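(* Let $I$ be a quasiconcave function satisfying $$\int_0^t \frac{I(s)}{s}\,ds\lesssim I(t),\quad t\in(0,1),$$ and let $X$ be an r.i. space. Then $$\|f\|_{Y_X}\approx\sup\left\{\int_0^1-I(t)g^*(t)\,d f^*(t)\;:\; g\in\mathcal M_+(0,1),\ \|S_Ig\|_{X'}\leq 1\right\}+\|f\|_1,\quad f\in\mathcal M_+(0,1),$$ where $\int_0^1 -I(t)g^*(t)\,df^*(t)$ is the Lebesgue–Stieltjes integral with respect to the nonincreasing function $f^*$.
   Context: All functions are defined on $(0,1)$ with Lebesgue measure; $\mathcal M_+(0,1)$ is the set of nonnegative measurable functions. $f^*(t)=\inf\{\lambda\ge0:|\{|f|>\lambda\}|\le t\}$ is the nonincreasing rearrangement. An r.i. (rearrangement-invariant Banach function) norm is a map $\rho:\mathcal M_+(0,1)\to[0,\infty]$ which is a norm (with $\rho(f)=0$ iff $f=0$ a.e.), satisfies $f\le g$ a.e. $\Rightarrow\rho(f)\le\rho(g)$, $f_n\nearrow f$ a.e. $\Rightarrow \rho(f_n)\nearrow\rho(f)$, $\rho(\chi_{(0,1)})<\infty$, $\int_0^1 f\lesssim \rho(f)$, and $\rho(f)=\rho(f^* )$; the r.i. space $X$ consists of measurable $f$ with $\|f\|_X=\rho(|f|)<\infty$. The associate space $X'$ has norm $\|g\|_{X'}=\sup_{\|f\|_X\le1}\int_0^1 fg$. $A\lesssim B$ means $A\le CB$ with $C$ independent of the functions and variables involved; $A\approx B$ means both $A\lesssim B$ and $B\lesssim A$. A quasiconcave function is a nondecreasing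 bijection $I:(0,1)\to(0,1)$ with $I(0+)=0$, $I(1-)=1$ and $t\mapsto I(t)/t$ nonincreasing. $S_If(t)=\frac{1}{I(t)}\sup_{0<s\le t}I(s)f^*(s)$ and $H_If(t)=\int_t^1\frac{f(s)}{I(s)}ds$ for $f\in\mathcal M_+(0,1)$, $t\in(0,1)$. An operator $T$ is bounded from $X$ to $Y$ if $\|Tf\|_Y\lesssim\|f\|_X$. $Y_X$ denotes the optimal target space of $X$ under $H_I$: the r.i. space such that $H_I:X\to Y_X$ is bounded and $Y_X\hookrightarrow Z$ for every r.i. space $Z$ with $H_I:X\to Z$ bounded (it exists and is unique up to equivalent norms). *)

(* Defs.v *)
(* R : realType, Lebesgue measure on R,
   functions on (0,1) represented as R -> \bar R (values outside ]0,1[ ignored). *)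
From HB Require Import structures.
From mathcomp Require Import all_boot all_order all_algebra.
From mathcomp Require Import all_classical all_reals all_analysis.
From mathcomp Require Import measurable_realfun.
Set Implicit Arguments.
Unset Strict Implicit.
Unset Printing Implicit Defensive.
Import Order.TTheory GRing.Theory Num.Theory.
Import numFieldNormedType.Exports.
Local Open Scope classical_set_scope.
Local Open Scope ring_scope.
Local Open Scope ereal_scope.

Section defs.
Context {R : realType}.
Local Notation mu := (@lebesgue_measure R).

Definition Dom : set R := `]0%R, 1%R[.

Definition Mplus (f : R -> \bar R) : Prop :=
  measurable_fun Dom f /\ (forall x, Dom x -> 0 <= f x).

Definition fstar (f : R -> \bar R) (t : R) : \bar R :=
  ereal_inf [set l%:E | l in
    [set l : R | (0 <= l)%R /\ mu (Dom `&` [set x | l%:E < `|f x|]) <= t%:E]].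

Definition ri_norm (rho : (R -> \bar R) -> \bar R) : Prop :=
  (forall f, Mplus f -> 0 <= rho f) /\
  (forall f, Mplus f -> (rho f = 0 <-> {ae mu, forall x, Dom x -> f x = 0})) /\
  (forall f g, Mplus f -> Mplus g -> rho (f \+ g) <= rho f + rho g) /\
  (forall (a : R) f, (0 <= a)%R -> Mplus f ->
      rho (fun x => a%:E * f x) = a%:E * rho f) /\
  (forall f g, Mplus f -> Mplus g ->
      {ae mu, forall x, Dom x -> f x <= g x} -> rho f <= rho g) /\
  (forall (F : nat -> R -> \bar R) f, (forall n, Mplus (F n)) -> Mplus f ->
      {ae mu, forall x, Dom x ->
         {homo (fun n => F n x) : n m / (n <= m)%N >-> n <= m} /\
         ((fun n => F n x) @ \oo --> f x)} ->
      {homo (fun n => rho (F n)) : n m / (n <= m)%N >-> n <= m} /\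
      ((fun n => rho (F n)) @ \oo --> rho f)) /\
  rho (cst 1) < +oo /\
  (exists C : R, (0 < C)%R /\
      forall f, Mplus f -> \int[mu]_(x in Dom) f x <= C%:E * rho f) /\
  (forall f, Mplus f -> rho f = rho (fstar f)).

Definition assoc_norm (rho : (R -> \bar R) -> \bar R) (g : R -> \bar R) : \bar R :=
  ereal_sup [set \int[mu]_(x in Dom) (f x * g x) | f in [set f | Mplus f /\ rho f <= 1]].

Definition quasiconcave (I : R -> R) : Prop :=
  [/\ set_bij Dom Dom I,
      (forall s t, Dom s -> Dom t -> (s <= t)%R -> (I s <= I t)%R),
      (I @ (0:R)^'+ --> (@GRing.zero R)),
      (I @ (1:R)^'- --> (@GRing.one R)) &
      (forall s t, Dom s -> Dom t -> (s <= t)%R -> (I t / t <= I s / s)%R)].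

Definition S_op (I : R -> R) (g : R -> \bar R) (t : R) : \bar R :=
  ((I t)^-1)%:E * ereal_sup [set (I s)%:E * fstar g s | s in `]0%R, t]].

Definition H_op (I : R -> R) (f : R -> \bar R) (t : R) : \bar R :=
  \int[mu]_(s in `]t, 1%R[) (f s * ((I s)^-1)%:E).

Definition H_bounded (I : R -> R) (rhoX rhoY : (R -> \bar R) -> \bar R) : Prop :=
  exists C : R, (0 < C)%R /\
    forall f, Mplus f -> rhoY (H_op I f) <= C%:E * rhoX f.

Definition embeds (rhoY rhoZ : (R -> \bar R) -> \bar R) : Prop :=
  exists C : R, (0 < C)%R /\ forall f, Mplus f -> rhoZ f <= C%:E * rhoY f.

Definition optimal_target (I : R -> R) (rhoX rhoY : (R -> \bar R) -> \bar R) : Prop :=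
  [/\ ri_norm rhoY, H_bounded I rhoX rhoY &
      forall rhoZ, ri_norm rhoZ -> H_bounded I rhoX rhoZ -> embeds rhoY rhoZ].

(* Lebesgue--Stieltjes integral over (0,1) of h >= 0 with respect to the
   nonnegative measure -dF, F nonincreasing (right-continuous) on (0,1).
   For a in (0,1), the Lebesgue--Stieltjes measure of any cumulative G with
   G = -F on [a,1) restricted to ]a,1[ depends only on F; the integral over
   (0,1) is the increasing limit (supremum) over a -> 0+ of the integrals over
   ]a,1[.  (Truncated below by 0: the integral of h >= 0 is >= 0.) *)
Definition stieltjes_neg (F h : R -> \bar R) : \bar R :=
  maxe 0 (ereal_sup [set y | exists (a : R) (G : cumulative R R),
     [/\ (0 < a < 1)%R,
         (forall t, (a <= t)%R -> (t < 1)%R -> (G t)%:E = - F t) &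
         y = \int[lebesgue_stieltjes_measure G]_(x in `]a, 1%R[) h x]]).

Definition rhs_norm (I : R -> R) (rhoX : (R -> \bar R) -> \bar R) (f : R -> \bar R) : \bar R :=
  ereal_sup [set stieltjes_neg (fstar f) (fun t => (I t)%:E * fstar g t) |
               g in [set g | Mplus g /\ assoc_norm rhoX (S_op I g) <= 1]]
  + \int[mu]_(x in Dom) f x.

End defs.

(* Main.v *)
Require Import Defs.
From HB Require Import structures.
From mathcomp Require Import all_boot all_order all_algebra perm.
From mathcomp Require Import all_classical all_reals all_analysis.
From mathcomp Require Import measurable_realfun.
From mathcomp Require Import ring lra zify.
Set Implicit Arguments.
Unset Strict Implicit.
Unset Printing Implicit Defensive.
Import Order.TTheory GRing.Theory Num.Theory.
Import numFieldNormedType.Exports.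
Local Open Scope classical_set_scope.
Local Open Scope ring_scope.
Local Open Scope ereal_scope.

(* With K(t) = \int_0^t k, Fubini gives \int (H_I h) k = \int h K / I, so a
   nonincreasing k lies in the associate unit ball of the optimal target as soon
   as K / I lies in the associate unit ball of X.  The functionals
   f |-> \int f^* (k + 1), over all such dyadic step functions k, have as supremum
   an r.i. norm Z with H_I : X -> Z bounded, hence Y_X embeds into Z.

   Upper bound on the right-hand side: phi(t) = sup_{s <= t} I(s) g^*(s) is
   quasiconcave, hence equivalent to a concave K, for which K / I is comparable
   with S_I g; summation by parts turns \int phi d(-f^* ) into \int f^* k <= ||f||_Z.

   Lower bound: a finite-dimensional Hahn-Banach argument yields, for a step
   function f_n below f^*, a norming k, automatically nonincreasing.  Then K / I
   lies in a ball of X', its least nonincreasing majorant g satisfies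
   S_I g <= 2 g and K <= I g, and g is comparable with the rearrangement of K / I
   because K / I doubles.  Summation by parts again compares \int f_n k with
   \int I g d(-f^* ), up to a multiple of ||f||_1. *)

(** * Rearrangements *)

(** Dyadic discretisation stands in for the duality theory of r.i. spaces. A step function with 2^n
    values is a vector, so norming it takes Hahn-Banach in finite dimension only, and the Fatou
    property lets the samples of f^* increase to f^*. The price is that functionals are first
    bounded on step functions alone. Such a bound extends to all functions because averaging over
    dyadic cells is a contraction, which follows from the triangle inequality and the invariance
    under exchanging neighbouring cells.

    Both special terms come from the end point 1. The Stieltjes integral over (0,1) does not see the
    jump of f^* at 1 and vanishes on constants; ||f||_1 pays for the last dyadic cell. Moreover
    (K/I)(s) >= (K/I)(t)/2 for t <= s <= 2t is of use only while 2t < 1. On the right half I is at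
    least I(1/2)/2, so K/I is bounded there by a constant, and the embedding of X into L^1 takes
    care of that part. *)

Section rearrangement.
Context {R : realType}.
Local Notation mu := (@lebesgue_measure R).
Local Notation Dom := (@Dom R).
Implicit Types (f g : R -> \bar R) (l t : R).

(** The form in which [lt_fstar] turns an inequality between rearrangements into one between
    distribution functions, level by level. *)
Lemma le_ereal_real (x y : \bar R) : 0 <= y ->
  (forall l : R, (0 <= l)%R -> l%:E < x -> l%:E < y) -> x <= y.
Proof.
move=> y0 h; rewrite leNgt; apply/negP => yx.
case: y y0 yx h => [r| |//] r0 rx h; last by rewrite ltNge leey in rx.
by have := h r r0 rx; rewrite ltxx.
Qed.

Lemma nondecreasing_cvg_ereal_sup (u : nat -> \bar R) (y : \bar R) :
  {homo u : n m / (n <= m)%N >-> n <= m} -> u @ \oo --> y -> y = ereal_sup (range u).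
Proof.
by move=> nu uy; apply: cvg_unique uy _ => //; exact: ereal_nondecreasing_cvgn.
Qed.

Lemma ae_imp (P Q : R -> Prop) : {ae mu, forall x, Dom x -> P x} ->
  (forall x, Dom x -> P x -> Q x) -> {ae mu, forall x, Dom x -> Q x}.
Proof.
move=> [N [mN N0 sN]] PQ; exists N; split => //.
by apply: subset_trans sN => x /= nQ; apply: contra_not nQ => + Dx => /(_ Dx); exact: PQ.
Qed.

Lemma measureD0 (A N : set R) : measurable A -> measurable N -> mu N = 0 ->
  mu (A `\` N) = mu A.
Proof.
move=> mA mN N0; rewrite [RHS](measureDI mu mA mN).
rewrite [X in _ + X](_ : _ = 0) ?adde0//.
by apply: (subset_measure0 _ _ _ N0) => //; exact: measurableI.
Qed.

Lemma measurable_Dom : measurable Dom.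
Proof. exact: measurable_itv. Qed.

Lemma mu_Dom : mu Dom = 1.
Proof. by rewrite lebesgue_measure_itv/= lte_fin ltr01 oppr0 adde0. Qed.

Definition distr f l : \bar R := mu (Dom `&` [set x | l%:E < f x]).

Lemma measurable_superlevel f l :
  Mplus f -> measurable (Dom `&` [set x | l%:E < f x]).
Proof. by move=> [mf _]; apply: emeasurable_fun_o_infty => //; exact: measurable_Dom. Qed.

Lemma distr_ge0 f l : 0 <= distr f l.
Proof. exact: measure_ge0. Qed.

Lemma distr_le1 f l : Mplus f -> distr f l <= 1.
Proof.
move=> mf; rewrite -mu_Dom; apply: le_measure; rewrite ?inE.
- exact: measurable_superlevel.
- exact: measurable_Dom.
- exact: subIsetl.
Qed.

Lemma distr_fin f l : Mplus f -> distr f l \is a fin_num.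
Proof.
move=> mf; rewrite ge0_fin_numE ?distr_ge0//.
by rewrite (le_lt_trans (distr_le1 _ mf))// ltry.
Qed.

Lemma distr_nonincr f l m : Mplus f -> (l <= m)%R -> distr f m <= distr f l.
Proof.
move=> mf lm; apply: le_measure; rewrite ?inE; try exact: measurable_superlevel.
by move=> x [Dx /= mx]; split => //=; apply: le_lt_trans mx; rewrite lee_fin.
Qed.

(** The superlevel set at l is the increasing union of those at l + 1/(n+1); the measure is
    continuous from below. *)
Lemma distr_right_cont f l (y : \bar R) : Mplus f ->
  (forall n, distr f (l + n.+1%:R^-1)%R <= y) -> distr f l <= y.
Proof.
move=> mf h.
pose F n := Dom `&` [set x | (l + n.+1%:R^-1)%:E < f x].
have UF : \bigcup_n F n = Dom `&` [set x | l%:E < f x].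
  apply/seteqP; split => [x [n _ [Dx /= nx]]|x [Dx /= lx]].
    by split => //=; apply: lt_trans nx; rewrite lte_fin ltrDl.
  have [n nx] : exists n : nat, (l + n.+1%:R^-1)%:E < f x.
    case: (f x) lx => [r| |//] lx; last by exists 0%N; rewrite ltry.
    rewrite lte_fin -subr_gt0 in lx.
    have [n nr] := ltr_add_invr lx.
    by exists n; rewrite lte_fin addrC -ltrBrDr; rewrite add0r in nr.
  by exists n.
have mF n : measurable (F n) by exact: measurable_superlevel.
have /cvg_lim <-// : mu \o F @ \oo --> distr f l.
  rewrite /distr -UF; apply: nondecreasing_cvg_mu => //.
    exact: bigcupT_measurable.
  move=> n m nm; apply/subsetPset => x [Dx /= nx]; split => //=.
  apply: le_lt_trans nx; rewrite lee_fin lerD2l lef_pV2 ?posrE ?ltr0n//.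
  by rewrite ler_nat.
apply: lime_le; last by apply: nearW => n; exact: h.
apply: ereal_nondecreasing_is_cvgn => n m nm; apply: distr_nonincr => //.
by rewrite lerD2l lef_pV2 ?posrE ?ltr0n// ler_nat.
Qed.

Lemma fstarE f t : Mplus f -> fstar f t =
  ereal_inf [set l%:E | l in [set l : R | (0 <= l)%R /\ distr f l <= t%:E]].
Proof.
move=> [_ f0]; rewrite /fstar; congr (ereal_inf (_ @` _)).
apply/funext => l /=; rewrite /distr; congr (_ /\ mu _ <= _).
apply/seteqP; split => x [Dx /=] h; split => //=.
  by rewrite gee0_abs ?f0// in h.
by rewrite gee0_abs ?f0.
Qed.

(** The infimum defining f^* is attained, by right continuity of the distribution function, so f^*
    and the distribution function are generalized inverses of each other. Most facts on
    rearrangements below go through this equivalence. *)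
Lemma lt_fstar f l t : Mplus f -> (0 <= l)%R ->
  (l%:E < fstar f t) = (t%:E < distr f l).
Proof.
move=> mf l0; rewrite !ltNge fstarE//; congr (~~ _); apply/idP/idP => h.
  apply: distr_right_cont => // n.
  have /ereal_inf_lt[_ [m [m0 mt] <-] ml] :
    ereal_inf [set l%:E | l in [set l : R | (0 <= l)%R /\ distr f l <= t%:E]] <
    (l + n.+1%:R^-1)%:E.
    by apply: le_lt_trans h _; rewrite lte_fin ltrDl.
  by apply: le_trans mt; apply: distr_nonincr => //; apply/ltW; rewrite lte_fin in ml.
by apply: ereal_inf_lbound; exists l.
Qed.

Lemma fstar_ge0 f t : 0 <= fstar f t.
Proof. by apply: le_ereal_inf_tmp => _ [l [l0 _] <-]; rewrite lee_fin. Qed.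

Lemma fstar_nonincr f s t : (s <= t)%R -> fstar f t <= fstar f s.
Proof.
move=> st; apply: ereal_inf_le_tmp => _ [l [l0 ls] <-]; exists l => //; split => //.
by apply: le_trans ls _; rewrite lee_fin.
Qed.

Lemma eq_fstar f g : Mplus f -> Mplus g ->
  (forall l, (0 <= l)%R -> distr f l = distr g l) -> fstar f = fstar g.
Proof.
move=> mf mg fg; apply/funext => t; apply/eqP; rewrite eq_le; apply/andP; split.
  by apply: le_ereal_real => [|l l0]; rewrite ?fstar_ge0// !lt_fstar// fg.
by apply: le_ereal_real => [|l l0]; rewrite ?fstar_ge0// !lt_fstar// fg.
Qed.

Lemma nonincr_emeasurable (D : set R) (F : R -> \bar R) : is_interval D ->
  (forall s t, D s -> D t -> (s <= t)%R -> F t <= F s) -> measurable_fun D F.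
Proof.
move=> iD nF mD; apply: (measurability _ (ErealGenOInfty.measurableE R)) => //.
move=> _ [_ [r ->] <-]; apply: is_interval_measurable => s t.
move=> [Ds]/=; rewrite in_itv/= andbT => rs [Dt]/=; rewrite in_itv/= andbT => rt.
move=> u /andP[su ut]; split; first by apply: (iD s t) => //; rewrite su.
rewrite /= in_itv/= andbT; apply: lt_le_trans rt _; apply: nF => //.
by apply: (iD s t) => //; rewrite su.
Qed.

Lemma nondecr_emeasurable (D : set R) (F : R -> \bar R) : is_interval D ->
  (forall s t, D s -> D t -> (s <= t)%R -> F s <= F t) -> measurable_fun D F.
Proof.
move=> iD nF mD; apply: (measurability _ (ErealGenOInfty.measurableE R)) => //.
move=> _ [_ [r ->] <-]; apply: is_interval_measurable => s t.
move=> [Ds]/=; rewrite in_itv/= andbT => rs [Dt]/=; rewrite in_itv/= andbT => rt.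
move=> u /andP[su ut]; split; first by apply: (iD s t) => //; rewrite su.
rewrite /= in_itv/= andbT; apply: lt_le_trans rs _; apply: nF => //.
by apply: (iD s t) => //; rewrite su.
Qed.

Lemma Dom_interval : is_interval Dom.
Proof. exact: interval_is_interval. Qed.

Lemma Mplus_nonincr (F : R -> \bar R) :
  (forall s t, Dom s -> Dom t -> (s <= t)%R -> F t <= F s) ->
  (forall t, Dom t -> 0 <= F t) -> Mplus F.
Proof. by move=> nF F0; split => //; apply: nonincr_emeasurable => //; exact: Dom_interval. Qed.

Lemma Mplus_fstar f : Mplus (fstar f).
Proof.
apply: Mplus_nonincr => *; last exact: fstar_ge0.
exact: fstar_nonincr.
Qed.

(** By [lt_fstar] the superlevel set of f^* at l is the initial interval whose length is the
    distribution function of f at l. *)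
Lemma distr_fstar f l : Mplus f -> (0 <= l)%R -> distr (fstar f) l = distr f l.
Proof.
move=> mf l0.
rewrite /distr (_ : Dom `&` [set x | l%:E < fstar f x] = `]0%R, fine (distr f l)[%classic); last first.
  have d1 := distr_le1 l mf; have df := distr_fin l mf.
  apply/seteqP; split => t /=; rewrite /Dom /= !in_itv/=.
    move=> [/andP[-> _]/=]; rewrite lt_fstar// => td.
    by rewrite -lte_fin fineK.
  move=> /andP[t0 td]; rewrite lt_fstar// t0 /=.
  have td' : t%:E < distr f l by rewrite -(fineK df) lte_fin.
  by split => //; rewrite -lte_fin (lt_le_trans td').
rewrite lebesgue_measure_itv/= lte_fin.
case: ifPn => [_|]; first by rewrite fineK ?distr_fin// oppr0 adde0.
rewrite -leNgt => d0; apply/esym/eqP; rewrite eq_le distr_ge0 andbT.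
by rewrite -/(distr f l) -(fineK (distr_fin l mf)) lee_fin.
Qed.

Lemma fstar_fstar f : Mplus f -> fstar (fstar f) = fstar f.
Proof.
move=> mf; apply: eq_fstar => // [|l l0]; first exact: Mplus_fstar.
exact: distr_fstar.
Qed.

Lemma fstar_le f g t : Mplus f -> Mplus g ->
  {ae mu, forall x, Dom x -> f x <= g x} -> fstar f t <= fstar g t.
Proof.
move=> mf mg [N [mN N0 sN]].
apply: le_ereal_real => [|l l0]; first exact: fstar_ge0.
rewrite !lt_fstar// => h; apply: lt_le_trans h _.
have -> : distr g l = mu ((Dom `&` [set x | (l%:E < g x)%E]) `|` N).
  by rewrite measureU0//; exact: measurable_superlevel.
apply: le_measure; rewrite ?inE; first exact: measurable_superlevel.
  by apply: measurableU => //; exact: measurable_superlevel.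
move=> x [Dx /= lx]; have [fg|fg] := leP (f x) (g x).
  by left; split => //=; exact: lt_le_trans fg.
by right; apply: sN => /= /(_ Dx); rewrite leNgt fg.
Qed.

Lemma fstar_scale (a : R) f t : (0 < a)%R -> Mplus f ->
  fstar (fun x => a%:E * f x) t = a%:E * fstar f t.
Proof.
move=> a0 mf.
have maf : Mplus (fun x => a%:E * f x).
  case: mf => mf f0; split; first by apply: measurable_funeM.
  by move=> x Dx; rewrite mule_ge0 ?f0// lee_fin ltW.
have key (l : R) (x : \bar R) : (l%:E < a%:E * x) = ((l / a)%:E < x).
  by rewrite mulrC EFinM lte_pdivrMl.
apply/eqP; rewrite eq_le; apply/andP; split; apply: le_ereal_real => [|l l0].
- by rewrite mule_ge0 ?fstar_ge0// lee_fin ltW.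
- rewrite key !lt_fstar ?divr_ge0 ?(ltW a0)// /distr.
  by under eq_set do rewrite key.
- exact: fstar_ge0.
- rewrite key !lt_fstar ?divr_ge0 ?(ltW a0)// /distr.
  by under [X in _ -> _ < mu (_ `&` X)]eq_set do rewrite key.
Qed.

Lemma fstar_cvg (F : nat -> R -> \bar R) f t : (forall n, Mplus (F n)) -> Mplus f ->
  {ae mu, forall x, Dom x ->
     {homo (fun n => F n x) : n m / (n <= m)%N >-> n <= m} /\
     ((fun n => F n x) @ \oo --> f x)} ->
  {homo (fun n => fstar (F n) t) : n m / (n <= m)%N >-> n <= m} /\
  ((fun n => fstar (F n) t) @ \oo --> fstar f t).
Proof.
move=> mF mf aeF.
have nd : {homo (fun n => fstar (F n) t) : n m / (n <= m)%N >-> n <= m}.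
  move=> n m nm; apply: fstar_le => //.
  by apply: (ae_imp aeF) => x Dx h; apply: h.1.
split => //.
have -> : fstar f t = ereal_sup (range (fun n => fstar (F n) t)).
  apply/eqP; rewrite eq_le; apply/andP; split; last first.
    apply: ge_ereal_sup => _ [n _ <-]; apply: fstar_le => //.
    apply: (ae_imp aeF) => x Dx [ndx cx].
    by rewrite (nondecreasing_cvg_ereal_sup ndx cx); apply: ereal_sup_ubound; exists n.
  apply: le_ereal_real => [|l l0].
    by apply: le_trans (fstar_ge0 (F 0%N) t) _; apply: ereal_sup_ubound; exists 0%N.
  rewrite lt_fstar// => h.
  (* Off the exceptional null set the superlevel sets of [F n] increase to that of f, whose measure
     exceeds t; hence one of them already has measure above t. *)
  have [n hn] : exists n, t%:E < distr (F n) l.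
    case: aeF => N [mN N0 sN].
    pose A n := (Dom `&` [set x | l%:E < F n x]) `\` N.
    have mA n : measurable (A n).
      by apply: measurableD => //; exact: measurable_superlevel.
    have UA : \bigcup_n A n = (Dom `&` [set x | l%:E < f x]) `\` N.
      have sNE x : ~ N x -> Dom x -> f x = ereal_sup (range (fun n => F n x)).
        move=> Nx Dx.
        have /contrapT /(_ Dx)[ndx cx] := contra_not (sN x) Nx.
        exact: nondecreasing_cvg_ereal_sup.
      apply/seteqP; split => [x [n _ [[Dx /= lx] Nx]]|x [[Dx /= lx] Nx]].
        split => //; split => //=; apply: lt_le_trans lx _.
        by rewrite (sNE x Nx Dx); apply: ereal_sup_ubound; exists n.
      move: lx; rewrite (sNE x Nx Dx) => /ereal_sup_gt[_ [n _ <-] nx].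
      by exists n.
    have muA n : mu (A n) = distr (F n) l.
      by apply: measureD0 => //; exact: measurable_superlevel.
    have ndA : {homo A : n m / (n <= m)%N >-> (n <= m)%O}.
      move=> n m nm; apply/subsetPset => x [[Dx /= lx] Nx]; split => //; split => //=.
      have /contrapT /(_ Dx)[ndx cx] := contra_not (sN x) Nx.
      exact: lt_le_trans lx (ndx _ _ nm).
    have mUA : measurable (\bigcup_n A n) by exact: bigcupT_measurable.
    have cA : (mu \o A) @ \oo --> mu (\bigcup_n A n) by exact: nondecreasing_cvg_mu.
    have ndmu : {homo (mu \o A) : n m / (n <= m)%N >-> n <= m}.
      move=> n m nm; apply: le_measure; rewrite ?inE; try exact: mA.
      by apply/subsetPset; exact: ndA.
    move: h; rewrite -[distr f l](measureD0 _ mN N0); last exact: measurable_superlevel.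
    rewrite -UA (nondecreasing_cvg_ereal_sup ndmu cA) => /ereal_sup_gt[_ [n _ <-] nx].
    by exists n; rewrite -muA.
  apply: lt_le_trans (ereal_sup_ubound _); last by exists n.
  by rewrite lt_fstar.
exact: ereal_nondecreasing_cvgn.
Qed.

End rearrangement.

(** * Layer cake formula and the integrals of rearrangements over initial segments *)

Section layer_cake.
Context {R : realType}.
Local Notation mu := (@lebesgue_measure R).
Local Notation Dom := (@Dom R).
Implicit Types (f g : R -> \bar R) (l t : R).

Lemma mu_ray_lt (y : \bar R) : 0 <= y -> mu [set l : R | (0 <= l)%R /\ l%:E < y] = y.
Proof.
case: y => [r| |//] y0.
  have -> : [set l : R | (0 <= l)%R /\ l%:E < r%:E] = `[0%R, r[%classic.
    apply/seteqP; split => l /=; rewrite in_itv/= lte_fin; first by move=> [-> ->].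
    by move=> /andP.
  rewrite lebesgue_measure_itv/= lte_fin oppr0 adde0.
  rewrite lee_fin in y0; case: ltgtP y0 => // <-//.
have -> : [set l : R | (0 <= l)%R /\ l%:E < +oo] = `[0%R, +oo[%classic.
  apply/seteqP; split => l /=; rewrite in_itv/= ltry andbT; first by case.
  by [].
by rewrite lebesgue_measure_itv/= ltry.
Qed.

(** Tonelli for the indicator of the region [A] below the graph. *)
Lemma ge0_integral_distr f : Mplus f ->
  \int[mu]_(x in Dom) f x = \int[mu]_(l in `[0%R, +oo[) distr f l.
Proof.
move=> [mf f0]; pose g := f \_ Dom.
have mg : measurable_fun setT g.
  by apply/(measurable_restrictT _ measurable_Dom).
have g0 x : 0 <= g x by rewrite /g; apply: erestrict_ge0.
pose A := [set p : R * R | (0 <= p.2)%R /\ p.2%:E < g p.1].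
have mA : measurable (A : set (measurableTypeR R * measurableTypeR R)).
  have -> : A = (setT `&` [set p : R * R | (0 <= p.2)%R]) `&`
                (setT `&` [set p | p.2%:E < g p.1]).
    by apply/seteqP; split => p /=; rewrite /A/=; tauto.
  apply: measurableI.
    rewrite (_ : _ `&` _ = setT `&` (@snd R R @^-1` `[0%R, +oo[)).
      by apply: measurable_snd => //; exact: measurable_itv.
    by apply/seteqP; split => p /=; rewrite in_itv/= andbT.
  apply: (@measurable_lte _ _ _ setT measurableT (fun p : R * R => p.2%:E) (g \o fst)).
    by apply/measurable_EFinP; exact: measurable_snd.
  by apply: measurableT_comp => //; exact: measurable_fst.
transitivity (\int[mu]_x \int[mu]_l (\1_A (x, l))%:E).
  rewrite integral_mkcond -/g; apply: eq_integral => x _.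
  rewrite -[LHS](mu_ray_lt (g0 x)) -[X in mu X]setIT.
  rewrite -integral_indic//; last first.
    have -> : [set l : R | (0 <= l)%R /\ l%:E < g x] = xsection A x.
      by apply/seteqP; split => l /=; rewrite /xsection /= inE.
    exact: measurable_xsection.
rewrite (@fubini_tonelli _ _ _ _ _ mu mu (fun p => (\1_A p)%:E)); last 2 first.
- by apply/measurable_EFinP; exact: measurable_indic.
- by move=> p; rewrite lee_fin.
rewrite [RHS]integral_mkcond; apply: eq_integral => l _ /=.
have mB : measurable (Dom `&` [set x | l%:E < f x]) by exact: measurable_superlevel.
rewrite patchE; case: ifPn; rewrite ?inE ?notin_setE /= in_itv/= andbT => l0.
  rewrite /distr -[X in _ = mu X]setIT -integral_indic//.
  apply: eq_integral => x _; rewrite !indicE; congr (nat_of_bool _)%:R%:E.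
  apply/idP/idP; rewrite !inE /A /g /= patchE; last first.
    by move=> [Dx lx]; rewrite mem_set.
  case: (boolP (x \in Dom)) => Dx [_ h]; first by rewrite inE in Dx.
  by have : l%:E < 0 := h; rewrite ltNge lee_fin l0.
apply: integral0_eq => x _; rewrite indicE memNset// => -[/=].
by move=> l0'; rewrite l0' in l0.
Qed.

Lemma integral_fstar f : Mplus f ->
  \int[mu]_(x in Dom) fstar f x = \int[mu]_(x in Dom) f x.
Proof.
move=> mf; rewrite !ge0_integral_distr//; last exact: Mplus_fstar.
by apply: eq_integral => l; rewrite inE/= in_itv/= andbT => l0; rewrite distr_fstar.
Qed.

(** The excess of f over the level l. Its integral is invariant under rearrangement, and at the
    level l = f^*(t) it yields a closed formula for the integral of f^* over (0,t). *)
Definition posd f l (x : R) : \bar R := maxe (f x - l%:E) 0.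

Lemma Mplus_posd f l : Mplus f -> Mplus (posd f l).
Proof.
move=> [mf f0]; split => [|x Dx]; last by rewrite /posd le_max lexx orbT.
apply: measurable_maxe => //; apply: emeasurable_funB => //.
Qed.

Lemma distr_posd f l m : (0 <= m)%R -> distr (posd f l) m = distr f (m + l).
Proof.
move=> m0; rewrite /distr; congr (mu (_ `&` _)); apply/funext => x /=.
rewrite /posd lt_max [X in _ || X]ltNge lee_fin m0 orbF.
by rewrite lteBrDr// EFinD.
Qed.

Lemma integral_posd_fstar f l : Mplus f -> (0 <= l)%R ->
  \int[mu]_(x in Dom) posd (fstar f) l x = \int[mu]_(x in Dom) posd f l x.
Proof.
move=> mf l0; have mfs := Mplus_fstar f.
rewrite !ge0_integral_distr//; try exact: Mplus_posd.
apply: eq_integral => m; rewrite inE/= in_itv/= andbT => m0.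
by rewrite !distr_posd// distr_fstar// addr_ge0.
Qed.

Definition headint f t : \bar R := \int[mu]_(x in `]0%R, t[) f x.

Lemma head_subDom t : (t <= 1)%R -> `]0%R, t[ `<=` Dom.
Proof.
move=> t1 x /=; rewrite /Dom /= !in_itv/= => /andP[-> xt]/=.
exact: lt_le_trans t1.
Qed.

Lemma Mplus_head f t : Mplus f -> (t <= 1)%R ->
  measurable_fun `]0%R, t[ f /\ forall x, `]0%R, t[%classic x -> 0 <= f x.
Proof.
move=> [mf f0] t1; split; last by move=> x /(head_subDom t1); exact: f0.
by apply: measurable_funS mf; [exact: measurable_Dom|exact: head_subDom].
Qed.

Lemma mu_head t : (0 <= t)%R -> mu `]0%R, t[ = t%:E.
Proof.
move=> t0; rewrite lebesgue_measure_itv/= lte_fin oppr0 adde0.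
by case: ltgtP t0 => // <-.
Qed.

Lemma integral_cst_head (r : \bar R) t : (0 <= t)%R ->
  \int[mu]_(x in `]0%R, t[) r = r * t%:E.
Proof.
by move=> t0; rewrite -(mu_head t0) -[RHS]integral_cst//; exact: measurable_itv.
Qed.

(** Integrate f <= l + (f - l)_+ over (0,t). *)
Lemma headint_le_posd f l t : Mplus f -> (0 <= l)%R -> (0 <= t <= 1)%R ->
  headint f t <= (t * l)%:E + \int[mu]_(x in Dom) posd f l x.
Proof.
move=> mf l0 /andP[t0 t1].
have [mft f0] := Mplus_head mf t1.
have [mpt p0] := Mplus_head (Mplus_posd l mf) t1.
have mI : measurable (`]0%R, t[%classic : set R) by exact: measurable_itv.
apply: (@le_trans _ _ (\int[mu]_(x in `]0%R, t[) (l%:E + posd f l x))).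
  apply: ge0_le_integral => // [|x tx].
    by apply: emeasurable_funD => //; exact: measurable_cst.
  by rewrite addeC -leeBlDr// /posd le_max lexx.
rewrite ge0_integralD//.
apply: leeD.
  by rewrite integral_cst_head// mulrC EFinM.
apply: ge0_subset_integral => //; try exact: measurable_Dom.
- exact: (Mplus_posd l mf).1.
- exact: (Mplus_posd l mf).2.
- exact: head_subDom.
Qed.

(** The choice l = f^*(t) makes [headint_le_posd] sharp for f^*: the excess vanishes to the right of
    t, and f^* >= l to the left of t. *)
Lemma headint_fstarE f l t : Mplus f -> (0 < t <= 1)%R -> fstar f t = l%:E ->
  headint (fstar f) t = (t * l)%:E + \int[mu]_(x in Dom) posd f l x.
Proof.
move=> mf /andP[t0 t1] ftl.
have l0 : (0 <= l)%R by rewrite -lee_fin -ftl fstar_ge0.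
apply/eqP; rewrite eq_le -{1}integral_posd_fstar// headint_le_posd//=; last 2 first.
- exact: Mplus_fstar.
- by rewrite (ltW t0).
have mI : measurable (`]0%R, t[%classic : set R) by exact: measurable_itv.
have [mft f0] := Mplus_head (Mplus_fstar f) t1.
have [mpt p0] := Mplus_head (Mplus_posd l (Mplus_fstar f)) t1.
have [mpD pD] := Mplus_posd l (Mplus_fstar f).
rewrite -integral_posd_fstar//.
have -> : \int[mu]_(x in Dom) posd (fstar f) l x = \int[mu]_(x in `]0%R, t[) posd (fstar f) l x.
  rewrite [LHS]integral_mkcond [RHS]integral_mkcond; apply: eq_integral => x _.
  rewrite !patchE; case: ifPn; rewrite ?inE ?notin_setE => Dx.
    case: ifPn; rewrite ?inE ?notin_setE => //= tx.
    have xt : (t <= x)%R.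
      by rewrite leNgt; apply/negP => xt; apply: tx; rewrite in_itv/= xt andbT; case/andP: Dx.
    apply/max_idPr; rewrite -ftl sube_le0; exact: fstar_nonincr.
  case: ifPn => //; rewrite inE => /(head_subDom t1) Dx'; contradiction.
have -> : (t * l)%:E = \int[mu]_(x in `]0%R, t[) l%:E.
  by rewrite integral_cst_head 1?ltW// mulrC EFinM.
rewrite -ge0_integralD//.
apply: ge0_le_integral => //.
- by move=> x tx; rewrite adde_ge0// ?lee_fin//; exact: p0.
- by apply: emeasurable_funD => //; exact: measurable_cst.
move=> x; rewrite /= in_itv/= => /andP[x0 xt].
rewrite /posd; have h : l%:E <= fstar f x by rewrite -ftl; apply: fstar_nonincr; exact: ltW.
by rewrite max_l ?sube_ge0// addeC subeK.
Qed.

Lemma headint_fstar_pinfty f t : (0 < t <= 1)%R -> fstar f t = +oo ->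
  headint (fstar f) t = +oo.
Proof.
move=> /andP[t0 t1] ft; apply/eqP; rewrite -leye_eq.
have mI : measurable (`]0%R, t[%classic : set R) by exact: measurable_itv.
have [mft f0] := Mplus_head (Mplus_fstar f) t1.
apply: (@le_trans _ _ (\int[mu]_(x in `]0%R, t[) cst +oo x)).
  rewrite integral_cst_head; last exact: ltW.
  by rewrite /cst gt0_mulye.
apply: ge0_le_integral => // [x _|x /=]; first exact: leey.
rewrite in_itv/= => /andP[x0 xt].
by rewrite -ft; apply: fstar_nonincr; exact: ltW.
Qed.

Lemma fstar_real_or_pinfty f t : (exists l, fstar f t = l%:E) \/ fstar f t = +oo.
Proof. by have := fstar_ge0 f t; case: (fstar f t) => [l| |]// _; [left; exists l|right]. Qed.

Lemma headint_le_fstar f t : Mplus f -> (0 < t <= 1)%R -> headint f t <= headint (fstar f) t.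
Proof.
move=> mf t01; have [[l ftl]|ft] := fstar_real_or_pinfty f t; last first.
  by rewrite headint_fstar_pinfty// leey.
rewrite (headint_fstarE mf t01 ftl); apply: headint_le_posd => //.
  by rewrite -lee_fin -ftl fstar_ge0.
by case/andP: t01 => /ltW-> ->.
Qed.

Lemma MplusD f g : Mplus f -> Mplus g -> Mplus (f \+ g).
Proof.
move=> [mf f0] [mg g0]; split; first exact: emeasurable_funD.
by move=> x Dx; rewrite adde_ge0 ?f0 ?g0.
Qed.

(** With l = f^*(t) and m = g^*(t), use (f + g - l - m)_+ <= (f - l)_+ + (g - m)_+. The
    rearrangement itself is not subadditive, but its integrals over initial intervals are. *)
Lemma headint_fstarD f g t : Mplus f -> Mplus g -> (0 < t <= 1)%R ->
  headint (fstar (f \+ g)) t <= headint (fstar f) t + headint (fstar g) t.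
Proof.
move=> mf mg t01; have mfg := MplusD mf mg.
have t1 : (t <= 1)%R by case/andP: t01.
have h0 (h : R -> \bar R) : 0 <= headint (fstar h) t.
  by apply: integral_ge0 => x _; exact: fstar_ge0.
have [[l ftl]|ft] := fstar_real_or_pinfty f t; last first.
  by rewrite (headint_fstar_pinfty t01 ft) addye ?leey// gt_eqF// (lt_le_trans _ (h0 g)).
have [[m gtm]|gt] := fstar_real_or_pinfty g t; last first.
  by rewrite (headint_fstar_pinfty t01 gt) addey ?leey// gt_eqF// (lt_le_trans _ (h0 f)).
have l0 : (0 <= l)%R by rewrite -lee_fin -ftl fstar_ge0.
have m0 : (0 <= m)%R by rewrite -lee_fin -gtm fstar_ge0.
rewrite (headint_fstarE mf t01 ftl) (headint_fstarE mg t01 gtm).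
apply: le_trans (headint_le_posd (l := (l + m)%R) (Mplus_fstar _) _ _) _.
- exact: addr_ge0.
- by case/andP: t01 => /ltW-> ->.
rewrite integral_posd_fstar ?addr_ge0// mulrDr EFinD [leRHS]addeACA.
apply: (leeD (lexx _)).
have [mp p0] := Mplus_posd l mf; have [mq q0] := Mplus_posd m mg.
rewrite -ge0_integralD//; last exact: measurable_Dom.
have [mr r0] := Mplus_posd (l + m) mfg.
apply: ge0_le_integral => //; [exact: measurable_Dom|exact: emeasurable_funD|].
move=> x Dx; rewrite /posd ge_max; apply/andP; split; last first.
  by rewrite adde_ge0// le_max lexx orbT.
have fx := mf.2 x Dx; have gx := mg.2 x Dx.
apply: (@le_trans _ _ ((f x - l%:E) + (g x - m%:E))).
  by rewrite EFinD oppeD// addeACA.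
by apply: leeD; rewrite le_max lexx.
Qed.

End layer_cake.

(** * Dyadic step functions *)

Section dyadic.
Context {R : realType}.
Local Notation mu := (@lebesgue_measure R).
Local Notation Dom := (@Dom R).
Implicit Types (f g u : R -> \bar R) (n m i j : nat) (x : R) (v w k : nat -> R).

Definition dy n i : R := (i%:R / (2 ^ n)%:R)%R.

(** Evaluation through truncation makes the value on a cell a matter of rewriting; on (0,1) only the
    entries of [v] below 2^n are read. *)
Definition step n v x : \bar R := (v (Num.truncn (x * (2 ^ n)%:R)%R))%:E.

Definition cell n i : set R := Dom `&` `[dy n i, dy n i.+1[%classic.

Lemma exp2_gt0 n : (0 < (2 ^ n)%:R :> R)%R.
Proof. by rewrite ltr0n expn_gt0. Qed.

Lemma dy0 n : dy n 0 = 0%R.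
Proof. by rewrite /dy mul0r. Qed.

Lemma dy_ge0 n i : (0 <= dy n i)%R.
Proof. by rewrite divr_ge0. Qed.

Lemma dy_gt0 n i : (0 < dy n i.+1)%R.
Proof. by rewrite divr_gt0// exp2_gt0. Qed.

Lemma dy1 n : dy n (2 ^ n) = 1%R.
Proof. by rewrite /dy divff// gt_eqF// exp2_gt0. Qed.

Lemma dy_le n i j : (dy n i <= dy n j)%R = (i <= j)%N.
Proof. by rewrite ler_pM2r ?invr_gt0 ?exp2_gt0// ler_nat. Qed.

Lemma dy_lt n i j : (dy n i < dy n j)%R = (i < j)%N.
Proof. by rewrite ltr_pM2r ?invr_gt0 ?exp2_gt0// ltr_nat. Qed.

Lemma dy_le1 n i : (i <= 2 ^ n)%N -> (dy n i <= 1)%R.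
Proof. by move=> ?; rewrite -(dy1 n) dy_le. Qed.

Lemma dyS n i : dy n i.+1 = (dy n i + (2 ^ n)%:R^-1)%R.
Proof. by rewrite /dy -natr1 mulrDl mul1r. Qed.

Lemma dy_double n i : dy n.+1 i.*2 = dy n i.
Proof.
rewrite /dy expnS natrM invfM -muln2 natrM mulrACA.
by rewrite mulrA divfK ?pnatr_eq0.
Qed.

Lemma measurable_cell n i : measurable (cell n i).
Proof. by apply: measurableI; exact: measurable_itv. Qed.

Lemma cell_Dom n i : cell n i `<=` Dom.
Proof. by move=> x []. Qed.

Lemma cell_truncn n i x : cell n i x -> Num.truncn (x * (2 ^ n)%:R)%R = i.
Proof.
move=> [_ /=]; rewrite in_itv/= /dy => /andP[ix xi].
apply: truncn_def; rewrite -ler_pdivrMr ?exp2_gt0// ix/=.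
by rewrite -ltr_pdivlMr ?exp2_gt0.
Qed.

Lemma step_cell n v i x : cell n i x -> step n v x = (v i)%:E.
Proof. by move=> /cell_truncn xi; rewrite /step xi. Qed.

Lemma Dom_cell n x : Dom x ->
  cell n (Num.truncn (x * (2 ^ n)%:R)%R) x /\ (Num.truncn (x * (2 ^ n)%:R)%R < 2 ^ n)%N.
Proof.
move=> Dx; have := Dx; rewrite /Dom/= in_itv/= => /andP[x0 x1].
have xN0 : (0 <= x * (2 ^ n)%:R)%R by rewrite mulr_ge0// ltW.
have /andP[t1 t2] := truncn_itv xN0.
have h : (x * (2 ^ n)%:R < (2 ^ n)%:R)%R by rewrite gtr_pMl// exp2_gt0.
split; last by rewrite -(ltr_nat R); exact: le_lt_trans h.
by split => //=; rewrite in_itv/= /dy ler_pdivrMr ?exp2_gt0// t1 ltr_pdivlMr ?exp2_gt0.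
Qed.

Lemma cell_itv n i x : (i < 2 ^ n)%N -> (0 < x)%R -> (dy n i <= x < dy n i.+1)%R -> cell n i x.
Proof.
move=> iN x0 /andP[ix xi]; split => /=; last by rewrite in_itv/= ix.
by rewrite /Dom/= in_itv/= x0 (lt_le_trans xi)// dy_le1.
Qed.

Lemma headintS n i u : Mplus u -> (i < 2 ^ n)%N ->
  headint u (dy n i.+1) = headint u (dy n i) + \int[mu]_(x in cell n i) u x.
Proof.
move=> mu' iN.
have E : `]0%R, dy n i.+1[%classic = `]0%R, dy n i[%classic `|` cell n i.
  apply/seteqP; split => x /=.
    rewrite !in_itv/= => /andP[x0 xi]; have [xi'|xi'] := ltP x (dy n i).
      by left; rewrite x0.
    by right; apply: cell_itv => //; rewrite xi'.
  case; last first.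
    by move=> [/=]; rewrite /Dom /= !in_itv/= => /andP[-> _] /andP[_ ->].
  rewrite !in_itv/= => /andP[-> xi]/=; apply: lt_trans xi _; by rewrite dy_lt.
rewrite /headint E ge0_integral_setU//.
- exact: measurable_cell.
- by rewrite -E; apply: (Mplus_head mu' _).1; exact: dy_le1.
- by rewrite -E; apply: (Mplus_head mu' _).2; exact: dy_le1.
- apply/disj_setPS => x [] /=; rewrite in_itv/= => /andP[_ xi] [_ /=].
  by rewrite in_itv/= => /andP[/(lt_le_trans xi)]; rewrite ltxx.
Qed.

Lemma headint_sum n i u : Mplus u -> (i <= 2 ^ n)%N ->
  headint u (dy n i) = \sum_(j < i) \int[mu]_(x in cell n j) u x.
Proof.
move=> mu'; elim: i => [_|i IH iN].
  by rewrite big_ord0 dy0 /headint set_itv_ge ?integral_set0// bnd_simp ltxx.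
by rewrite headintS// IH ?(ltnW iN)// big_ord_recr.
Qed.

Lemma integral_Dom_sum n u : Mplus u ->
  \int[mu]_(x in Dom) u x = \sum_(j < 2 ^ n) \int[mu]_(x in cell n j) u x.
Proof. by move=> mu'; rewrite -headint_sum// dy1. Qed.

Lemma Mplus_cst (a : R) : (0 <= a)%R -> @Mplus R (cst a%:E).
Proof. by move=> a0; split => [|x _]; [exact: measurable_cst|rewrite lee_fin]. Qed.

Lemma headint1 (t : R) : (0 <= t)%R -> headint (cst 1) t = t%:E.
Proof. by move=> t0; rewrite /headint integral_cst_head// mul1e. Qed.

Lemma mu_cell n i : (i < 2 ^ n)%N -> mu (cell n i) = ((2 ^ n)%:R^-1)%:E.
Proof.
move=> iN; have := headintS (Mplus_cst ler01) iN.
rewrite !headint1 ?dy_ge0// integral_cst; last exact: measurable_cell.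
rewrite mul1e dyS EFinD addeC [X in _ = X]addeC.
by move/(congr1 (fun z => z - (dy n i)%:E)); rewrite !addeK.
Qed.

Lemma integral_cst_cell n i (r : \bar R) : (i < 2 ^ n)%N ->
  \int[mu]_(x in cell n i) r = r * ((2 ^ n)%:R^-1)%:E.
Proof.
by move=> iN; rewrite -(mu_cell iN) -[RHS]integral_cst//; exact: measurable_cell.
Qed.

Lemma Mplus_restr (D : set R) f : measurable D -> D `<=` Dom -> Mplus f ->
  measurable_fun D f /\ forall x, D x -> 0 <= f x.
Proof.
move=> mD DD [mf f0]; split; last by move=> x /DD; exact: f0.
exact: (measurable_funS measurable_Dom DD mf).
Qed.

Lemma Mplus_step n v : (forall i, (i < 2 ^ n)%N -> (0 <= v i)%R) -> Mplus (step n v).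
Proof.
move=> v0; split; last first.
  by move=> x Dx; have [_ ?] := Dom_cell n Dx; rewrite lee_fin v0.
pose s x := \sum_(i < 2 ^ n) (v i * \1_(cell n i) x)%R%:E.
apply: (@eq_measurable_fun _ _ _ _ _ s); last first.
  apply: emeasurable_sum => i; apply/measurable_EFinP; apply: measurable_funM => //.
  by apply: measurable_indic; exact: measurable_cell.
move=> x; rewrite inE => Dx; have [cx xN] := Dom_cell n Dx.
rewrite /s (bigD1 (Ordinal xN))//= indicE mem_set// mulr1 big1 ?adde0// => j jx.
rewrite indicE memNset ?mulr0// => cj; move/negP: jx; apply.
by apply/eqP/val_inj => /=; rewrite (cell_truncn cj).
Qed.

Lemma integral_step n u v : Mplus u -> (forall i, (i < 2 ^ n)%N -> (0 <= v i)%R) ->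
  \int[mu]_(x in Dom) (u x * step n v x) =
  \sum_(i < 2 ^ n) (v i)%:E * \int[mu]_(x in cell n i) u x.
Proof.
move=> mu' v0.
have mus : Mplus (fun x => u x * step n v x).
  have [ms s0] := Mplus_step v0; have [mu1 u0] := mu'.
  split; first exact: emeasurable_funM.
  by move=> x Dx; rewrite mule_ge0 ?u0 ?s0.
rewrite (integral_Dom_sum n)//; apply: eq_bigr => i _.
have [mui ui0] := Mplus_restr (measurable_cell n i) (@cell_Dom n i) mu'.
rewrite -ge0_integralZl//; last 2 first.
- exact: measurable_cell.
- by rewrite lee_fin v0.
by apply: eq_integral => x; rewrite inE => cx; rewrite (step_cell _ cx) muleC.
Qed.

Lemma integral_cell_step n v i : (i < 2 ^ n)%N ->
  \int[mu]_(x in cell n i) step n v x = (v i / (2 ^ n)%:R)%R%:E.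
Proof.
move=> iN; under eq_integral => x do [rewrite inE => cx; rewrite (step_cell _ cx)].
by rewrite integral_cst_cell.
Qed.

(** Summation by parts as an induction: subtracting the last weight from all weights leaves a
    shorter nonincreasing sequence, plus the last weight times the full sum. *)
Lemma abel_le (N : nat) k (U W : nat -> \bar R) :
  (forall i, (i < N)%N -> (0 <= k i)%R) ->
  (forall i j, (i <= j < N)%N -> (k j <= k i)%R) ->
  (forall i, (i < N)%N -> 0 <= U i) -> (forall i, (i < N)%N -> 0 <= W i) ->
  (forall j, (j <= N)%N -> \sum_(i < j) U i <= \sum_(i < j) W i) ->
  \sum_(i < N) (k i)%:E * U i <= \sum_(i < N) (k i)%:E * W i.
Proof.
elim: N k => [|N IH] k k0 kn U0 W0 UW; first by rewrite !big_ord0.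
have E (V : nat -> \bar R) : (forall i, (i < N.+1)%N -> 0 <= V i) ->
  \sum_(i < N.+1) (k i)%:E * V i =
  \sum_(i < N) (k i - k N)%:E * V i + (k N)%:E * \sum_(i < N.+1) V i.
  move=> V0; rewrite big_ord_recr/= [X in _ = _ + _ * X]big_ord_recr/=.
  have VN i : (i < N)%N -> 0 <= V i by move=> iN; apply: V0; exact: ltnW.
  rewrite ge0_muleDr ?V0//; last by apply: sume_ge0 => i _; exact: VN.
  rewrite addeA ge0_sume_distrr; last by move=> i _; exact: VN.
  congr (_ + _); rewrite -big_split/=; apply: eq_bigr => i _.
  rewrite -ge0_muleDl ?lee_fin ?subr_ge0 ?kn ?k0 ?ltnSn//.
  + by rewrite -EFinD subrK.
  + by rewrite andbT ltnW.
rewrite !E//; apply: leeD; last by apply: lee_wpmul2l; rewrite ?lee_fin ?k0// UW.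
apply: (IH (fun i => (k i - k N)%R)) => [i iN|i j /andP[ij jN]|i iN|i iN|j jN].
- by rewrite subr_ge0 kn// (ltnW iN)/=.
- by rewrite lerD2r kn// ij/= ltnW.
- by apply: U0; exact: ltnW.
- by apply: W0; exact: ltnW.
- by apply: UW; exact: ltnW.
Qed.

(** Hardy's lemma: domination of the integrals over initial intervals is enough against
    nonincreasing weights. *)
Lemma step_le_head n u (w : R -> \bar R) k : Mplus u -> Mplus w ->
  (forall i, (i < 2 ^ n)%N -> (0 <= k i)%R) ->
  (forall i j, (i <= j < 2 ^ n)%N -> (k j <= k i)%R) ->
  (forall t, (0 < t <= 1)%R -> headint u t <= headint w t) ->
  \int[mu]_(x in Dom) (u x * step n k x) <= \int[mu]_(x in Dom) (w x * step n k x).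
Proof.
move=> mu' mw k0 kn uw; rewrite !integral_step//.
apply: (abel_le (U := fun i => \int[mu]_(x in cell n i) u x)
  (W := fun i => \int[mu]_(x in cell n i) w x)) => //.
- by move=> i iN; apply: integral_ge0 => x /cell_Dom; exact: mu'.2.
- by move=> i iN; apply: integral_ge0 => x /cell_Dom; exact: mw.2.
move=> [|j] jN; first by rewrite !big_ord0.
by rewrite -!headint_sum//; apply: uw; rewrite dy_gt0 dy_le1.
Qed.

Lemma step_le_fstar n u k : Mplus u ->
  (forall i, (i < 2 ^ n)%N -> (0 <= k i)%R) ->
  (forall i j, (i <= j < 2 ^ n)%N -> (k j <= k i)%R) ->
  \int[mu]_(x in Dom) (u x * step n k x) <= \int[mu]_(x in Dom) (fstar u x * step n k x).
Proof.
move=> mu' k0 kn; apply: step_le_head => //; first exact: Mplus_fstar.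
by move=> t; exact: headint_le_fstar.
Qed.

Lemma distr_step n v l : (forall i, (i < 2 ^ n)%N -> (0 <= v i)%R) ->
  distr (step n v) l = (\sum_(i < 2 ^ n) (l < v i)%R%:R / (2 ^ n)%:R)%R%:E.
Proof.
move=> v0; have mB := measurable_superlevel l (Mplus_step v0).
pose B := Dom `&` [set x | l%:E < step n v x].
rewrite /distr (_ : _ `&` _ = B `&` Dom); last by rewrite /B setIAC setIid.
transitivity (\int[mu]_(x in Dom) (\1_B x)%:E).
  by rewrite integral_indic//; exact: measurable_Dom.
rewrite (integral_Dom_sum n); last first.
  split; last by move=> x _; rewrite lee_fin.
  by apply/measurable_EFinP; exact: measurable_indic.
rewrite -sumEFin; apply: eq_bigr => i _.
under eq_integral => x.
  rewrite inE => cx.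
  have -> : \1_B x = (l < v i)%R%:R :> R.
    rewrite indicE; congr (nat_of_bool _)%:R; apply/idP/idP; rewrite inE /B /=.
      by rewrite (step_cell _ cx) lte_fin; case.
    by rewrite (step_cell _ cx) lte_fin; split => //; apply: cell_Dom cx.
  over.
by rewrite integral_cst_cell.
Qed.

(** All cells of one level have the same measure, so the distribution function only counts the
    entries above each level. This is how r.i. norms ignore permutations of entries. *)
Lemma fstar_step_perm n v w (p : {perm 'I_(2 ^ n)}) :
  (forall i, (i < 2 ^ n)%N -> (0 <= v i)%R) ->
  (forall i : 'I_(2 ^ n), w i = v (p i)) -> fstar (step n w) = fstar (step n v).
Proof.
move=> v0 wv.
have w0 i : (i < 2 ^ n)%N -> (0 <= w i)%R.
  by move=> iN; rewrite -[i]/(nat_of_ord (Ordinal iN)) wv v0.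
apply: eq_fstar => [||l l0]; try exact: Mplus_step.
rewrite !distr_step//; congr _%:E; rewrite [RHS](reindex_inj (@perm_inj _ p))/=.
by apply: eq_bigr => i _; rewrite wv.
Qed.

End dyadic.

(** * Averaging over dyadic cells *)

Section averaging.
Context {R : realType}.
Local Notation mu := (@lebesgue_measure R).
Local Notation Dom := (@Dom R).
Implicit Types (f g h : R -> \bar R) (n m i j : nat) (x : R) (v w k : nat -> R).

Lemma step_ext n v w x : (forall i, (i < 2 ^ n)%N -> v i = w i) -> Dom x ->
  step n v x = step n w x.
Proof. by move=> vw Dx; have [_ xN] := Dom_cell n Dx; rewrite /step vw. Qed.

Lemma cell_half n i : cell n.+1 i `<=` @cell R n i./2.
Proof.
move=> x [Dx /=]; rewrite in_itv/= => /andP[ix xi]; split => //=; rewrite in_itv/=.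
rewrite -(dy_double n i./2) -(dy_double n i./2.+1); apply/andP; split.
  by apply: le_trans ix; rewrite dy_le -[leqRHS]odd_double_half leq_addl.
apply: (lt_le_trans xi); rewrite dy_le -[X in (X < _)%N]odd_double_half doubleS.
by case: (odd i).
Qed.

Lemma step_half n v x : Dom x -> step n v x = step n.+1 (fun i => v i./2) x.
Proof.
move=> Dx; have [cx _] := Dom_cell n.+1 Dx.
by rewrite (step_cell _ cx) (step_cell _ (cell_half cx)).
Qed.

Lemma fstar_fin f t : Mplus f -> \int[mu]_(x in Dom) f x < +oo -> (0 < t <= 1)%R ->
  fstar f t \is a fin_num.
Proof.
move=> mf ff t01; have [[l ->]//|ft] := fstar_real_or_pinfty f t.
have : headint (fstar f) t <= \int[mu]_(x in Dom) fstar f x.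
  apply: ge0_subset_integral => //; try exact: measurable_Dom.
  - exact: (Mplus_fstar f).1.
  - by move=> x _; exact: fstar_ge0.
  - by apply: head_subDom; case/andP: t01.
by rewrite integral_fstar// headint_fstar_pinfty// leNgt ff.
Qed.

(** Sampling at the right end of the cell keeps the step function below f^* and makes it grow under
    refinement. [fine] is harmless for integrable f, whose rearrangement is finite at positive
    arguments. *)
Definition smp n f i : R := fine (fstar f (dy n i.+1)).

Lemma smp_ge0 n f i : (0 <= smp n f i)%R.
Proof. by rewrite fine_ge0// fstar_ge0. Qed.

Lemma smpE n f i : Mplus f -> \int[mu]_(x in Dom) f x < +oo -> (i < 2 ^ n)%N ->
  (smp n f i)%:E = fstar f (dy n i.+1).
Proof. by move=> mf ff iN; rewrite fineK// fstar_fin// dy_gt0 dy_le1. Qed.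

Lemma step_smpE n f i x : Mplus f -> \int[mu]_(x in Dom) f x < +oo -> cell n i x ->
  step n (smp n f) x = fstar f (dy n i.+1).
Proof.
move=> mf ff cx; rewrite (step_cell _ cx) smpE//.
by have [_] := Dom_cell n (cell_Dom cx); rewrite (cell_truncn cx).
Qed.

Lemma step_smp_le n f x : Mplus f -> \int[mu]_(x in Dom) f x < +oo -> Dom x ->
  step n (smp n f) x <= fstar f x.
Proof.
move=> mf ff Dx; have [cx xN] := Dom_cell n Dx; rewrite (step_smpE mf ff cx).
apply: fstar_nonincr; case: cx => _ /=; rewrite in_itv/= => /andP[_]; exact: ltW.
Qed.

Lemma step_smp_nd f x : Mplus f -> \int[mu]_(x in Dom) f x < +oo -> Dom x ->
  {homo (fun n => step n (smp n f) x) : n m / (n <= m)%N >-> n <= m}.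
Proof.
move=> mf ff Dx; apply/nondecreasing_seqP => n.
have [cx xN] := Dom_cell n.+1 Dx; move: cx; set i := Num.truncn _ => cx.
rewrite (step_smpE mf ff cx) (step_smpE mf ff (cell_half cx)).
apply: fstar_nonincr; rewrite -(dy_double n i./2.+1) dy_le doubleS -[X in (X < _)%N]odd_double_half.
by case: (odd i).
Qed.

(** Right continuity of f^*: if l < f^*(x), then x lies strictly below the distribution function at
    l, and so does the right end of its cell once the mesh is finer than this gap. *)
Lemma step_smp_cvg f x : Mplus f -> \int[mu]_(x in Dom) f x < +oo -> Dom x ->
  (fun n => step n (smp n f) x) @ \oo --> fstar f x.
Proof.
move=> mf ff Dx.
suff -> : fstar f x = ereal_sup (range (fun n => step n (smp n f) x)).
  by apply: ereal_nondecreasing_cvgn; exact: step_smp_nd.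
apply/eqP; rewrite eq_le; apply/andP; split; last first.
  by apply: ge_ereal_sup => _ [n _ <-]; exact: step_smp_le.
apply: le_ereal_real => [|l l0].
  apply: le_trans (ereal_sup_ubound _); last by exists 0%N.
  by rewrite lee_fin smp_ge0.
rewrite lt_fstar// -(fineK (distr_fin l mf)) lte_fin -subr_gt0 => h.
have [n hn] : exists n : nat, ((2 ^ n)%:R^-1 < fine (distr f l) - x)%R.
  have [n] := ltr_add_invr h; rewrite add0r => hn; exists n; apply: le_lt_trans hn.
  by rewrite lef_pV2 ?posrE ?exp2_gt0// ler_nat ltn_expl.
have [cx _] := Dom_cell n Dx.
apply: (@lt_le_trans _ _ (step n (smp n f) x)); last first.
  by apply: ereal_sup_ubound; exists n.
rewrite (step_smpE mf ff cx) lt_fstar// -(fineK (distr_fin l mf)) lte_fin dyS.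
case: cx => _ /=; rewrite in_itv/= => /andP[+ _] => ix.
by apply: le_lt_trans (_ : (x + (2 ^ n)%:R^-1 < _)%R); rewrite ?lerD2r// -ltrBrDl.
Qed.

Definition mean n h i : R := (fine (\int[mu]_(x in cell n i) h x) * (2 ^ n)%:R)%R.

Lemma integral_cell_ge0 n h i : Mplus h -> 0 <= \int[mu]_(x in cell n i) h x.
Proof. by move=> mh; apply: integral_ge0 => x /cell_Dom; exact: mh.2. Qed.

Lemma mean_ge0 n h i : Mplus h -> (0 <= mean n h i)%R.
Proof. by move=> mh; rewrite mulr_ge0// fine_ge0// integral_cell_ge0. Qed.

Lemma integral_sub_fin h (D : set R) : Mplus h -> \int[mu]_(x in Dom) h x < +oo ->
  measurable D -> D `<=` Dom -> \int[mu]_(x in D) h x \is a fin_num.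
Proof.
move=> mh fh mD DD; rewrite ge0_fin_numE.
  apply: le_lt_trans fh; apply: ge0_subset_integral => //; [exact: measurable_Dom|exact: mh.1|exact: mh.2].
by apply: integral_ge0 => x /DD; exact: mh.2.
Qed.

Lemma integral_cell_fin n h i : Mplus h -> \int[mu]_(x in Dom) h x < +oo ->
  \int[mu]_(x in cell n i) h x \is a fin_num.
Proof.
by move=> mh fh; apply: integral_sub_fin => //; [exact: measurable_cell|exact: cell_Dom].
Qed.

Lemma adde_fin_inj (a b c : \bar R) : a \is a fin_num -> a + b = a + c -> b = c.
Proof. by move=> af /(congr1 (fun z => z - a)); rewrite ![a + _]addeC !addeK. Qed.

Definition avg w i : R := ((w i.*2 + w i.*2.+1) / 2)%R.

Lemma mean_avg n h i : Mplus h -> \int[mu]_(x in Dom) h x < +oo -> (i < 2 ^ n)%N ->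
  mean n h i = avg (mean n.+1 h) i.
Proof.
move=> mh fh iN.
have i2 : (i.*2.+1 < 2 ^ n.+1)%N by rewrite expnS mul2n -doubleS leq_double.
have H1 := headintS mh iN.
have H2 := headintS mh i2; have H3 := headintS mh (ltnW i2).
have Hf : headint h (dy n i) \is a fin_num.
  rewrite /headint; apply: integral_sub_fin => //.
  by apply: head_subDom; rewrite dy_le1// ltnW.
have E : \int[mu]_(x in cell n i) h x =
    \int[mu]_(x in cell n.+1 i.*2) h x + \int[mu]_(x in cell n.+1 i.*2.+1) h x.
  by apply: (adde_fin_inj Hf); rewrite -H1 -(dy_double n i.+1) doubleS H2 H3 dy_double; exact: esym (addeA _ _ _).
rewrite /mean /avg E fineD ?integral_cell_fin// expnS natrM -!mulrDl mulrA.
by rewrite [RHS]mulrAC mulfK ?pnatr_eq0.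
Qed.

(** Exchanges the two halves of each cell of the next coarser level. *)
Definition swap2 i := if odd i then i.-1 else i.+1.

Lemma swap2K : involutive swap2.
Proof.
move=> i; rewrite /swap2; case oi: (odd i); last by rewrite /= oi.
by case: i oi => //= i /negbTE ->.
Qed.

Lemma swap2_lt n i : (i < 2 ^ n.+1)%N -> (swap2 i < 2 ^ n.+1)%N.
Proof.
rewrite expnS mul2n /swap2; case: ifPn => oi iN; first by apply: leq_ltn_trans iN; exact: leq_pred.
rewrite ltn_neqAle iN andbT; apply: contraNneq oi => /(congr1 odd).
by rewrite /= odd_double => /negbFE.
Qed.

Lemma swap2_avg w i : avg w i./2 = ((w i + w (swap2 i)) / 2)%R.
Proof.
rewrite /avg /swap2; have := odd_double_half i.
by case: (odd i); set d := _.*2; move: d => d <-; rewrite ?add0n ?add1n//= addrC.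
Qed.

End averaging.

(** * Rearrangement-invariant norms and the contractivity of averaging *)

Section ri_norm_theory.
Context {R : realType} (rho : (R -> \bar R) -> \bar R) (hrho : ri_norm rho).
Local Notation mu := (@lebesgue_measure R).
Local Notation Dom := (@Dom R).
Implicit Types (f g h : R -> \bar R) (n m i j : nat) (x : R) (v w k : nat -> R).

Lemma ri_ge0 f : Mplus f -> 0 <= rho f.
Proof. by move: hrho => [+ _]; exact. Qed.

Lemma ri_triangle f g : Mplus f -> Mplus g -> rho (f \+ g) <= rho f + rho g.
Proof. by move: hrho => [_ [_ [+ _]]]; exact. Qed.

Lemma ri_scale (a : R) f : (0 <= a)%R -> Mplus f -> rho (fun x => a%:E * f x) = a%:E * rho f.
Proof. by move: hrho => [_ [_ [_ [+ _]]]]; exact. Qed.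

Lemma ri_le_ae f g : Mplus f -> Mplus g -> {ae mu, forall x, Dom x -> f x <= g x} ->
  rho f <= rho g.
Proof. by move: hrho => [_ [_ [_ [_ [+ _]]]]]; exact. Qed.

Lemma ri_cvg (F : nat -> R -> \bar R) f : (forall n, Mplus (F n)) -> Mplus f ->
  {ae mu, forall x, Dom x ->
     {homo (fun n => F n x) : n m / (n <= m)%N >-> n <= m} /\
     ((fun n => F n x) @ \oo --> f x)} ->
  {homo (fun n => rho (F n)) : n m / (n <= m)%N >-> n <= m} /\
  ((fun n => rho (F n)) @ \oo --> rho f).
Proof. by move: hrho => [_ [_ [_ [_ [_ [+ _]]]]]]; exact. Qed.

Lemma ri_one : rho (cst 1) < +oo.
Proof. by move: hrho => [_ [_ [_ [_ [_ [_ [+ _]]]]]]]. Qed.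

Lemma ri_int : exists C : R, (0 < C)%R /\
  forall f, Mplus f -> \int[mu]_(x in Dom) f x <= C%:E * rho f.
Proof. by move: hrho => [_ [_ [_ [_ [_ [_ [_ [+ _]]]]]]]]. Qed.

Lemma ri_fstar f : Mplus f -> rho f = rho (fstar f).
Proof. by move: hrho => [_ [_ [_ [_ [_ [_ [_ [_ +]]]]]]]]; exact. Qed.

Lemma ri_le f g : Mplus f -> Mplus g -> (forall x, Dom x -> f x <= g x) -> rho f <= rho g.
Proof. by move=> mf mg fg; apply: ri_le_ae => //; apply: aeW. Qed.

Lemma ri_eq f g : Mplus f -> Mplus g -> (forall x, Dom x -> f x = g x) -> rho f = rho g.
Proof.
move=> mf mg fg; apply/eqP; rewrite eq_le !ri_le// => x /fg ->; exact: lexx.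
Qed.

Lemma ri_eq_fstar f g : Mplus f -> Mplus g -> fstar f = fstar g -> rho f = rho g.
Proof. by move=> mf mg fg; rewrite ri_fstar// fg -ri_fstar. Qed.

(** Disposes of non-integrable functions, so that f^* may afterwards be taken finite. *)
Lemma ri_pinfty f : Mplus f -> \int[mu]_(x in Dom) f x = +oo -> rho f = +oo.
Proof.
move=> mf fy; have [C [C0 /(_ _ mf)]] := ri_int; rewrite fy leye_eq.
case: (rho f) (ri_ge0 mf) => [r| |]//.
Qed.

(** The averaged function is half of [w] plus half of its copy with neighbours exchanged, and the
    two are equimeasurable. *)
Lemma ri_avg n w : (forall i, (i < 2 ^ n.+1)%N -> (0 <= w i)%R) ->
  rho (step n (avg w)) <= rho (step n.+1 w).
Proof.
move=> w0.
have ws0 i : (i < 2 ^ n.+1)%N -> (0 <= w (swap2 i))%R by move=> /swap2_lt; exact: w0.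
have a0 i : (i < 2 ^ n)%N -> (0 <= avg w i)%R.
  move=> iN; have i2 : (i.*2.+1 < 2 ^ n.+1)%N by rewrite expnS mul2n -doubleS leq_double.
  by rewrite divr_ge0// addr_ge0// w0// ltnW.
have mw := Mplus_step w0; have mws := Mplus_step ws0.
have h0 : (0 <= 2^-1 :> R)%R by rewrite invr_ge0.
have mZ u : Mplus u -> Mplus (fun x => (2^-1 : R)%:E * u x).
  by move=> [mu' u0]; split; [exact: measurable_funeM|move=> x Dx; rewrite mule_ge0 ?u0].
have -> : rho (step n (avg w)) = rho ((fun x => (2^-1 : R)%:E * step n.+1 w x) \+
    (fun x => (2^-1 : R)%:E * step n.+1 (w \o swap2) x)).
  apply: ri_eq; [exact: Mplus_step|by apply: MplusD; exact: mZ|].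
  move=> x Dx; rewrite (step_half _ _ Dx) /step/= swap2_avg -!EFinM -EFinD.
  by rewrite mulrC mulrDr.
apply: le_trans (ri_triangle (mZ _ mw) (mZ _ mws)) _.
rewrite !ri_scale//.
have -> : rho (step n.+1 (w \o swap2)) = rho (step n.+1 w).
  apply: ri_eq_fstar => //.
  pose s (i : 'I_(2 ^ n.+1)) := Ordinal (swap2_lt (ltn_ord i)).
  have sI : injective s by apply: (can_inj (g := s)) => i; apply/val_inj; exact: swap2K.
  by apply: (@fstar_step_perm _ _ _ _ (perm sI)) => // i; rewrite permE.
rewrite -ge0_muleDl ?lee_fin// -EFinD (_ : (_ + _)%R = 1%R) ?mul1e//.
by rewrite -mulr2n -[(_ *+ 2)%R]mulr_natr mulVf// pnatr_eq0.
Qed.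

Lemma ri_mean n m h : Mplus h -> \int[mu]_(x in Dom) h x < +oo -> (n <= m)%N ->
  rho (step n (mean n h)) <= rho (step m (mean m h)).
Proof.
move=> mh fh; elim: m => [|m IH]; first by rewrite leqn0 => /eqP ->.
rewrite leq_eqVlt => /predU1P[->//|]; rewrite ltnS => /IH nm; apply: le_trans nm _.
have M0 p i : (i < 2 ^ p)%N -> (0 <= mean p h i)%R by move=> _; exact: mean_ge0.
apply: le_trans (ri_avg (M0 m.+1)).
apply: ri_le; first exact: Mplus_step (M0 m).
  apply: Mplus_step => i iN; rewrite -mean_avg//; exact: M0.
by move=> x Dx; rewrite (@step_ext _ _ _ (avg (mean m.+1 h)))// => i iN; rewrite mean_avg.
Qed.

(** The sampled function of level n + m equals its own cell means at that level, so finitely many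
    pairwise averagings bring it to level n. Monotone convergence in each cell and the Fatou
    property pass to f^*. *)
Lemma ri_mean_fstar n f : Mplus f -> \int[mu]_(x in Dom) f x < +oo ->
  rho (step n (mean n (fstar f))) <= rho f.
Proof.
move=> mf ff; have mfs := Mplus_fstar f.
pose F m := step m (smp m f).
have mF m : Mplus (F m) by apply: Mplus_step => i _; exact: smp_ge0.
have Ff m x : Dom x -> F m x <= fstar f x by move=> Dx; exact: step_smp_le.
have fF m : \int[mu]_(x in Dom) F m x < +oo.
  apply: le_lt_trans ff; rewrite -(integral_fstar mf).
  apply: ge0_le_integral => //; [exact: measurable_Dom|exact: (mF m).2|exact: (mF m).1|exact: mfs.1|exact: Ff].
have ffs : \int[mu]_(x in Dom) fstar f x < +oo by rewrite integral_fstar.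
have bound m : rho (step n (mean n (F (n + m)%N))) <= rho f.
  apply: le_trans (ri_mean (mF _) (fF _) (leq_addr m n)) _.
  rewrite (ri_fstar mf); apply: ri_le => //.
    by apply: Mplus_step => i _; exact: mean_ge0.
  move=> x Dx; apply: le_trans (Ff (n + m)%N x Dx).
  rewrite (@step_ext _ _ _ (smp (n + m) f))// => i iN.
  by rewrite /mean integral_cell_step//= divfK// gt_eqF// exp2_gt0.
have stepE h x i : Mplus h -> \int[mu]_(x in Dom) h x < +oo -> cell n i x ->
    step n (mean n h) x = (2 ^ n)%:R%:E * \int[mu]_(x in cell n i) h x.
  by move=> mh fh cx; rewrite (step_cell _ cx) /mean mulrC EFinM fineK// integral_cell_fin.
have [|||nd cv] := @ri_cvg (fun m => step n (mean n (F (n + m)%N))) (step n (mean n (fstar f))).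
- by move=> m; apply: Mplus_step => i _; exact: mean_ge0.
- by apply: Mplus_step => i _; exact: mean_ge0.
- apply: aeW => x Dx; have [cx _] := Dom_cell n Dx; set i := Num.truncn _ in cx.
  have mc := @measurable_cell R n i.
  have ndF y : cell n i y -> {homo (fun m => F (n + m)%N y) : p q / (p <= q)%N >-> p <= q}.
    by move=> /cell_Dom Dy p q pq; apply: step_smp_nd => //; rewrite leq_add2l.
  have hF m := Mplus_restr mc (@cell_Dom _ n i) (mF m).
  split.
    move=> p q pq; rewrite (stepE _ _ i (mF _) (fF _) cx) (stepE _ _ i (mF _) (fF _) cx).
    apply: lee_wpmul2l => //.
    apply: ge0_le_integral => //; [exact: (hF _).2|exact: (hF _).1|exact: (hF _).1|].
    by move=> y cy; exact: ndF.
  rewrite (stepE _ _ i mfs ffs cx).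
  under eq_fun do rewrite (stepE _ _ i (mF _) (fF _) cx).
  apply: cvgeZl => //.
  have -> : \int[mu]_(y in cell n i) fstar f y =
            \int[mu]_(y in cell n i) limn (fun m => F (n + m)%N y).
    apply: eq_integral => y; rewrite inE => /cell_Dom Dy; apply/esym/cvg_lim => //.
    have := step_smp_cvg mf ff Dy; rewrite -(cvg_shiftn n).
    by under eq_fun do rewrite addnC.
  apply: cvg_monotone_convergence => //.
  + by move=> m; exact: (hF _).1.
  + by move=> m; exact: (hF _).2.
rewrite (nondecreasing_cvg_ereal_sup nd cv).
by apply: ge_ereal_sup => _ [m _ <-]; exact: bound.
Qed.

(* A bound tested on dyadic step functions passes to all functions, because
   averaging over dyadic cells does not increase [rho]. *)
Lemma step_dual_le n k (C : R) : (0 < C)%R ->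
  (forall i, (i < 2 ^ n)%N -> (0 <= k i)%R) ->
  (forall i j, (i <= j < 2 ^ n)%N -> (k j <= k i)%R) ->
  (forall v, (forall i, (i < 2 ^ n)%N -> (0 <= v i)%R) ->
     (\sum_(i < 2 ^ n) k i * v i)%R%:E <= C%:E * rho (step n v)) ->
  forall f, Mplus f ->
  \int[mu]_(x in Dom) (f x * step n (fun i => k i * (2 ^ n)%:R)%R x) <= C%:E * rho f.
Proof.
move=> C0 k0 kn kC f mf.
have [fy|ff] := eqVneq (\int[mu]_(x in Dom) f x) +oo.
  by rewrite (ri_pinfty mf fy) gt0_muley ?leey.
rewrite -ltey in ff.
have K0 i : (i < 2 ^ n)%N -> (0 <= k i * (2 ^ n)%:R)%R.
  by move=> iN; rewrite mulr_ge0 ?k0.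
apply: le_trans (step_le_fstar mf K0 _) _.
  by move=> i j ij; rewrite ler_wpM2r// kn.
rewrite integral_step//; last exact: Mplus_fstar.
apply: (@le_trans _ _ (C%:E * rho (step n (mean n (fstar f))))); last first.
  by rewrite lee_pmul2l//; exact: ri_mean_fstar.
apply: le_trans (kC _ _); last by move=> i _; apply: mean_ge0; exact: Mplus_fstar.
rewrite -sumEFin; apply: lee_sum => i _; rewrite /mean [(fine _ * _)%R]mulrC.
rewrite [leRHS]EFinM [X in _ <= _ * X]EFinM fineK; first by rewrite EFinM muleA.
by apply: integral_cell_fin; [exact: Mplus_fstar|rewrite integral_fstar].
Qed.

End ri_norm_theory.

(** * Finite-dimensional Hahn-Banach and norming step functions *)

Section hahn_banach.
Context {R : realType}.
Local Open Scope ring_scope.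

(** Homogeneity is asked as one inequality only; the other one is [sublinearZ]. *)
Definition sublinear (V : lmodType R) (p : V -> R) : Prop :=
  (forall u v, p (u + v) <= p u + p v) /\ (forall t u, 0 <= t -> p (t *: u) <= t * p u).

Lemma sublinear0 (V : lmodType R) (p : V -> R) : sublinear p -> 0 <= p 0.
Proof. by move=> [pD _]; have := pD 0 0; rewrite addr0 lerDl. Qed.

Lemma sublinearN (V : lmodType R) (p : V -> R) u : sublinear p -> - p (- u) <= p u.
Proof.
move=> sp; have := le_trans (sublinear0 sp) (_ : _ <= p u + p (- u)).
by rewrite -{1}(subrr u) => /(_ (sp.1 _ _)) h; rewrite -subr_ge0 opprK.
Qed.

Lemma sublinearZ (V : lmodType R) (p : V -> R) t u : sublinear p -> 0 <= t -> t * p u <= p (t *: u).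
Proof.
move=> sp; rewrite le_eqVlt => /predU1P[<-|t0].
  by rewrite mul0r scale0r sublinear0.
rewrite mulrC -ler_pdivlMr// mulrC -[X in p X <= _](scalerK (lt0r_neq0 t0)).
by apply: sp.2; rewrite invr_ge0 ltW.
Qed.

(* The largest sublinear functional below [p] that is linear along [b]. *)
Lemma sublinear_extend (V : lmodType R) (p : V -> R) (b : V) : sublinear p ->
  exists q : V -> R, [/\ sublinear q, forall u, q u <= p u & q (- b) <= - p b].
Proof.
(* The infimum q(u) of p(u + t b) - t p(b) over t >= 0: t = 0 gives q <= p, and t = 1 at u = -b
   gives q(-b) <= p(0) - p(b), with p(0) <= 0. *)
move=> sp; pose S u := [set p (u + t *: b) - t * p b | t in [set t | 0 <= t]].
pose q u := inf (S u).
have lbS u : lbound (S u) (- p (- u)).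
  move=> _ [t /= t0 <-]; rewrite lerBrDr -lerBrDl opprK.
  apply: le_trans (sublinearZ b sp t0) _.
  by rewrite -[X in p X <= _](addKr u) addrC; exact: sp.1.
have S0 u : S u !=set0 by exists (p (u + 0 *: b) - 0 * p b); exists 0 => /=.
have qS u y : S u y -> q u <= y by move=> Sy; apply: ge_inf => //; exists (- p (- u)).
have qge u y : (forall z, S u z -> y <= z) -> y <= q u by move=> h; exact: lb_le_inf.
exists q; split.
- split.
    move=> u v; rewrite -lerBlDr; apply: (qge _ _) => _ [t /= t0 <-].
    rewrite lerBlDr -lerBlDl; apply: (qge _ _) => _ [s /= s0 <-]; rewrite lerBlDl.
    apply: (@le_trans _ _ (p ((u + v) + (t + s) *: b) - (t + s) * p b)).
      by apply: qS; exists (t + s) => //=; exact: addr_ge0.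
    by have := sp.1 (u + t *: b) (v + s *: b); rewrite addrACA -scalerDl; lra.
  move=> t u; rewrite le_eqVlt => /predU1P[<-|t0].
    rewrite scale0r mul0r; apply: (le_trans (y := p (0 + 0 *: b) - 0 * p b)).
      by apply: qS; exists 0 => /=.
    rewrite scale0r addr0 mul0r subr0 -(scale0r (0 : V)).
    by apply: le_trans (sp.2 0 0 (lexx _)) _; rewrite mul0r.
  rewrite -ler_pdivrMl//; apply: (qge _ _) => _ [s /= s0 <-]; rewrite ler_pdivrMl//.
  apply: (le_trans (y := p (t *: u + (t * s) *: b) - (t * s) * p b)).
    by apply: qS; exists (t * s) => //=; rewrite mulr_ge0// ltW.
  by rewrite -scalerA -scalerDr mulrBr mulrA lerD2r; apply: sp.2; exact: ltW.
- move=> u; apply: qS; exists 0 => //=; by rewrite scale0r addr0 mul0r subr0.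
- apply: (le_trans (y := p (- b + 1 *: b) - 1 * p b)).
    by apply: qS; exists 1 => /=.
  rewrite scale1r addNr mul1r gerDr -(scale0r (0 : V)).
  by apply: le_trans (sp.2 0 0 (lexx _)) _; rewrite mul0r.
Qed.

(** Vectors treated earlier stay good, because q(-e) <= -q(e) is inherited by every sublinear
    functional below q. *)
Lemma sublinear_extend_seq (V : lmodType R) (p : V -> R) (s : seq V) : sublinear p ->
  exists q : V -> R, [/\ sublinear q, forall u, q u <= p u &
    forall e, e \in s -> q (- e) <= - q e].
Proof.
move=> sp; elim: s => [|b s [q [sq qp qs]]]; first by exists p; split.
have [r [sr rq rb]] := sublinear_extend b sq; exists r; split => // [u|e].
  exact: le_trans (rq u) (qp u).
rewrite inE => /predU1P[->|es].
  by apply: le_trans rb _; rewrite lerN2.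
by apply: le_trans (rq _) _; apply: le_trans (qs e es) _; rewrite lerN2.
Qed.

(** Treating [b] before the basis vectors secures q(-b) <= -p(b) against the original p, so the
    final functional still norms [b]. Its coefficients are its values at the basis vectors. *)
Lemma hahn_banach_rV (N : nat) (p : 'rV[R]_N -> R) (b : 'rV[R]_N) : sublinear p ->
  exists k : 'I_N -> R, (forall u : 'rV[R]_N, \sum_i k i * u 0 i <= p u) /\ p b <= \sum_i k i * b 0 i.
Proof.
move=> sp; have [p1 [sp1 p1p p1b]] := sublinear_extend b sp.
have [q [sq qp1 qe]] := sublinear_extend_seq [seq delta_mx 0 i | i : 'I_N] sp1.
pose k i := q (delta_mx 0 i).
(* This upper bound suffices: applied at -u, together with [sublinearN], it bounds the linear form
   by q, hence by p. *)
have qk u : q u <= \sum_i k i * u 0 i.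
  have qsum (s : seq 'I_N) : q (\sum_(i <- s) u 0 i *: delta_mx 0 i) <= \sum_(i <- s) k i * u 0 i.
    elim: s => [|i s IH].
      by rewrite !big_nil -(scale0r 0); apply: le_trans (sq.2 0 0 (lexx _)) _; rewrite mul0r.
    rewrite !big_cons; apply: le_trans (sq.1 _ _) _; apply: lerD => //.
    have [u0|u0] := leP 0 (u 0 i); first by rewrite mulrC; exact: sq.2.
    rewrite -[u 0 i]opprK scaleNr -scalerN; apply: le_trans (sq.2 _ _ _) _.
      by rewrite oppr_ge0 ltW.
    rewrite (_ : k i * _ = (- u 0 i) * (- k i)); last by rewrite opprK mulrNN mulrC.
    apply: ler_wpM2l; first by rewrite oppr_ge0 ltW.
    by apply: qe; apply/mapP; exists i => //; rewrite mem_enum.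
  by rewrite {1}(row_sum_delta u); exact: qsum.
exists k; split => [u|].
  apply: le_trans (p1p u); apply: le_trans (qp1 u); apply: le_trans (sublinearN u sq).
  rewrite lerNr -sumrN; apply: le_trans (qk _) _; apply: ler_sum => i _.
  by rewrite mxE mulrN.
apply: le_trans (qk b); apply: le_trans (sublinearN b sq); rewrite lerNr.
exact: le_trans (qp1 _) p1b.
Qed.

End hahn_banach.

Section norming.
Context {R : realType} (rho : (R -> \bar R) -> \bar R) (hrho : ri_norm rho).
Local Notation Dom := (@Dom R).
Implicit Types (n i j : nat) (v b k : nat -> R).
Local Open Scope ring_scope.

(** Hahn-Banach works with row vectors and [step] with sequences; entries past the end default to
    0. *)
Definition natf n (u : 'rV[R]_n) i : R := if insub i is Some o then u 0 o else 0.

Lemma natfE n (u : 'rV[R]_n) (i : 'I_n) : natf u i = u 0 i.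
Proof. by rewrite /natf valK. Qed.

Lemma natf_row n v i : (i < n)%N -> natf (\row_(j < n) v j) i = v i.
Proof. by move=> iN; rewrite -[i]/(nat_of_ord (Ordinal iN)) natfE mxE. Qed.

(** Taking positive parts extends the norm to signed vectors as a sublinear functional that vanishes
    on nonpositive ones, which forces nonnegative coefficients. *)
Definition pos_step n (u : 'rV[R]_(2 ^ n)) := step n (fun i => Num.max 0 (natf u i)).

Lemma Mplus_pos_step n (u : 'rV[R]_(2 ^ n)) : Mplus (pos_step u).
Proof. by apply: Mplus_step => i _; rewrite le_max lexx. Qed.

Lemma ri_step_fin n v : (forall i, (i < 2 ^ n)%N -> 0 <= v i) ->
  rho (step n v) \is a fin_num.
Proof.
move=> v0; have ms := Mplus_step v0; rewrite ge0_fin_numE; last exact: ri_ge0.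
pose M := \sum_(i < 2 ^ n) v i.
have M0 : 0 <= M by apply: sumr_ge0 => i _; exact: v0.
have m1 := @Mplus_cst R 1 ler01.
apply: (@le_lt_trans _ _ (M%:E * rho (cst 1%E))%E).
  rewrite -ri_scale//; apply: ri_le => //.
    by have := Mplus_cst M0; congr Mplus; apply/funext => x; rewrite /cst mule1.
  move=> x Dx; have [_ xN] := Dom_cell n Dx; rewrite /cst mule1 /step lee_fin.
  by rewrite /M (bigD1 (Ordinal xN))//= lerDl; apply: sumr_ge0 => i _; exact: v0.
rewrite lte_mul_pinfty ?lee_fin//; exact: ri_one.
Qed.

Lemma sublinear_pos_step n : sublinear (fun u : 'rV[R]_(2 ^ n) => fine (rho (pos_step u))).
Proof.
have fp (u : 'rV[R]_(2 ^ n)) : rho (pos_step u) \is a fin_num.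
  by apply: ri_step_fin => i _; rewrite le_max lexx.
split => [u v|t u t0]; rewrite -lee_fin.
  rewrite EFinD !fineK//; apply: le_trans (ri_triangle hrho (Mplus_pos_step u) (Mplus_pos_step v)).
  apply: ri_le => //; [exact: Mplus_pos_step|by apply: MplusD; exact: Mplus_pos_step|].
  move=> x Dx; have [_ xN] := Dom_cell n Dx; rewrite /pos_step /step/= lee_fin.
  rewrite -[Num.truncn _]/(nat_of_ord (Ordinal xN)) !natfE mxE ge_max.
  rewrite addr_ge0 ?le_max ?lexx//=; apply: lerD; by rewrite le_max lexx orbT.
rewrite EFinM !fineK// -ri_scale//; last exact: Mplus_pos_step.
have mt : Mplus (fun x => t%:E * pos_step u x)%E.
  have [m0 p0] := Mplus_pos_step u.
  by split; [exact: measurable_funeM|move=> x Dx; rewrite mule_ge0 ?lee_fin//; exact: p0].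
apply: ri_le => //; first exact: Mplus_pos_step.
move=> x Dx; have [_ xN] := Dom_cell n Dx; rewrite /pos_step /step/= lee_fin.
rewrite -[Num.truncn _]/(nat_of_ord (Ordinal xN)) !natfE mxE maxr_pMr// mulr0.
exact: lexx.
Qed.

(* Strict monotonicity of [b] forces the norming functional to be monotone:
   transposing two entries of [b] leaves its norm unchanged. *)
Lemma step_norming n b : (forall i, (i < 2 ^ n)%N -> 0 <= b i) ->
  (forall i j, (i < j < 2 ^ n)%N -> b j < b i) ->
  exists k, [/\ forall i, (i < 2 ^ n)%N -> 0 <= k i,
    forall i j, (i <= j < 2 ^ n)%N -> k j <= k i,
    forall v, (forall i, (i < 2 ^ n)%N -> 0 <= v i) ->
      ((\sum_(i < 2 ^ n) k i * v i)%:E <= rho (step n v))%E &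
    (rho (step n b) <= (\sum_(i < 2 ^ n) k i * b i)%:E)%E].
Proof.
move=> b0 bdec; set N := (2 ^ n)%N in b0 bdec *.
have posE v : (forall i, (i < N)%N -> 0 <= v i) ->
    rho (pos_step (\row_(j < N) v j : 'rV[R]_(2 ^ n))) = rho (step n v).
  move=> v0; apply: ri_eq => //; [exact: Mplus_pos_step|exact: Mplus_step|].
  by move=> x Dx; apply: step_ext => // i iN; rewrite natf_row// max_r// v0.
have [k' [k'p k'b]] := hahn_banach_rV (\row_(j < 2 ^ n) b j) (sublinear_pos_step n).
pose k i := natf (\row_j k' j) i.
have kE (i : 'I_N) : k i = k' i by rewrite /k natfE mxE.
have kv v : (forall i, (i < N)%N -> 0 <= v i) ->
    ((\sum_(i < N) k i * v i)%:E <= rho (step n v))%E.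
  move=> v0; have := k'p (\row_j v j); rewrite posE// -lee_fin fineK; last exact: ri_step_fin.
  by congr (_ <= _)%E; congr EFin; apply: eq_bigr => i _; rewrite kE mxE.
have kb : (rho (step n b) <= (\sum_(i < N) k i * b i)%:E)%E.
  move: k'b; rewrite posE// -lee_fin fineK; last exact: ri_step_fin.
  by congr (_ <= _)%E; congr EFin; apply: eq_bigr => i _; rewrite kE mxE.
exists k; split => //.
  (* The negative of a basis vector has positive part 0, so the functional is at most 0 there. *)
  move=> i iN; pose o := Ordinal iN; have := k'p (- delta_mx 0 o).
  have -> : rho (pos_step (- delta_mx 0 o)) = 0%E.
    have m1 := @Mplus_cst R 1 ler01.
    rewrite (_ : 0%E = 0%:E * rho (cst 1%E))%E; last by rewrite mul0e.
    rewrite -ri_scale//; apply: ri_eq => //; first exact: Mplus_pos_step.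
      by have := @Mplus_cst R 0 (lexx _); congr Mplus; apply/funext => x; rewrite mul0e.
    move=> x Dx; have [_ xN] := Dom_cell n Dx; rewrite mul0e /pos_step /step.
    rewrite -[Num.truncn _]/(nat_of_ord (Ordinal xN)) natfE !mxE eqxx/= max_l// oppr_le0.
  rewrite (bigD1 o)//= big1 => [|j jo]; last first.
    by rewrite !mxE (negbTE jo) andbF oppr0 mulr0.
  by rewrite !mxE !eqxx mulrN mulr1 addr0 oppr_le0 -kE.
move=> i j /andP[]; rewrite leq_eqVlt => /predU1P[->//|ij jN].
have iN : (i < N)%N by exact: ltn_trans ij jN.
pose oi := Ordinal iN; pose oj := Ordinal jN.
pose p := tperm oi oj.
pose b' m := natf (\row_m b (p m)) m.
have b'E (m : 'I_N) : b' m = b (p m) by rewrite /b' natfE mxE.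
have b'0 m : (m < N)%N -> 0 <= b' m.
  by move=> mN; rewrite -[m]/(nat_of_ord (Ordinal mN)) b'E b0.
have := kv _ b'0.
have -> : rho (step n b') = rho (step n b).
  apply: ri_eq_fstar => //; try exact: Mplus_step.
  exact: (@fstar_step_perm _ _ _ _ p).
(* The functional is at most the common norm at [b'] and at least that norm at [b]; the two sums
   differ only in the entries i and j. *)
move=> /le_trans/(_ kb); rewrite lee_fin.
have ne : oj != oi by rewrite -val_eqE/= gtn_eqF.
rewrite (bigD1 oi)//= (bigD1 oj)//= [leRHS](bigD1 oi)//= [in leRHS](bigD1 oj)//= !addrA.
rewrite (_ : \sum_(m < N | _) k m * b' m = \sum_(m < N | (m != oi) && (m != oj)) k m * b m); last first.
  by apply: eq_bigr => m /andP[mi mj]; rewrite b'E tpermD// eq_sym.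
rewrite lerD2r -[i]/(nat_of_ord oi) -[j]/(nat_of_ord oj) !b'E tpermL tpermR /=.
have := bdec i j; rewrite ij jN => /(_ isT) bij h.
have : 0 <= (k i - k j) * (b i - b j) by nra.
by rewrite pmulr_lge0 ?subr_gt0// subr_ge0.
Qed.

End norming.

(** * The norm given by a family of nonincreasing step functions *)

Section triangle_fubini.
Context {R : realType}.
Local Notation mu := (@lebesgue_measure R).
Local Notation Dom := (@Dom R).
Implicit Types (f g h u q : R -> \bar R).

Lemma DomP (t : R) : Dom t <-> (0 < t < 1)%R.
Proof. by rewrite /Dom/= in_itv. Qed.

Lemma tail_subDom (t : R) : (0 <= t)%R -> `]t, 1%R[ `<=` Dom.
Proof.
move=> t0 x /=; rewrite /Dom /= !in_itv/= => /andP[tx ->]; rewrite andbT.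
exact: le_lt_trans tx.
Qed.

Lemma Mplus_headint q : Mplus q -> Mplus (headint q).
Proof.
move=> mq; split.
  apply: nondecr_emeasurable; first exact: Dom_interval.
  move=> s t _ /DomP/andP[t0 t1] st; have [m p] := Mplus_head mq (ltW t1).
  apply: ge0_subset_integral => //; try exact: measurable_itv.
  by move=> x /=; rewrite !in_itv/= => /andP[-> xs]; rewrite (lt_le_trans xs).
by move=> t /DomP/andP[_ /ltW t1]; apply: integral_ge0; exact: (Mplus_head mq t1).2.
Qed.

(** Tonelli on the triangle t < s, with both functions extended by 0 outside (0,1). *)
Lemma fubini_triangle u q : Mplus u -> Mplus q ->
  \int[mu]_(t in Dom) ((\int[mu]_(s in `]t, 1%R[) u s) * q t) =
  \int[mu]_(s in Dom) (u s * headint q s).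
Proof.
move=> mu' mq.
have mD := @measurable_Dom R.
pose uD := u \_ Dom; pose qD := q \_ Dom.
have muD : measurable_fun setT uD by apply/(measurable_restrictT _ mD); exact: mu'.1.
have mqD : measurable_fun setT qD by apply/(measurable_restrictT _ mD); exact: mq.1.
have uD0 x : 0 <= uD x by rewrite /uD; apply: erestrict_ge0; exact: mu'.2.
have qD0 x : 0 <= qD x by rewrite /qD; apply: erestrict_ge0; exact: mq.2.
pose T := [set p : R * R | (p.1 < p.2)%R].
have mT : measurable (T : set (measurableTypeR R * measurableTypeR R)).
  have -> : T = setT `&` [set p : R * R | p.1%:E < p.2%:E].
    by rewrite setTI; apply/seteqP; split => p /=; rewrite lte_fin.
  apply: (@measurable_lte _ _ _ setT measurableT (fun p : R * R => p.1%:E) (fun p => p.2%:E)).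
    by apply/measurable_EFinP; exact: measurable_fst.
  by apply/measurable_EFinP; exact: measurable_snd.
pose F (p : R * R) := qD p.1 * (uD p.2 * (\1_T p)%:E).
have mF : measurable_fun setT (F : measurableTypeR R * measurableTypeR R -> \bar R).
  apply: emeasurable_funM; first by apply: measurableT_comp => //; exact: measurable_fst.
  apply: emeasurable_funM; first by apply: measurableT_comp => //; exact: measurable_snd.
  by apply/measurable_EFinP; exact: measurable_indic.
have F0 p : 0 <= F p by rewrite !mule_ge0 ?qD0 ?uD0// lee_fin.
have mind (A : set R) : measurable A -> measurable_fun setT (fun x => (\1_A x)%:E : \bar R).
  by move=> mA; apply/measurable_EFinP; exact: measurable_indic.
transitivity (\int[mu]_t \int[mu]_s F (t, s)).
  rewrite [LHS]integral_mkcond; apply: eq_integral => t _.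
  rewrite patchE; case: ifPn => [|tD]; last first.
    by apply/esym/integral0_eq => s _; rewrite /F /= {1}/qD patchE (negbTE tD) mul0e.
  rewrite inE => Dt.
  have t0 : (0 <= t)%R by move: Dt; rewrite /Dom/= in_itv/= => /andP[/ltW].
  have -> : \int[mu]_s F (t, s) = \int[mu]_s (qD t * (uD s * (\1_`]t, +oo[ s)%:E)).
    apply: eq_integral => s _; rewrite /F /= !indicE; congr (_ * (_ * (nat_of_bool _)%:R%:E)).
    by apply/idP/idP; rewrite !inE /T/= in_itv/= andbT.
  rewrite ge0_integralZl//; last 2 first.
  - by apply: emeasurable_funM => //; apply: mind; exact: measurable_itv.
  - by move=> s _; rewrite mule_ge0// lee_fin.
  rewrite muleC /qD patchE mem_set//; congr (_ * _).
  rewrite [LHS]integral_mkcond; apply: eq_integral => s _.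
  rewrite patchE; case: ifPn; rewrite ?inE ?notin_setE /= in_itv/=.
    move=> /andP[ts s1]; rewrite indicE mem_set ?mule1/= ?in_itv/= ?ts//.
    by rewrite /uD patchE mem_set// /Dom/= in_itv/= s1 (le_lt_trans t0).
  move=> /negP; rewrite negb_and -!leNgt => /orP[st|s1].
    by rewrite indicE memNset ?mule0//= in_itv/= andbT; apply/negP; rewrite -leNgt.
  rewrite /uD patchE memNset ?mul0e// /Dom/= in_itv/=; apply/negP.
  by rewrite negb_and -!leNgt s1 orbT.
rewrite (@fubini_tonelli _ _ _ _ _ mu mu F)//.
rewrite [RHS]integral_mkcond; apply: eq_integral => s _.
rewrite patchE; case: ifPn => [|sD]; last first.
  by apply: integral0_eq => t _; rewrite /F /= {1}/uD patchE (negbTE sD) mul0e mule0.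
rewrite inE => Ds.
have /andP[s0 s1] : (0 < s < 1)%R by move: Ds; rewrite /Dom/= in_itv.
have -> : \int[mu]_t F (t, s) = \int[mu]_t (uD s * (qD t * (\1_`]-oo, s[ t)%:E)).
  apply: eq_integral => t _; rewrite /F /= muleCA !indicE.
  by congr (_ * (_ * (nat_of_bool _)%:R%:E)).
rewrite ge0_integralZl//; last 2 first.
- by apply: emeasurable_funM => //; apply: mind; exact: measurable_itv.
- by move=> t _; rewrite mule_ge0// lee_fin.
rewrite /uD patchE mem_set//; congr (_ * _).
rewrite /headint [RHS]integral_mkcond; apply: eq_integral => t _.
rewrite [in RHS]patchE; case: ifPn; rewrite ?inE ?notin_setE /= in_itv/=.
  move=> /andP[t0 ts]; rewrite indicE mem_set ?mule1/= ?in_itv/= ?ts//.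
  by rewrite /qD patchE mem_set// /Dom/= in_itv/= t0 (lt_trans ts).
move=> /negP; rewrite negb_and -!leNgt => /orP[t0|st].
  rewrite /qD patchE memNset ?mul0e// /Dom/= in_itv/=; apply/negP.
  by rewrite negb_and -!leNgt t0.
by rewrite indicE memNset ?mule0//= in_itv/=; apply/negP; rewrite -leNgt.
Qed.

(** If u(t) <= l, the superlevel set at l lies in (0,t). Equality may fail where u is not
    right-continuous. *)
Lemma fstar_le_nonincr u t : Mplus u ->
  (forall s t, Dom s -> Dom t -> (s <= t)%R -> u t <= u s) -> Dom t -> fstar u t <= u t.
Proof.
move=> mu' nu Dt; apply: le_ereal_real => [|l l0]; first exact: mu'.2.
rewrite lt_fstar//; apply: contraTT; rewrite -!leNgt => utl.
have /andP[t0 t1] : (0 < t < 1)%R by move: Dt; rewrite /Dom/= in_itv.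
rewrite -(mu_head (ltW t0)); apply: le_measure; rewrite ?inE.
- exact: measurable_superlevel.
- exact: measurable_itv.
move=> x [Dx /= lx]; have := Dx; rewrite /Dom/= !in_itv/= => /andP[-> _]/=.
rewrite ltNge; apply/negP => tx; have := lt_le_trans lx (nu _ _ Dt Dx tx).
by rewrite ltNge utl.
Qed.

End triangle_fubini.

Section sup_norm.
Context {R : realType}.
Local Notation mu := (@lebesgue_measure R).
Local Notation Dom := (@Dom R).
Implicit Types (f g h : R -> \bar R) (KK : set (nat * (nat -> R))).

(** A supremum of Lorentz norms, each the integral of f^* against a nonincreasing weight. *)
Definition sup_norm KK f : \bar R :=
  ereal_sup [set \int[mu]_(x in Dom) (fstar f x * step nk.1 nk.2 x) | nk in KK].

(** One condition for each nontrivial axiom: weights at least 1 give the embedding into L^1 and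
    definiteness, monotone weights the triangle inequality, the bound [M] a finite norm of the
    constant 1. The family is nonempty so that the supremum is not -oo. *)
Definition admissible KK (M : R) : Prop :=
  [/\ KK !=set0,
      forall nk i, KK nk -> (i < 2 ^ nk.1)%N -> (1 <= nk.2 i)%R,
      forall nk i j, KK nk -> (i <= j < 2 ^ nk.1)%N -> (nk.2 j <= nk.2 i)%R &
      forall nk, KK nk -> \int[mu]_(x in Dom) step nk.1 nk.2 x <= M%:E].

Variables (KK : set (nat * (nat -> R))) (M : R) (aKK : admissible KK M).

Let KKn0 : KK !=set0. Proof. by case: aKK. Qed.

Let k1 nk i : KK nk -> (i < 2 ^ nk.1)%N -> (1 <= nk.2 i)%R.
Proof. by case: aKK => _ h _ _; exact: h. Qed.

Let k0 nk i : KK nk -> (i < 2 ^ nk.1)%N -> (0 <= nk.2 i)%R.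
Proof. by move=> h iN; apply: le_trans (k1 h iN). Qed.

Let kn nk i j : KK nk -> (i <= j < 2 ^ nk.1)%N -> (nk.2 j <= nk.2 i)%R.
Proof. by case: aKK => _ _ h _; exact: h. Qed.

Let kM nk : KK nk -> \int[mu]_(x in Dom) step nk.1 nk.2 x <= M%:E.
Proof. by case: aKK => _ _ _ h; exact: h. Qed.

Let mstep nk : KK nk -> Mplus (step nk.1 nk.2).
Proof. by move=> h; apply: Mplus_step => i; exact: k0. Qed.

Lemma MplusM f g : Mplus f -> Mplus g -> Mplus (fun x => f x * g x).
Proof.
move=> [mf f0] [mg g0]; split; first exact: emeasurable_funM.
by move=> x Dx; rewrite mule_ge0 ?f0 ?g0.
Qed.

Lemma le_integral_Dom f g : Mplus f -> Mplus g -> (forall x, Dom x -> f x <= g x) ->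
  \int[mu]_(x in Dom) f x <= \int[mu]_(x in Dom) g x.
Proof.
move=> mf mg fg; apply: ge0_le_integral => //; [exact: measurable_Dom|exact: mf.2|exact: mf.1|exact: mg.1].
Qed.

Lemma sup_norm_ub nk f : KK nk -> \int[mu]_(x in Dom) (fstar f x * step nk.1 nk.2 x) <= sup_norm KK f.
Proof. by move=> h; apply: ereal_sup_ubound; exists nk. Qed.

Lemma sup_norm_le f (y : \bar R) :
  (forall nk, KK nk -> \int[mu]_(x in Dom) (fstar f x * step nk.1 nk.2 x) <= y) ->
  sup_norm KK f <= y.
Proof. by move=> h; apply: ge_ereal_sup => _ [nk ? <-]; exact: h. Qed.

Lemma integral_le_sup_norm f : Mplus f -> \int[mu]_(x in Dom) f x <= sup_norm KK f.
Proof.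
move=> mf; have [nk KKnk] := KKn0; apply: le_trans (sup_norm_ub _ KKnk).
have mfs := Mplus_fstar f.
rewrite -(integral_fstar mf); apply: le_integral_Dom => //; first exact: MplusM (mstep KKnk).
move=> x Dx; have [_ xN] := Dom_cell nk.1 Dx.
by rewrite -[leLHS]mule1; apply: lee_wpmul2l; [exact: fstar_ge0|rewrite lee_fin k1].
Qed.

Lemma sup_norm_mono f g : Mplus f -> Mplus g -> {ae mu, forall x, Dom x -> f x <= g x} ->
  sup_norm KK f <= sup_norm KK g.
Proof.
move=> mf mg fg; apply: sup_norm_le => nk KKnk; apply: le_trans (sup_norm_ub _ KKnk).
have ms := mstep KKnk.
apply: le_integral_Dom; try by apply: MplusM => //; exact: Mplus_fstar.
by move=> x Dx; apply: lee_wpmul2r; [exact: ms.2|exact: fstar_le].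
Qed.

Lemma fstar_cst0 (t : R) : (0 <= t)%R -> fstar (cst 0) t = 0.
Proof.
move=> t0; apply/eqP; rewrite eq_le fstar_ge0 andbT.
have m0 := @Mplus_cst R 0 (lexx _).
apply: le_ereal_real => // l l0; rewrite lt_fstar// /distr.
rewrite (_ : _ `&` _ = set0) ?measure0 ?lte_fin ?ltNge ?t0//.
by apply/seteqP; split => x //= [_]; rewrite lte_fin ltNge l0.
Qed.

Lemma sup_norm_cst0 : sup_norm KK (cst 0) = 0.
Proof.
apply/eqP; rewrite eq_le; apply/andP; split.
  apply: sup_norm_le => nk KKnk; rewrite integral0_eq// => x Dx.
  by rewrite fstar_cst0 ?mul0e//; move: Dx; rewrite /Dom/= in_itv/= => /andP[/ltW].
apply: le_trans (integral_le_sup_norm (@Mplus_cst R 0 (lexx _))).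
by apply: integral_ge0.
Qed.

Lemma sup_norm_ge0 f : Mplus f -> 0 <= sup_norm KK f.
Proof.
by move=> mf; apply: le_trans (integral_le_sup_norm mf); apply: integral_ge0; exact: mf.2.
Qed.

Lemma MplusZ (a : R) f : (0 <= a)%R -> Mplus f -> Mplus (fun x => a%:E * f x).
Proof.
move=> a0 [mf f0]; split; first exact: measurable_funeM.
by move=> x Dx; rewrite mule_ge0 ?f0 ?lee_fin.
Qed.

Lemma sup_norm_scale_le (a : R) f : (0 < a)%R -> Mplus f ->
  sup_norm KK (fun x => a%:E * f x) <= a%:E * sup_norm KK f.
Proof.
move=> a0 mf; apply: sup_norm_le => nk KKnk.
under eq_integral => x _ do rewrite fstar_scale// -muleA.
have [m1 p1] := MplusM (Mplus_fstar f) (mstep KKnk).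
rewrite ge0_integralZl ?lee_fin ?(ltW a0)//; last exact: measurable_Dom.
by apply: lee_wpmul2l; [rewrite lee_fin ltW|exact: sup_norm_ub].
Qed.

(** [headint_fstarD] compares the integrals over initial intervals, and Hardy's lemma [step_le_head]
    carries this to each weight. *)
Lemma sup_norm_triangle f g : Mplus f -> Mplus g ->
  sup_norm KK (f \+ g) <= sup_norm KK f + sup_norm KK g.
Proof.
move=> mf mg; have mfs := Mplus_fstar f; have mgs := Mplus_fstar g.
apply: sup_norm_le => nk KKnk; have ms := mstep KKnk.
apply: (@le_trans _ _ (\int[mu]_(x in Dom) ((fstar f \+ fstar g) x * step nk.1 nk.2 x))).
  apply: step_le_head.
  - exact: Mplus_fstar.
  - exact: MplusD.
  - by move=> i; exact: k0.
  - by move=> i j; exact: kn.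
  move=> t t01; have t1 : (t <= 1)%R by case/andP: t01.
  have [m1 p1] := Mplus_head mfs t1; have [m2 p2] := Mplus_head mgs t1.
  rewrite [leRHS]ge0_integralD//; exact: headint_fstarD.
under eq_integral => x _ do rewrite /= ge0_muleDl ?fstar_ge0//.
have [m1 p1] := MplusM mfs ms; have [m2 p2] := MplusM mgs ms.
rewrite ge0_integralD//; last exact: measurable_Dom.
by apply: leeD; exact: sup_norm_ub.
Qed.

Lemma sup_norm_cvg (F : nat -> R -> \bar R) f : (forall n, Mplus (F n)) -> Mplus f ->
  {ae mu, forall x, Dom x ->
     {homo (fun n => F n x) : n m / (n <= m)%N >-> n <= m} /\
     ((fun n => F n x) @ \oo --> f x)} ->
  {homo (fun n => sup_norm KK (F n)) : n m / (n <= m)%N >-> n <= m} /\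
  ((fun n => sup_norm KK (F n)) @ \oo --> sup_norm KK f).
Proof.
move=> mF mf aeF.
have nd : {homo (fun n => sup_norm KK (F n)) : n m / (n <= m)%N >-> n <= m}.
  move=> n m nm; apply: sup_norm_mono => //.
  by apply: (ae_imp aeF) => x Dx h; apply: h.1.
split => //.
suff -> : sup_norm KK f = ereal_sup (range (fun n => sup_norm KK (F n))).
  exact: ereal_nondecreasing_cvgn.
apply/eqP; rewrite eq_le; apply/andP; split; last first.
  apply: ge_ereal_sup => _ [n _ <-]; apply: sup_norm_mono => //.
  apply: (ae_imp aeF) => x Dx [ndx cx].
  by rewrite (nondecreasing_cvg_ereal_sup ndx cx); apply: ereal_sup_ubound; exists n.
apply: sup_norm_le => nk KKnk; have ms := mstep KKnk.
pose G n x := fstar (F n) x * step nk.1 nk.2 x.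
have mG n : Mplus (G n) by apply: MplusM => //; exact: Mplus_fstar.
have -> : \int[mu]_(x in Dom) (fstar f x * step nk.1 nk.2 x) =
          \int[mu]_(x in Dom) limn (G ^~ x).
  apply: eq_integral => x; rewrite inE => Dx; apply/esym/cvg_lim => //.
  by apply: cvgeZr => //; apply: (fstar_cvg x mF mf aeF).2.
have cv : (fun n => \int[mu]_(x in Dom) G n x) @ \oo --> \int[mu]_(x in Dom) limn (G ^~ x).
  apply: cvg_monotone_convergence => //.
  - exact: measurable_Dom.
  - by move=> n; exact: (mG n).1.
  - by move=> n; exact: (mG n).2.
  move=> x Dx n m nm; apply: lee_wpmul2r; first exact: ms.2.
  exact: (fstar_cvg x mF mf aeF).1.
have ndG : {homo (fun n => \int[mu]_(x in Dom) G n x) : n m / (n <= m)%N >-> n <= m}.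
  move=> n m nm; apply: le_integral_Dom => // x Dx; apply: lee_wpmul2r; first exact: ms.2.
  exact: (fstar_cvg x mF mf aeF).1.
rewrite (nondecreasing_cvg_ereal_sup ndG cv); apply: ge_ereal_sup => _ [n _ <-].
apply: le_trans (sup_norm_ub (F n) KKnk) _.
by apply: ereal_sup_ubound; exists n.
Qed.

Lemma fstar_cst1_le (t : R) : (0 <= t)%R -> fstar (cst 1) t <= 1.
Proof.
move=> t0; have m1 := @Mplus_cst R 1 ler01.
apply: le_ereal_real => // l l0; rewrite lt_fstar// /distr; apply: contraTT.
rewrite -!leNgt lee_fin => l1; rewrite (_ : _ `&` _ = set0) ?measure0 ?lee_fin//.
by apply/seteqP; split => x //= [_]; rewrite lte_fin ltNge l1.
Qed.

Lemma ri_norm_sup_norm : ri_norm (sup_norm KK).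
Proof.
have mD := @measurable_Dom R.
split; first exact: sup_norm_ge0.
split.
  move=> f mf; split => [f0|f0].
    have : \int[mu]_(x in Dom) `|f x| = 0.
      apply/eqP; rewrite eq_le; apply/andP; split; last exact: integral_ge0.
      rewrite -f0; apply: le_trans (integral_le_sup_norm mf).
      under eq_integral => x do [rewrite inE => Dx; rewrite gee0_abs ?mf.2//].
      exact: lexx.
    by move=> h; exact: (ae_eq_integral_abs mu mD mf.1).1 h.
  apply/eqP; rewrite eq_le sup_norm_ge0// andbT -sup_norm_cst0.
  have m0 := @Mplus_cst R 0 (lexx _); apply: sup_norm_mono => //.
  by apply: (ae_imp f0) => x Dx ->.
split; first exact: sup_norm_triangle.
split.
  move=> a f; rewrite le_eqVlt => /predU1P[<-|a0] mf.
    rewrite mul0e -sup_norm_cst0; congr sup_norm.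
    by apply/funext => x; rewrite mul0e.
  apply/eqP; rewrite eq_le sup_norm_scale_le//=.
  rewrite -lee_pdivlMl// -[X in sup_norm KK X <= _](_ : (fun x => a^-1%:E * (a%:E * f x)) = f).
    by apply: sup_norm_scale_le; rewrite ?invr_gt0//; apply: MplusZ => //; exact: ltW.
  by apply/funext => x; rewrite muleA -EFinM mulVf ?mul1e// gt_eqF.
split; first exact: sup_norm_mono.
split; first exact: sup_norm_cvg.
split.
  apply: le_lt_trans (ltry M); apply: sup_norm_le => nk KKnk; apply: le_trans (kM KKnk).
  have ms := mstep KKnk.
  apply: le_integral_Dom => //; first by apply: MplusM => //; exact: Mplus_fstar.
  move=> x Dx; rewrite -[leRHS]mul1e; apply: lee_wpmul2r; first exact: ms.2.
  by apply: fstar_cst1_le; move: Dx; rewrite /Dom/= in_itv/= => /andP[/ltW].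
split; first by exists 1%R; split => // f mf; rewrite mul1e; exact: integral_le_sup_norm.
by move=> f mf; rewrite /sup_norm fstar_fstar.
Qed.

End sup_norm.

(** * The operator H and the norm of its optimal target *)

Section hardy_operator.
Context {R : realType} (I : R -> R) (hI : quasiconcave I).
Local Notation mu := (@lebesgue_measure R).
Local Notation Dom := (@Dom R).
Implicit Types (f g h q : R -> \bar R) (s t : R).

Lemma integral_cst_Dom (r : \bar R) : \int[mu]_(x in Dom) r = r.
Proof.
by rewrite -[RHS]mule1 -(@mu_Dom R) -[RHS]integral_cst//; exact: measurable_Dom.
Qed.

Lemma I_Dom t : Dom t -> Dom (I t).
Proof. by case: hI => -[+ _ _] _ _ _ _; exact. Qed.

Lemma I_gt0 t : Dom t -> (0 < I t)%R.
Proof. by move=> /I_Dom/DomP/andP[]. Qed.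

Lemma I_le1 t : Dom t -> (I t <= 1)%R.
Proof. by move=> /I_Dom/DomP/andP[_ /ltW]. Qed.

Lemma I_mono s t : Dom s -> Dom t -> (s <= t)%R -> (I s <= I t)%R.
Proof. by case: hI => _ + _ _ _; exact. Qed.

Lemma I_scale s t : Dom s -> Dom t -> (s <= t)%R -> (I t * s <= I s * t)%R.
Proof.
move=> Ds Dt st; have [_ _ _ _ /(_ _ _ Ds Dt st)] := hI.
move: (Ds) (Dt) => /DomP/andP[s0 _] /DomP/andP[t0 _].
by rewrite ler_pdivrMr// mulrAC ler_pdivlMr.
Qed.

Lemma I_double s t : Dom s -> Dom t -> (t <= 2 * s)%R -> (I t <= 2 * I s)%R.
Proof.
move=> Ds Dt t2s; have [st|ts] := leP s t; last first.
  have := I_mono Dt Ds (ltW ts); have := I_gt0 Ds; lra.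
have s0 : (0 < s)%R by move/DomP/andP: Ds => [].
rewrite -(ler_pM2r s0); apply: le_trans (I_scale Ds Dt st) _.
by rewrite [(2 * _)%R]mulrC -mulrA ler_pM2l ?I_gt0.
Qed.

Lemma half_Dom : Dom (2^-1)%R.
Proof. by apply/DomP; rewrite invr_gt0 ltr0n invf_lt1 ?ltr1n. Qed.

(** On (0,1/2] this is the monotonicity of I(t)/t, beyond that of I. It makes t/I(t) bounded by
    1/I(1/2). *)
Lemma I_ge_linear t : Dom t -> (I 2^-1 * t <= I t)%R.
Proof.
move=> Dt; have c0 := I_gt0 half_Dom; have /DomP/andP[t0 t1] := Dt.
have [th|ht] := leP t (2^-1)%R.
  have := I_scale Dt half_Dom th; have := I_gt0 Dt; lra.
have := I_mono half_Dom Dt (ltW ht); nra.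
Qed.

Definition Iinv t : \bar R := ((I t)^-1)%:E.

Lemma Iinv_ge1 t : Dom t -> 1 <= Iinv t.
Proof. by move=> Dt; rewrite lee_fin invf_ge1 ?I_gt0// I_le1. Qed.

Lemma Mplus_Iinv : Mplus Iinv.
Proof.
apply: Mplus_nonincr => [s t Ds Dt st|t Dt]; last by rewrite lee_fin invr_ge0 ltW ?I_gt0.
by rewrite lee_fin lef_pV2 ?posrE ?I_gt0// I_mono.
Qed.

Lemma Mplus_hIinv h : Mplus h -> Mplus (fun s => h s * Iinv s).
Proof. by move=> mh; apply: MplusM => //; exact: Mplus_Iinv. Qed.

Lemma H_nonincr h s t : Mplus h -> Dom s -> Dom t -> (s <= t)%R -> H_op I h t <= H_op I h s.
Proof.
move=> mh Ds Dt st; have [m p] := Mplus_hIinv mh.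
have /DomP/andP[/ltW s0 _] := Ds.
apply: ge0_subset_integral.
- exact: measurable_itv.
- exact: measurable_itv.
- by apply: measurable_funS m; [exact: measurable_Dom|exact: tail_subDom].
- by move=> x /(tail_subDom s0); exact: p.
by move=> x /=; rewrite !in_itv/= => /andP[tx ->]; rewrite (le_lt_trans st).
Qed.

Lemma Mplus_H h : Mplus h -> Mplus (H_op I h).
Proof.
move=> mh; apply: Mplus_nonincr => [s t Ds Dt st|t Dt]; first exact: H_nonincr.
have [m p] := Mplus_hIinv mh; have /DomP/andP[/ltW t0 _] := Dt.
by apply: integral_ge0 => x /(tail_subDom t0); exact: p.
Qed.

Lemma H_dual h q : Mplus h -> Mplus q ->
  \int[mu]_(t in Dom) (H_op I h t * q t) = \int[mu]_(s in Dom) (h s * Iinv s * headint q s).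
Proof. by move=> mh mq; apply: fubini_triangle => //; exact: Mplus_hIinv. Qed.

(** Duality with the constant 1, whose primitive is t, and the bound of t/I(t) from
    [I_ge_linear]. *)
Lemma integral_H_le h : Mplus h ->
  \int[mu]_(t in Dom) H_op I h t <= (I 2^-1)^-1%:E * \int[mu]_(t in Dom) h t.
Proof.
move=> mh; have c0 := I_gt0 half_Dom; have m1 := @Mplus_cst R 1 ler01.
have -> : \int[mu]_(t in Dom) H_op I h t = \int[mu]_(t in Dom) (H_op I h t * cst 1 t).
  by apply: eq_integral => t _; rewrite mule1.
rewrite H_dual// -ge0_integralZl//; last 4 first.
- exact: measurable_Dom.
- exact: mh.1.
- exact: mh.2.
- by rewrite lee_fin invr_ge0 ltW.
have meq t : Dom t -> h t * Iinv t * headint (cst 1) t = h t * (Iinv t * t%:E).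
  by move=> /DomP/andP[/ltW t0 _]; rewrite headint1// muleA.
rewrite (@eq_integral _ _ _ mu Dom (fun t => h t * (Iinv t * t%:E))); last first.
  by move=> t; rewrite inE; exact: meq.
have mid : Mplus (EFin : R -> \bar R).
  split; first exact: measurable_funTS.
  by move=> x /DomP/andP[/ltW]; rewrite lee_fin.
apply: le_integral_Dom.
- by apply: MplusM => //; apply: MplusM => //; exact: Mplus_Iinv.
- by apply: MplusZ => //; rewrite invr_ge0 ltW.
move=> t Dt; rewrite muleC; apply: lee_wpmul2r; first exact: mh.2.
rewrite -EFinM lee_fin ler_pdivrMl ?I_gt0// mulrC ler_pdivlMl//.
exact: I_ge_linear.
Qed.

Variables (rhoX : (R -> \bar R) -> \bar R) (hX : ri_norm rhoX).

(* The nonincreasing dyadic step functions in the associate unit ball of the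
   optimal target. *)
Definition dual_steps : set (nat * (nat -> R)) :=
  [set nk | [/\ forall i, (i < 2 ^ nk.1)%N -> (0 <= nk.2 i)%R,
    forall i j, (i <= j < 2 ^ nk.1)%N -> (nk.2 j <= nk.2 i)%R &
    forall h, Mplus h -> \int[mu]_(x in Dom) (H_op I h x * step nk.1 nk.2 x) <= rhoX h]].

(* Since [f^*] and [f] have the same integral, the shift adds [||f||_1]. *)
Definition shifted_steps : set (nat * (nat -> R)) :=
  [set (nk.1, fun i => (nk.2 i + 1)%R) | nk in dual_steps].

(** Test the defining inequality with h = 1. The constant 1/4 does not stay below H 1 near the end
    point 1, but its integrals over initial intervals stay below those of H 1, which is enough
    against a nonincreasing weight. *)
Lemma dual_steps_bound nk : dual_steps nk ->
  \int[mu]_(x in Dom) step nk.1 nk.2 x <= 4%:E * rhoX (cst 1).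
Proof.
move=> [k0 kn kH]; have m1 := @Mplus_cst R 1 ler01.
have m4 : Mplus (cst (4^-1 : R)%:E) by apply: Mplus_cst; rewrite invr_ge0.
have ms := Mplus_step k0.
rewrite -lee_pdivrMl//; apply: le_trans (kH _ m1).
rewrite -ge0_integralZl//; last 3 first.
- exact: measurable_Dom.
- exact: ms.1.
- exact: ms.2.
have mH := Mplus_H m1.
suff key t : (0 < t <= 1)%R ->
    headint (cst (4^-1 : R)%:E) t <= headint (H_op I (cst 1)) t.
  exact: (@step_le_head R nk.1 (cst (4^-1 : R)%:E)).
move=> /andP[t0 t1].
rewrite /headint integral_cst_head ?(ltW t0)//.
(* On [(0, 1/2)] the tail integral [H 1] is at least 1/2. *)
pose m := Num.min t 2^-1%R.
have m0 : (0 <= m)%R by rewrite le_min (ltW t0)/= invr_ge0.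
have mt : (m <= t)%R by rewrite ge_min lexx.
have mh : (m <= 2^-1)%R by rewrite ge_min lexx orbT.
have [mHt pHt] := Mplus_head mH t1.
have sub : `]0%R, m[ `<=` `]0%R, t[.
  by move=> x /=; rewrite !in_itv/= => /andP[-> xm]; rewrite (lt_le_trans xm).
apply: (@le_trans _ _ (\int[mu]_(x in `]0%R, m[) (2^-1 : R)%:E)).
  rewrite integral_cst_head// -!EFinM lee_fin.
  have [ht|/ltW ht] := leP t 2^-1%R; [have -> : m = t by exact/min_idPl|have -> : m = 2^-1%R by exact/min_idPr]; lra.
apply: (@le_trans _ _ (\int[mu]_(x in `]0%R, m[) H_op I (cst 1) x)); last first.
  by apply: ge0_subset_integral => //; exact: measurable_itv.
apply: ge0_le_integral.
- exact: measurable_itv.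
- by move=> x _; rewrite lee_fin invr_ge0.
- exact: measurable_cst.
- by apply: measurable_funS mHt => //; exact: measurable_itv.
move=> x /=; rewrite in_itv/= => /andP[x0 xm].
have [m' p'] := Mplus_hIinv m1.
have xh : (x < 2^-1)%R by exact: lt_le_trans mh.
apply: (@le_trans _ _ (\int[mu]_(s in `]x, 1%R[) cst 1 s)).
  have x1 : (x < 1)%R by apply: lt_trans xh _; rewrite invf_lt1 ?ltr1n.
  have mx : mu `]x, 1%R[ = (1 - x)%:E by rewrite lebesgue_measure_itv/= lte_fin x1 EFinB.
  have -> : \int[mu]_(s in `]x, 1%R[) cst 1 s = (1 - x)%:E.
    by rewrite -mx -[RHS]mul1e -[RHS]integral_cst//; exact: measurable_itv.
  by rewrite lee_fin; lra.
apply: ge0_le_integral.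
- exact: measurable_itv.
- by [].
- exact: measurable_cst.
- by apply: measurable_funS m'; [exact: measurable_Dom|exact: tail_subDom (ltW x0)].
by move=> s /(tail_subDom (ltW x0)) Ds; rewrite mul1e; exact: Iinv_ge1.
Qed.

Lemma step_shift n k x : @step R n (fun i => (k i + 1)%R) x = step n k x + 1.
Proof. by rewrite /step EFinD. Qed.

Lemma dual_steps0 : dual_steps (0%N, fun=> 0%R).
Proof.
split => //= h mh; rewrite integral0_eq ?(ri_ge0 hX mh)//.
by move=> x _; rewrite /step mule0.
Qed.

Lemma rhoX1_real : exists M : R, rhoX (cst 1) = M%:E.
Proof.
have m1 := @Mplus_cst R 1 ler01.
have := ri_one hX; have := ri_ge0 hX m1.
by case: (rhoX _) => // M _ _; exists M.
Qed.

Lemma admissible_shifted : exists M, admissible shifted_steps M.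
Proof.
have [M rM] := rhoX1_real; exists (4 * M + 1)%R; split.
- by exists (0%N, fun=> (0 + 1)%R); exists (0%N, fun=> 0%R) => //; exact: dual_steps0.
- by move=> _ i [nk [k0 _ _] <-] /= iN; rewrite lerDr k0.
- by move=> _ i j [nk [_ kn _] <-] /= ij; rewrite lerD2r kn.
move=> _ [nk dnk <-] /=; have [k0 _ _] := dnk; have ms := Mplus_step k0.
under eq_integral => x _ do rewrite step_shift.
rewrite ge0_integralD//; last 3 first.
- exact: measurable_Dom.
- exact: ms.2.
- exact: ms.1.
rewrite integral_cst_Dom EFinD; apply: leeD => //.
by apply: le_trans (dual_steps_bound dnk) _; rewrite rM.
Qed.

Definition rhoZ := sup_norm shifted_steps.

Lemma ri_norm_rhoZ : ri_norm rhoZ.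
Proof. by have [M aM] := admissible_shifted; exact: (ri_norm_sup_norm aM). Qed.

(** H h is nonincreasing, hence at least its own rearrangement. The unshifted weight is handled by
    the definition of [dual_steps], the shift by [integral_H_le] and the embedding of X into L^1. *)
Lemma H_bounded_rhoZ : H_bounded I rhoX rhoZ.
Proof.
have [C [C0 hC]] := ri_int hX; have c0 := I_gt0 half_Dom.
exists (1 + (I 2^-1)^-1 * C)%R; split; first by rewrite addr_gt0// mulr_gt0// invr_gt0.
move=> h mh; apply: sup_norm_le => _ [nk [k0 kn kH] <-] /=.
have mH := Mplus_H mh; have ms := Mplus_step k0; have mHs := Mplus_fstar (H_op I h).
have k10 i : (i < 2 ^ nk.1)%N -> (0 <= nk.2 i + 1)%R by move=> /k0 ?; rewrite addr_ge0.
have ms1 := Mplus_step k10.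
apply: (@le_trans _ _ (\int[mu]_(x in Dom) (H_op I h x * step nk.1 nk.2 x + H_op I h x))).
  apply: le_integral_Dom; first exact: MplusM.
    by apply: MplusD => //; exact: MplusM.
  move=> x Dx; rewrite -[X in _ <= _ + X]mule1 -ge0_muleDr//; last exact: ms.2.
  rewrite -step_shift; apply: lee_wpmul2r; first exact: ms1.2.
  by apply: fstar_le_nonincr => // s t Ds Dt st; exact: H_nonincr.
have [m p] := MplusM mH ms.
rewrite ge0_integralD//; [|exact: measurable_Dom|exact: mH.2|exact: mH.1].
rewrite EFinD ge0_muleDl ?lee_fin//; last by rewrite mulr_ge0 ?invr_ge0 ?ltW.
rewrite mul1e; apply: leeD; first exact: kH.
apply: le_trans (integral_H_le mh) _; rewrite EFinM -muleA.
by apply: lee_wpmul2l; [rewrite lee_fin invr_ge0 ltW|exact: hC].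
Qed.

End hardy_operator.

(** * Stieltjes integrals over dyadic cells *)

Section stieltjes_cells.
Context {R : realType}.
Local Notation mu := (@lebesgue_measure R).
Local Notation Dom := (@Dom R).
Implicit Types (f u : R -> \bar R) (n i j : nat) (s t a : R) (G : cumulative R R).

Lemma stieltjes_itvoc G s t : (s <= t)%R ->
  lebesgue_stieltjes_measure G `]s, t] = (G t - G s)%:E.
Proof.
move=> st; rewrite /lebesgue_stieltjes_measure/= /measure_extension/=.
by rewrite measurable_mu_extE//=; [rewrite wlength_itv_bnd|exact: is_ocitv].
Qed.

Lemma fstar_fin_gt0 f t : Mplus f -> \int[mu]_(x in Dom) f x < +oo -> (0 < t)%R ->
  fstar f t \is a fin_num.
Proof.
move=> mf ff t0; rewrite ge0_fin_numE ?fstar_ge0//.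
have m1 : (Num.min t 1 <= t)%R by rewrite ge_min lexx.
apply: le_lt_trans (fstar_nonincr f m1) _.
rewrite -ge0_fin_numE ?fstar_ge0//; apply: fstar_fin => //.
by rewrite lt_min t0 ltr01 ge_min lexx orbT.
Qed.

Lemma fstar1 f : Mplus f -> fstar f 1 = 0.
Proof.
move=> mf; apply/eqP; rewrite eq_le fstar_ge0 andbT.
apply: le_ereal_real => // l l0; rewrite lt_fstar//.
by rewrite ltNge distr_le1.
Qed.

Definition fstarr f t : R := fine (fstar f t).

Lemma fstarr_ge0 f t : (0 <= fstarr f t)%R.
Proof. by rewrite fine_ge0// fstar_ge0. Qed.

Lemma fstarr1 f : Mplus f -> fstarr f 1 = 0%R.
Proof. by move=> mf; rewrite /fstarr fstar1. Qed.

Lemma fstarr_nonincr f s t : Mplus f -> \int[mu]_(x in Dom) f x < +oo ->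
  (0 < s)%R -> (s <= t)%R -> (fstarr f t <= fstarr f s)%R.
Proof.
move=> mf ff s0 st; rewrite -lee_fin !fineK ?fstar_fin_gt0//.
  exact: fstar_nonincr.
exact: lt_le_trans st.
Qed.

(** Keeps the supremum in [stieltjes_neg] from being void. Right continuity comes from [lt_fstar]: a
    strict inequality f^*(m) > l persists up to the distribution function at l. *)
Lemma exists_cumulative f a : Mplus f -> \int[mu]_(x in Dom) f x < +oo -> (0 < a)%R ->
  exists G : cumulative R R, forall t, (a <= t)%R -> (G t)%:E = - fstar f t.
Proof.
move=> mf ff a0.
(* Frozen to the left of [a]: f^* may blow up at 0, while a cumulative function is finite and
   monotone on the whole line. *)
pose F t := (- fstarr f (Num.max a t))%R.
have max0 t : (0 < Num.max a t)%R by rewrite lt_max a0.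
have Fnd : {homo F : s t / (s <= t)%R}.
  move=> s t st; rewrite lerN2; apply: fstarr_nonincr => //.
  by rewrite ge_max !le_max lexx st orbT.
have Frc : right_continuous F.
  move=> t; apply/cvgrPdist_le => e e0; set m := Num.max a t.
  have Fm : (fstarr f m)%:E = fstar f m by rewrite fineK// fstar_fin_gt0// max0.
  have [d d0 dP] : exists2 d, (0 < d)%R & forall v, (t < v)%R -> (v < t + d)%R ->
      (fstarr f m - e <= fstarr f (Num.max a v))%R.
    have [l0|l0] := ltP (fstarr f m - e)%R 0%R.
      by exists 1%R => // v _ _; rewrite (le_trans (ltW l0))// fstarr_ge0.
    have : (fstarr f m - e)%:E < fstar f m by rewrite -Fm lte_fin ltrBlDr ltrDl.
    rewrite lt_fstar// -(fineK (distr_fin _ mf)) lte_fin => h.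
    exists (fine (distr f (fstarr f m - e)) - m)%R; first by rewrite subr_gt0.
    move=> v tv vd; have am : (a <= m)%R by rewrite le_max lexx.
    have tm : (t <= m)%R by rewrite le_max lexx orbT.
    rewrite -lee_fin fineK ?fstar_fin_gt0//; apply: ltW.
    rewrite lt_fstar// -(fineK (distr_fin _ mf)) lte_fin gt_max (le_lt_trans am h)/=.
    by apply: lt_le_trans vd _; lra.
  have tv0 : (t < t + d)%R by rewrite ltrDl.
  near=> v.
  have tv : (t < v)%R by near: v; exact: nbhs_right_gt.
  have vd : (v < t + d)%R by near: v; exact: nbhs_right_lt.
  have := dP v tv vd; have := Fnd _ _ (ltW tv); rewrite /F -/m => h1 h2.
  by rewrite ler0_norm ?subr_le0//; lra.
pose mixin := isCumulative.Build R _ R F Fnd Frc.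
exists (HB.pack_for (cumulative R R) F mixin) => t at'.
by rewrite /= /F max_r// EFinN fineK// fstar_fin_gt0// (lt_le_trans a0).
Unshelve. all: by end_near.
Qed.

(** The agreement stops before 1, as in [stieltjes_neg]; the value of [G] at 1 remains unknown. *)
Definition cumul_of f G a := forall t, (a <= t)%R -> (t < 1)%R -> (G t)%:E = - fstar f t.

Lemma cumul_ofE f G a t : cumul_of f G a -> (a <= t)%R -> (t < 1)%R -> G t = (- fstarr f t)%R.
Proof. by move=> h at' t1; rewrite /fstarr -fineN -h. Qed.

(** Only an inequality, since [a] may cut the interval and, for t = 1, the point 1 is left out. In
    that case the open interval is exhausted by intervals ending before 1, where [G] is known. *)
Lemma stieltjes_oc_le f G a s t : Mplus f -> \int[mu]_(x in Dom) f x < +oo ->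
  (0 < a < 1)%R -> cumul_of f G a -> (0 < s < t)%R -> (t <= 1)%R ->
  lebesgue_stieltjes_measure G (`]s, t] `&` `]a, 1%R[) <= (fstarr f s - fstarr f t)%:E.
Proof.
move=> mf ff /andP[a0 a1] GE /andP[s0 st] t1.
set nu := lebesgue_stieltjes_measure G.
have nu0 : nu set0 = 0 by exact: measure0.
have mA : measurable (`]s, t] `&` `]a, 1%R[ : set R) by apply: measurableI; exact: measurable_itv.
pose m := Num.max s a.
have sm : (s <= m)%R by rewrite le_max lexx.
have am : (a <= m)%R by rewrite le_max lexx orbT.
have m0 : (0 < m)%R by exact: lt_le_trans sm.
have Fsm : (fstarr f m <= fstarr f s)%R by exact: fstarr_nonincr.
have bnd b : (b < 1)%R -> (b <= t)%R -> nu `]m, b]%classic <= (fstarr f s - fstarr f t)%:E.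
  move=> b1 bt; have [mb|bm] := leP m b; last first.
    rewrite set_itv_ge ?bnd_simp -?leNgt ?(ltW bm)// nu0.
    by rewrite lee_fin subr_ge0; apply: fstarr_nonincr => //; exact: ltW.
  rewrite [leLHS]stieltjes_itvoc// !(cumul_ofE GE) ?(le_trans am)// ?(le_lt_trans mb)//.
  have := fstarr_nonincr mf ff (lt_le_trans m0 mb) bt.
  by rewrite lee_fin; lra.
move: t1; rewrite le_eqVlt => /predU1P[t1|t1].
  have sub : `]s, t] `&` `]a, 1%R[ `<=` `]m, 1%R[.
    move=> x /=; rewrite !in_itv/= => -[/andP[sx _] /andP[ax ->]].
    by rewrite andbT gt_max sx.
  apply: (@le_trans _ _ (nu `]m, 1%R[%classic)).
    by apply: le_measure; rewrite ?inE//; exact: measurable_itv.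
  rewrite itv_bnd_open_bigcup//.
  pose A k := `]m, (1 - k.+1%:R^-1)%R]%classic : set R.
  have ndA : {homo A : n m / (n <= m)%N >-> (n <= m)%O}.
    move=> i j ij; apply/subsetPset => x /=; rewrite /A/= !in_itv/= => /andP[->/=].
    by move/le_trans; apply; rewrite lerB// lef_pV2 ?ler_nat ?posrE.
  have cA : nu \o A @ \oo --> nu (\bigcup_k A k).
    apply: nondecreasing_cvg_mu => //.
      by move=> ?; exact: measurable_itv.
    by apply: bigcupT_measurable => k; exact: measurable_itv.
  have ndnu : {homo nu \o A : n m / (n <= m)%N >-> n <= m}.
    move=> i j ij; apply: le_measure; rewrite ?inE; try exact: measurable_itv.
    by apply/subsetPset; exact: ndA.
  rewrite (nondecreasing_cvg_ereal_sup ndnu cA); apply: ge_ereal_sup => _ [k _ <-].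
  by apply: bnd; rewrite ?t1 ?gtrBl// gerBl.
apply: le_trans (bnd t t1 (lexx _)); apply: le_measure; rewrite ?inE//.
by move=> x /=; rewrite !in_itv/= => -[/andP[sx ->] /andP[ax _]]; rewrite andbT gt_max sx.
Qed.

(** Left-open, unlike [cell]: the Stieltjes measure of such an interval is the increment of its
    cumulative function. *)
Definition cell_oc n i : set R := `]dy n i, dy n i.+1]%classic.

Lemma cell_oc_inj n i j x : cell_oc n i x -> cell_oc n j x -> i = j.
Proof.
rewrite /cell_oc /= !in_itv/= => /andP[ix xi] /andP[jx xj].
have := lt_le_trans ix xj; have := lt_le_trans jx xi; rewrite !dy_lt !ltnS => h1 h2.
by apply/eqP; rewrite eqn_leq h1 h2.
Qed.

Lemma exists_cell_oc n x : Dom x -> exists2 i, (i < 2 ^ n)%N & cell_oc n i x.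
Proof.
move=> Dx; have [[_ cx] xN] := Dom_cell n Dx; move: cx xN; set i := Num.truncn _.
rewrite /= in_itv/= le_eqVlt => /andP[/predU1P[ix|ix] xi] iN; last first.
  by exists i => //; rewrite /cell_oc /= in_itv/= ix ltW.
have /DomP/andP[x0 _] := Dx.
case: i ix xi iN => [|i] ix xi iN; first by rewrite -ix dy0 ltxx in x0.
exists i; first exact: ltnW.
by rewrite /cell_oc /= in_itv/= -ix lexx andbT dy_lt.
Qed.

Definition cell_sum n (N : nat) (D : nat -> R) (x : R) : \bar R :=
  \sum_(i < N) ((D i)%:E * (\1_(cell_oc n i) x)%:E).

Lemma cell_sum_in n N D i x : (i < N)%N -> cell_oc n i x -> cell_sum n N D x = (D i)%:E.
Proof.
move=> iN cx; rewrite /cell_sum (bigD1 (Ordinal iN))//= indicE mem_set// mule1.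
rewrite big1 ?adde0// => j ji; rewrite indicE memNset ?mule0// => cj.
by move/negP: ji; apply; apply/eqP/val_inj; exact: cell_oc_inj cj cx.
Qed.

Lemma integral_cell_sum G a n N D : (forall i, (i < N)%N -> (0 <= D i)%R) ->
  \int[lebesgue_stieltjes_measure G]_(x in `]a, 1%R[) cell_sum n N D x =
  \sum_(i < N) ((D i)%:E * lebesgue_stieltjes_measure G (cell_oc n i `&` `]a, 1%R[)).
Proof.
move=> D0; have mI : measurable (`]a, 1%R[%classic : set R) by exact: measurable_itv.
have mc i : measurable (cell_oc n i : set R) by exact: measurable_itv.
have mind (A : set R) : measurable A -> measurable_fun `]a, 1%R[ (fun x : R => (\1_A x)%:E : \bar R).
  by move=> mA; apply/measurable_EFinP; exact: measurable_indic.
rewrite ge0_integral_sum//; last 2 first.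
- by move=> i; apply: measurable_funeM; exact: mind.
- by move=> i x _; rewrite mule_ge0 ?lee_fin ?D0.
apply: eq_bigr => i _; rewrite ge0_integralZl//.
- rewrite integral_indic; [reflexivity|exact: mI|exact: mc].
- exact: mind.
- by rewrite lee_fin D0.
Qed.

Lemma measurable_cell_sum n N D : measurable_fun setT (cell_sum n N D).
Proof.
apply: emeasurable_sum => i; apply: measurable_funeM; apply/measurable_EFinP.
by apply: measurable_indic; exact: measurable_itv.
Qed.

Lemma cell_sum_ge0 n N D x : (forall i, (i < N)%N -> (0 <= D i)%R) -> 0 <= cell_sum n N D x.
Proof. by move=> D0; apply: sume_ge0 => i _; rewrite mule_ge0 ?lee_fin ?D0. Qed.

(** The first cell ends at or before [a] and does not meet the domain of integration, so [D] may
    vanish there. *)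
Lemma stieltjes_le_sum f G a n D u : Mplus f -> \int[mu]_(x in Dom) f x < +oo ->
  (0 < a < 1)%R -> cumul_of f G a -> (dy n 1 <= a)%R -> Mplus u ->
  D 0%N = 0%R -> (forall i, (0 <= D i)%R) ->
  (forall i t, (0 < i < 2 ^ n)%N -> Dom t -> cell_oc n i t -> u t <= (D i)%:E) ->
  \int[lebesgue_stieltjes_measure G]_(x in `]a, 1%R[) u x <=
  (\sum_(i < 2 ^ n) D i * (fstarr f (dy n i) - fstarr f (dy n i.+1)))%R%:E.
Proof.
move=> mf ff a01 GE dya [mu' u0] D00 D0 uD; have /andP[a0 a1] := a01.
have mI : measurable (`]a, 1%R[%classic : set R) by exact: measurable_itv.
have sub := tail_subDom (ltW a0).
apply: (@le_trans _ _ (\int[lebesgue_stieltjes_measure G]_(x in `]a, 1%R[) cell_sum n (2 ^ n) D x)).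
  apply: ge0_le_integral => //.
  - by move=> x /sub; exact: u0.
  - by apply: measurable_funS mu' => //; exact: measurable_Dom.
  - by apply: measurable_funTS; exact: measurable_cell_sum.
  move=> x ax; have Dx := sub x ax; have [i iN cx] := exists_cell_oc n Dx.
  rewrite (cell_sum_in _ iN cx); apply: uD => //; rewrite iN andbT lt0n.
  apply/eqP => i0; move: cx ax; rewrite /cell_oc i0 /= !in_itv/= => /andP[_ x1] /andP[ax _].
  by have := lt_le_trans ax (le_trans x1 dya); rewrite ltxx.
rewrite integral_cell_sum; last by move=> i _; exact: D0.
rewrite -sumEFin; apply: lee_sum => -[[|i] iN] _ /=; first by rewrite D00 mul0e mul0r.
rewrite EFinM; apply: lee_wpmul2l; first by rewrite lee_fin.
by apply: stieltjes_oc_le => //; rewrite ?dy_le1// dy_gt0/= dy_lt.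
Qed.

(** The sum omits the last cell: its increment includes the jump of f^* at 1, which the integral
    over an interval open at 1 does not see. *)
Lemma stieltjes_ge_sum f G n D u : Mplus f -> \int[mu]_(x in Dom) f x < +oo ->
  cumul_of f G (dy n 1) -> Mplus u ->
  D 0%N = 0%R -> (forall i, (0 <= D i)%R) ->
  (forall i t, (0 < i)%N -> (i.+1 < 2 ^ n)%N -> Dom t -> cell_oc n i t -> (D i)%:E <= u t) ->
  (\sum_(i < (2 ^ n).-1) D i * (fstarr f (dy n i) - fstarr f (dy n i.+1)))%R%:E <=
  \int[lebesgue_stieltjes_measure G]_(x in `]dy n 1, 1%R[) u x.
Proof.
move=> mf ff GE [mu' u0] D00 D0 uD; have a0 := @dy_gt0 R n 0.
have mI : measurable (`]dy n 1, 1%R[%classic : set R) by exact: measurable_itv.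
have sub := tail_subDom (ltW a0).
apply: (@le_trans _ _ (\int[lebesgue_stieltjes_measure G]_(x in `]dy n 1, 1%R[)
    cell_sum n (2 ^ n).-1 D x)); last first.
  apply: ge0_le_integral => //.
  - by move=> x _; apply: cell_sum_ge0 => i _; exact: D0.
  - by apply: measurable_funTS; exact: measurable_cell_sum.
  - by apply: measurable_funS mu' => //; exact: measurable_Dom.
  move=> x ax; have Dx := sub x ax; have [i iN cx] := exists_cell_oc n Dx.
  have [iN'|iN'] := ltnP i (2 ^ n).-1.
    rewrite (cell_sum_in _ iN' cx); have [i0|i0] := posnP i; first by rewrite i0 D00 u0.
    by apply: uD => //; rewrite -ltn_predRL.
  rewrite /cell_sum big1 ?u0// => j _; rewrite indicE memNset ?mule0// => cj.
  by have := ltn_ord j; rewrite (cell_oc_inj cj cx) ltnNge iN'.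
rewrite integral_cell_sum; last by move=> i _; exact: D0.
rewrite -sumEFin; apply: lee_sum => -[[|i] iN] _ /=; first by rewrite D00 mul0e mul0r.
have iN' : (i.+2 < 2 ^ n)%N by rewrite -ltn_predRL.
have x1 : (@dy R n i.+2 < 1)%R by rewrite -(dy1 n) dy_lt.
rewrite EFinM; apply: lee_wpmul2l; first by rewrite lee_fin.
rewrite (_ : _ `&` _ = `]dy n i.+1, dy n i.+2]%classic); last first.
  apply/seteqP; split => x /=; rewrite /cell_oc /= !in_itv/=; first by case.
  move=> /andP[ix xi]; split; first by rewrite ix.
  by rewrite (le_lt_trans xi x1) andbT (le_lt_trans _ ix)// dy_le.
rewrite [leRHS]stieltjes_itvoc ?dy_le// !(cumul_ofE GE) ?dy_le//.
  by rewrite lee_fin; lra.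
by apply: lt_trans x1; rewrite dy_lt.
Qed.

Lemma abel_sum (N : nat) (k F : nat -> R) :
  (\sum_(i < N) (\sum_(j < i) k j) * (F i - F i.+1) =
   \sum_(i < N) k i * F i.+1 - (\sum_(j < N) k j) * F N)%R.
Proof.
elim: N => [|N IH]; first by rewrite !big_ord0 mul0r subr0.
by rewrite !big_ord_recr/= IH; ring.
Qed.

End stieltjes_cells.

(** * Concave majorants *)

Section concave_majorant.
Context {R : realType}.
Local Notation Dom := (@Dom R).
Implicit Types (s t x y : R) (i j n : nat).
Local Open Scope ring_scope.

Lemma dy_le_double n i : (dy n i.+2 : R) <= 2 * dy n i.+1.
Proof.
by rewrite /dy mulrA ler_pM2r ?invr_gt0 ?exp2_gt0// -natrM ler_nat mul2n -addnn; lia.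
Qed.

Variables (phi : R -> R).
Hypothesis phi0 : forall t, Dom t -> 0 <= phi t.
Hypothesis phim : forall s t, Dom s -> Dom t -> s <= t -> phi s <= phi t.
Hypothesis phiq : forall s t, Dom s -> Dom t -> s <= t -> phi t * s <= phi s * t.

(** Pairs of an intercept and a slope; the two signs make the infimum nonnegative and nondecreasing
    on the half-line. *)
Definition affine_majorants : set (R * R) :=
  [set p | [/\ 0 <= p.1, 0 <= p.2 & forall s, Dom s -> phi s <= p.1 + p.2 * s]].

Definition concave_majorant x : R := inf [set p.1 + p.2 * x | p in affine_majorants].

(** To the left of x the intercept dominates by monotonicity of phi, to the right the linear part
    does by monotonicity of phi(s)/s. At s = x the value is 2 phi(x), the source of the factor 2 in
    [concave_majorant_le]. *)
Lemma affine_majorant_at x : Dom x -> affine_majorants (phi x, phi x / x).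
Proof.
move=> Dx; have /DomP/andP[x0 x1] := Dx; split => /=; first exact: phi0.
  by rewrite divr_ge0 ?phi0// ltW.
move=> s Ds; have s0 : 0 < s by have /DomP/andP[] := Ds.
have [sx|xs] := leP s x.
  apply: le_trans (phim Ds Dx sx) _; rewrite lerDl mulr_ge0 ?divr_ge0 ?phi0// ltW//.
apply: (@le_trans _ _ (phi x / x * s)); last by rewrite lerDr phi0.
rewrite mulrAC ler_pdivlMr//; exact: phiq Dx Ds (ltW xs).
Qed.

Lemma affine_majorants_neq0 x : [set p.1 + p.2 * x | p in affine_majorants] !=set0.
Proof.
have h := affine_majorant_at (@half_Dom R).
by eexists; exists (phi 2^-1, phi 2^-1 / 2^-1).
Qed.

Lemma concave_majorant_lb p x : affine_majorants p -> 0 <= x ->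
  concave_majorant x <= p.1 + p.2 * x.
Proof.
move=> mp x0; apply: ge_inf; last by exists p.
by exists 0 => _ [q [q1 q2 _] <-]; rewrite addr_ge0// mulr_ge0.
Qed.

Lemma concave_majorant_glb x y : (forall p, affine_majorants p -> y <= p.1 + p.2 * x) ->
  y <= concave_majorant x.
Proof.
move=> h; apply: lb_le_inf; first exact: affine_majorants_neq0.
by move=> _ [p mp <-]; exact: h.
Qed.

Lemma concave_majorant_ge0 x : 0 <= x -> 0 <= concave_majorant x.
Proof. by move=> x0; apply: concave_majorant_glb => p [p1 p2 _]; rewrite addr_ge0// mulr_ge0. Qed.

Lemma concave_majorant_ge t : Dom t -> phi t <= concave_majorant t.
Proof. by move=> Dt; apply: concave_majorant_glb => p [_ _]; exact. Qed.

Lemma concave_majorant_le t : Dom t -> concave_majorant t <= 2 * phi t.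
Proof.
move=> Dt; have /DomP/andP[t0 _] := Dt.
apply: le_trans (concave_majorant_lb (affine_majorant_at Dt) (ltW t0)) _ => /=.
by rewrite divfK ?gt_eqF//; lra.
Qed.

Lemma concave_majorant_mono s t : 0 <= s -> s <= t -> concave_majorant s <= concave_majorant t.
Proof.
move=> s0 st; apply: concave_majorant_glb => p mp.
apply: le_trans (concave_majorant_lb mp s0) _; case: mp => _ p2 _.
by rewrite lerD2l ler_wpM2l.
Qed.

Lemma concave_majorant_scale s t : 0 < s -> s <= t ->
  concave_majorant t * s <= concave_majorant s * t.
Proof.
move=> s0 st; have t0 : 0 < t by exact: lt_le_trans st.
rewrite -ler_pdivrMr//; apply: concave_majorant_glb => p mp.
rewrite ler_pdivrMr//; have [p1 p2 _] := mp.
have := concave_majorant_lb mp (ltW t0); nra.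
Qed.

Lemma concave_majorant_double s t : 0 < s -> s <= t -> t <= 2 * s ->
  concave_majorant t <= 2 * concave_majorant s.
Proof.
move=> s0 st t2s; have h := concave_majorant_scale s0 st.
have h0 := concave_majorant_ge0 (ltW s0); rewrite -(ler_pM2r s0); apply: le_trans h _.
by have := ler_wpM2l h0 t2s; lra.
Qed.

(* The value at the node 0 is reset to 0, which keeps the sequence concave. *)
Definition nodes n i : R := if i is 0%N then 0 else concave_majorant (dy n i).

Lemma nodes_ge0 n i : 0 <= nodes n i.
Proof. by case: i => //= i; apply: concave_majorant_ge0; exact: dy_ge0. Qed.

Lemma nodes_le n i p : affine_majorants p -> nodes n i <= p.1 + p.2 * dy n i.
Proof.
case: i => [|i] mp /=; last by apply: concave_majorant_lb => //; exact: dy_ge0.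
by case: mp => p1 p2 _; rewrite dy0 mulr0 addr0.
Qed.

Definition slope n i : R := nodes n i.+1 - nodes n i.

Lemma sum_slope n i : \sum_(j < i) slope n j = nodes n i.
Proof.
elim: i => [|i IH]; first by rewrite big_ord0.
by rewrite big_ord_recr/= IH /slope addrC subrK.
Qed.

Lemma slope_ge0 n i : 0 <= slope n i.
Proof.
rewrite subr_ge0; case: i => [|i]; first exact: nodes_ge0.
by apply: concave_majorant_mono; rewrite ?dy_ge0// dy_le.
Qed.

(** Every affine majorant bounds the values at both neighbouring nodes, hence their mean; at the
    node 0 this holds because intercepts are nonnegative. *)
Lemma slopeS n i : slope n i.+1 <= slope n i.
Proof.
suff : (nodes n i.+2 + nodes n i) / 2 <= nodes n i.+1 by rewrite /slope; lra.
apply: concave_majorant_glb => p mp.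
have := nodes_le n i.+2 mp; have := nodes_le n i mp.
by rewrite !dyS; lra.
Qed.

Lemma slope_nonincr n i j : (i <= j)%N -> slope n j <= slope n i.
Proof.
elim: j => [|j IH]; first by rewrite leqn0 => /eqP ->.
rewrite leq_eqVlt => /predU1P[->//|]; rewrite ltnS => /IH; exact: le_trans (slopeS _ _).
Qed.

(** The density whose integral over cell i is the increment [slope n i]; its primitive interpolates
    [nodes]. *)
Definition slope_step n i : R := slope n i * (2 ^ n)%:R.

Lemma slope_step_ge0 n i : 0 <= slope_step n i.
Proof. by rewrite mulr_ge0 ?slope_ge0. Qed.

(** In the first cell the primitive is a chord from the origin, below the majorant. Elsewhere t is
    rounded up to the next node, at the cost of a factor 2 by doubling. The other factor 2 compares
    the majorant with phi. *)
Lemma headint_slope n t : Dom t ->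
  (headint (step n (slope_step n)) t <= (4 * phi t)%:E)%E.
Proof.
move=> Dt; have /DomP/andP[t0 t1] := Dt.
have k0 i : (i < 2 ^ n)%N -> 0 <= slope_step n i by move=> _; exact: slope_step_ge0.
have ms := Mplus_step k0; have [[_ ct] tN] := Dom_cell n Dt.
move: ct tN; set i := Num.truncn _; rewrite /= in_itv/= => /andP[it ti] iN.
have P2 := concave_majorant_le Dt.
case: i it ti iN => [|i] it ti iN.
  have -> : headint (step n (slope_step n)) t = (slope_step n 0%N * t)%:E.
    rewrite EFinM -(integral_cst_head _ (ltW t0)); apply: eq_integral => x.
    rewrite inE /= in_itv/= => /andP[x0 xt]; apply: step_cell; apply: cell_itv => //.
    by rewrite dy0 (ltW x0) (lt_trans xt).
  rewrite lee_fin /slope_step /slope /= subr0.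
  have := concave_majorant_scale t0 (ltW ti).
  rewrite {2}/dy mul1r ler_pdivlMr ?exp2_gt0// => h.
  apply: le_trans (_ : 2 * phi t <= _); last by rewrite ler_wpM2r ?phi0// ler_nat.
  by apply: le_trans P2; rewrite mulrAC.
apply: (@le_trans _ _ (headint (step n (slope_step n)) (dy n i.+2))).
  have [m p] := Mplus_head ms (@dy_le1 R _ _ iN).
  apply: ge0_subset_integral => //; try exact: measurable_itv.
  by move=> x /=; rewrite !in_itv/= => /andP[-> xt]; rewrite (lt_trans xt ti).
rewrite headint_sum//.
have E (j : 'I_i.+2) : (\int[lebesgue_measure]_(x in cell n j) step n (slope_step n) x = (slope n j)%:E)%E.
  rewrite integral_cell_step ?(leq_trans (ltn_ord j))//.
  by rewrite /slope_step mulfK// gt_eqF// exp2_gt0.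
under eq_bigr do rewrite E.
rewrite sumEFin sum_slope lee_fin /=.
have h2 := dy_le_double n i.
have i0 := @dy_gt0 R n i.
have := concave_majorant_double i0 (ltW (le_lt_trans it ti)) h2.
have := concave_majorant_mono (ltW i0) it; lra.
Qed.

End concave_majorant.

(** * The Stieltjes functional is bounded by the target norm *)

Section lower_embedding.
Context {R : realType} (I : R -> R) (hI : quasiconcave I).
Variables (rhoX : (R -> \bar R) -> \bar R) (hX : ri_norm rhoX).
Local Notation mu := (@lebesgue_measure R).
Local Notation Dom := (@Dom R).
Implicit Types (f g h : R -> \bar R) (s t : R) (i j n : nat).

Lemma assoc_norm_holder g h : Mplus g -> assoc_norm rhoX g <= 1 -> Mplus h ->
  \int[mu]_(x in Dom) (h x * g x) <= rhoX h.
Proof.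
move=> mg g1 mh; have mD := @measurable_Dom R.
have hole k : Mplus k -> rhoX k <= 1 -> \int[mu]_(x in Dom) (k x * g x) <= 1.
  by move=> mk k1; apply: le_trans g1; apply: ereal_sup_ubound; exists k.
have := ri_ge0 hX mh; case E : (rhoX h) => [r| |]// r0; last exact: leey.
rewrite lee_fin in r0; have [r00|r1] := eqVneq r 0%R.
  have [_ [/(_ h mh)[h0 _] _]] := hX.
  have aeh := h0 (etrans E (congr1 EFin r00)).
  rewrite (@ge0_ae_eq_integral _ _ _ mu Dom _ (cst 0))//.
  - by rewrite integral0 r00.
  - exact: (MplusM mh mg).1.
  - exact: (MplusM mh mg).2.
  - by apply: (ae_imp aeh) => x Dx ->; rewrite mul0e.
have {r0 r1}r0 : (0 < r)%R by rewrite lt_def r1.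
have rV0 : (0 <= r^-1)%R by rewrite invr_ge0 ltW.
have := hole _ (MplusZ rV0 mh); rewrite ri_scale// E -EFinM mulVf ?gt_eqF// => /(_ (lexx _)).
under eq_integral => x _ do rewrite -muleA.
have [m p] := MplusM mh mg.
by rewrite ge0_integralZl ?lee_fin// lee_pdivrMl// mule1.
Qed.

Variables (g : R -> \bar R) (mg : Mplus g) (hg : assoc_norm rhoX (S_op I g) <= 1).

(** This is I(t) S_I g(t), the least nondecreasing majorant of I g^*. *)
Definition phiE t : \bar R := ereal_sup [set (I s)%:E * fstar g s | s in `]0%R, t]].

Lemma phiE_ub s t : Dom s -> (s <= t)%R -> (I s)%:E * fstar g s <= phiE t.
Proof.
by move=> /DomP/andP[s0 _] st; apply: ereal_sup_ubound; exists s => //=; rewrite in_itv/= s0.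
Qed.

Lemma phiE_lub t (y : \bar R) : Dom t ->
  (forall s, Dom s -> (s <= t)%R -> (I s)%:E * fstar g s <= y) -> phiE t <= y.
Proof.
move=> /DomP/andP[t0 t1] h; apply: ge_ereal_sup => _ [s /= + <-].
rewrite in_itv/= => /andP[s0 st]; apply: h => //.
by apply/DomP; rewrite s0 (le_lt_trans st).
Qed.

Lemma phiE_ge0 t : Dom t -> 0 <= phiE t.
Proof.
move=> Dt; apply: le_trans (phiE_ub Dt (lexx _)).
by rewrite mule_ge0 ?fstar_ge0// lee_fin ltW// I_gt0.
Qed.

Lemma phiE_mono s t : Dom s -> Dom t -> (s <= t)%R -> phiE s <= phiE t.
Proof.
move=> Ds Dt st; apply: phiE_lub => // u Du us; apply: phiE_ub => //; exact: le_trans st.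
Qed.

Lemma Mplus_phiE : Mplus phiE.
Proof.
split; last exact: phiE_ge0.
by apply: nondecr_emeasurable; [exact: Dom_interval|exact: phiE_mono].
Qed.

Lemma Mplus_S_op : Mplus (S_op I g).
Proof. exact: (MplusM (Mplus_Iinv hI) Mplus_phiE). Qed.

(** An infinite value at t would make S_I g infinite on (t,1), against the Hölder inequality tested
    with the constant 1. *)
Lemma phiE_fin t : Dom t -> phiE t \is a fin_num.
Proof.
move=> Dt; rewrite ge0_fin_numE ?phiE_ge0// ltey; apply/negP => /eqP phiy.
have m1 := @Mplus_cst R 1 ler01.
have := le_lt_trans (assoc_norm_holder Mplus_S_op hg m1) (ri_one hX).
have /DomP/andP[t0 t1] := Dt.
have mI : measurable (`]t, 1%R[%classic : set R) by exact: measurable_itv.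
have [m p] := MplusM m1 Mplus_S_op.
suff -> : \int[mu]_(x in Dom) (cst 1 x * S_op I g x) = +oo by [].
apply/eqP; rewrite -leye_eq.
apply: (@le_trans _ _ (\int[mu]_(x in `]t, 1%R[) cst +oo x)).
  have -> : \int[mu]_(x in `]t, 1%R[) cst +oo x = +oo * mu `]t, 1%R[%classic.
    by rewrite -[RHS]integral_cst.
  by rewrite lebesgue_measure_itv/= lte_fin t1 -EFinB gt0_mulye// lte_fin subr_gt0.
apply: (@le_trans _ _ (\int[mu]_(x in `]t, 1%R[) (cst 1 x * S_op I g x))); last first.
  apply: ge0_subset_integral => //; [exact: measurable_Dom|exact: tail_subDom (ltW t0)].
apply: ge0_le_integral => //.
- by move=> x _; exact: leey.
- by apply: measurable_funS m; [exact: measurable_Dom|exact: tail_subDom (ltW t0)].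
move=> x xt; have Dx := tail_subDom (ltW t0) xt.
have -> : S_op I g x = +oo; last by rewrite /cst mul1e.
have -> : S_op I g x = Iinv I x * phiE x by [].
have -> : phiE x = +oo.
  apply/eqP; rewrite -leye_eq -phiy; apply: phiE_mono => //.
  by move: xt; rewrite /= in_itv/= => /andP[/ltW].
by rewrite gt0_muley// lte_fin invr_gt0 I_gt0.
Qed.

Definition phir t : R := fine (phiE t).

Lemma phirE t : Dom t -> (phir t)%:E = phiE t.
Proof. by move=> Dt; rewrite fineK// phiE_fin. Qed.

Lemma phir_ge0 t : Dom t -> (0 <= phir t)%R.
Proof. by move=> Dt; rewrite fine_ge0// phiE_ge0. Qed.

Lemma phir_mono s t : Dom s -> Dom t -> (s <= t)%R -> (phir s <= phir t)%R.
Proof. by move=> Ds Dt st; rewrite -lee_fin !phirE// phiE_mono. Qed.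

(** For s < u <= t one has I(u) g^*(u) <= (u/s) I(s) g^*(s), because I(u)/u and g^* are
    nonincreasing. *)
Lemma phir_scale s t : Dom s -> Dom t -> (s <= t)%R -> (phir t * s <= phir s * t)%R.
Proof.
move=> Ds Dt st; have /DomP/andP[s0 _] := Ds; have /DomP/andP[t0 _] := Dt.
rewrite -ler_pdivlMr// -lee_fin phirE//; apply: phiE_lub => // u Du ut.
have /DomP/andP[u0 _] := Du.
have [us|su] := leP u s.
  apply: le_trans (phiE_ub Du us) _; rewrite -phirE// lee_fin ler_pdivlMr//.
  by rewrite ler_wpM2l ?phir_ge0.
have gs : (I s)%:E * fstar g s <= (phir s)%:E by rewrite phirE//; exact: phiE_ub.
have gu := fstar_nonincr g (ltW su).
apply: (@le_trans _ _ ((t / s)%:E * ((I s)%:E * fstar g s))); last first.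
  have -> : (phir s * t / s = t / s * phir s)%R by rewrite [RHS]mulrC mulrA.
  by rewrite [leRHS]EFinM; apply: lee_wpmul2l => //; rewrite lee_fin divr_ge0// ltW.
rewrite muleA -EFinM; apply: le_trans (lee_wpmul2l _ gu) _.
  by rewrite lee_fin ltW// I_gt0.
apply: lee_wpmul2r; first exact: fstar_ge0.
rewrite lee_fin mulrAC ler_pdivlMr//.
apply: le_trans (I_scale hI Ds Du (ltW su)) _.
by rewrite [leRHS]mulrC ler_wpM2l// ltW// I_gt0.
Qed.

Let k n := slope_step phir n.

(** The factor 1/4 cancels the constant of [headint_slope], so the primitive divided by I lies below
    S_I g and Hölder applies. *)
Lemma quarter_slope_dual n : dual_steps I rhoX (n, fun i => (4^-1 * k n i)%R).
Proof.
have kk i : (i < 2 ^ n)%N -> (0 <= k n i)%R.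
  by move=> _; apply: slope_step_ge0; [exact: phir_ge0|exact: phir_mono|exact: phir_scale].
have k0 i : (i < 2 ^ n)%N -> (0 <= 4^-1 * k n i)%R.
  by move=> iN; rewrite mulr_ge0 ?invr_ge0// kk.
split => //= [i j /andP[ij _]|h mh].
  rewrite ler_wpM2l ?invr_ge0// /k /slope_step ler_wpM2r//.
  by apply: slope_nonincr => //; [exact: phir_ge0|exact: phir_mono|exact: phir_scale].
have mk := Mplus_step k0; have mkk := Mplus_step kk.
rewrite H_dual//; apply: le_trans (assoc_norm_holder Mplus_S_op hg mh).
have mhI := Mplus_hIinv hI mh.
have sE x : step n (fun i => (4^-1 * k n i)%R) x = (4^-1 : R)%:E * step n (k n) x.
  by rewrite /step EFinM.
have hE t : Dom t -> headint (step n (fun i => (4^-1 * k n i)%R)) t = (4^-1 : R)%:E * headint (step n (k n)) t.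
  move=> /DomP/andP[_ /ltW t1]; rewrite /headint; under eq_integral => x _ do rewrite sE.
  have [m p] := Mplus_head mkk t1.
  by rewrite ge0_integralZl// lee_fin invr_ge0.
have hle t : Dom t -> headint (step n (fun i => (4^-1 * k n i)%R)) t <= phiE t.
  move=> Dt; rewrite hE//.
  apply: le_trans (lee_wpmul2l _ (headint_slope phir_ge0 phir_mono phir_scale n Dt)) _.
    by rewrite lee_fin invr_ge0.
  by rewrite -EFinM mulrA mulVf ?mul1r ?phirE.
have mhead := Mplus_headint mk.
apply: le_integral_Dom; [exact: MplusM|by apply: MplusM => //; exact: Mplus_S_op|].
move=> t Dt; rewrite -muleA; apply: lee_wpmul2l; first exact: mh.2.
by apply: lee_wpmul2l; [exact: (Mplus_Iinv hI).2|exact: hle].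
Qed.

(** The constant is 8 = 2 * 4: a factor 2 for replacing the majorant on a cell by its value at the
    left node, a factor 4 for the normalisation in [quarter_slope_dual]. *)
Lemma stieltjes_le_rhoZ f : Mplus f -> \int[mu]_(x in Dom) f x < +oo ->
  stieltjes_neg (fstar f) (fun t => (I t)%:E * fstar g t) <= 8%:E * rhoZ I rhoX f.
Proof.
move=> mf ff; have [M aM] := admissible_shifted hI hX.
have Z0 : 0 <= rhoZ I rhoX f by exact: (sup_norm_ge0 aM mf).
rewrite /stieltjes_neg ge_max mule_ge0//=; apply: ge_ereal_sup => _ [a [G [a01 GE ->]]].
have /andP[a0 a1] := a01.
(* A mesh finer than [a] hides the first cell, where the value at the left node is reset to 0. *)
have [n na] : exists n, (@dy R n 1 <= a)%R.
  have [n] := ltr_add_invr a0; rewrite add0r => hn; exists n; rewrite /dy mul1r.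
  apply: le_trans (ltW hn); rewrite lef_pV2 ?posrE ?exp2_gt0// ler_nat.
  by rewrite (leq_trans _ (ltn_expl n (ltnSn 1))).
pose P i := nodes phir n i.
have P0 i : (0 <= P i)%R by apply: nodes_ge0; [exact: phir_ge0|exact: phir_mono|exact: phir_scale].
have mI : Mplus (fun t => (I t)%:E).
  split; last by move=> x Dx; rewrite lee_fin ltW// I_gt0.
  apply: nondecr_emeasurable; first exact: Dom_interval.
  by move=> s t Ds Dt st; rewrite lee_fin I_mono.
have mu' : Mplus (fun t => (I t)%:E * fstar g t) by apply: MplusM => //; exact: Mplus_fstar.
apply: le_trans (@stieltjes_le_sum _ f G a n (fun i => 2 * P i)%R _ mf ff a01 GE na mu' _ _ _) _.
- by rewrite /P /= mulr0.
- by move=> i; rewrite mulr_ge0.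
- move=> [|i] t //= iN Dt; rewrite /cell_oc /= in_itv/= => /andP[it ti].
  apply: le_trans (phiE_ub Dt (lexx _)) _; rewrite -phirE// lee_fin.
  apply: le_trans (concave_majorant_ge phir_ge0 phir_mono phir_scale Dt) _.
  have i0 := @dy_gt0 R n i.
  have h1 := concave_majorant_mono phir_ge0 phir_mono phir_scale (ltW (lt_trans i0 it)) ti.
  apply: le_trans h1 _; apply: concave_majorant_double => //.
  + exact: phir_ge0.
  + exact: phir_mono.
  + exact: phir_scale.
  + exact: (ltW (lt_le_trans it ti)).
  + exact: dy_le_double.
(* Summation by parts; the boundary term vanishes because f^*(1) = 0. *)
have E : (\sum_(i < 2 ^ n) 2 * P i * (fstarr f (dy n i) - fstarr f (dy n i.+1)) =
          2 * \sum_(i < 2 ^ n) slope phir n i * fstarr f (dy n i.+1))%R.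
  have := abel_sum (2 ^ n) (slope phir n) (fun i => fstarr f (dy n i)).
  rewrite dy1 fstarr1// mulr0 subr0 => <-; rewrite mulr_sumr; apply: eq_bigr => i _.
  by rewrite sum_slope mulrA.
rewrite E.
have dk := quarter_slope_dual n; have [k0 kn _] := dk; rewrite /= in k0 kn.
have mk := Mplus_step k0; have mfs := Mplus_fstar f.
have k10 i : (i < 2 ^ n)%N -> (0 <= 4^-1 * k n i + 1)%R by move=> /k0 ?; rewrite addr_ge0.
have mk1 := Mplus_step k10.
apply: (@le_trans _ _ (8%:E * \int[mu]_(x in Dom) (fstar f x * step n (fun i => (4^-1 * k n i)%R) x))); last first.
  apply: lee_wpmul2l => //.
  apply: (@le_trans _ _ (\int[mu]_(x in Dom) (fstar f x * step n (fun i => (4^-1 * k n i + 1)%R) x))).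
    apply: le_integral_Dom; try exact: MplusM.
    move=> x Dx; apply: lee_wpmul2l; first exact: fstar_ge0.
    by rewrite step_shift leeDl.
  apply: (@sup_norm_ub _ _ (n, fun i => (4^-1 * k n i + 1)%R)).
  by exists (n, fun i => (4^-1 * k n i)%R).
rewrite integral_step// ge0_sume_distrr; last first.
  move=> i _; rewrite mule_ge0 ?lee_fin ?k0//; exact: integral_cell_ge0.
rewrite mulr_sumr -sumEFin; apply: lee_sum => i _.
have Fi : (fstarr f (dy n i.+1) / (2 ^ n)%:R)%:E <= \int[mu]_(x in cell n i) fstar f x.
  have [m p] := Mplus_restr (measurable_cell n i) (@cell_Dom R n i) mfs.
  rewrite EFinM fineK; last by apply: fstar_fin_gt0 => //; exact: dy_gt0.
  rewrite -(integral_cst_cell _ (ltn_ord i)); apply: ge0_le_integral => //.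
  - exact: measurable_cell.
  - by move=> x _; exact: fstar_ge0.
  move=> x [_ /=]; rewrite in_itv/= => /andP[_ /ltW xi]; exact: fstar_nonincr.
rewrite muleA -EFinM; apply: le_trans (lee_wpmul2l _ Fi); last first.
  by rewrite lee_fin mulr_ge0// k0.
rewrite -EFinM lee_fin /k /slope_step le_eqVlt; apply/orP; left; apply/eqP.
by field; rewrite gt_eqF// exp2_gt0.
Qed.

End lower_embedding.

(** * The weight of a norming functional *)

Section upper_preliminaries.
Context {R : realType}.
Local Notation mu := (@lebesgue_measure R).
Local Notation Dom := (@Dom R).
Implicit Types (f g h : R -> \bar R) (s t : R) (i j n : nat) (v w : nat -> R).

Lemma step_nonincr n v s t : (forall i j, (i <= j < 2 ^ n)%N -> (v j <= v i)%R) ->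
  Dom s -> Dom t -> (s <= t)%R -> step n v t <= step n v s.
Proof.
move=> vn Ds Dt st; have [_ tN] := Dom_cell n Dt.
rewrite lee_fin; apply: vn; rewrite tN andbT; apply: le_truncn.
by rewrite ler_wpM2r.
Qed.

(** Equality, and not only [fstar_le_nonincr], because right-open cells make the step function
    right-continuous. *)
Lemma fstar_step_nonincr n v t : (forall i, (i < 2 ^ n)%N -> (0 <= v i)%R) ->
  (forall i j, (i <= j < 2 ^ n)%N -> (v j <= v i)%R) -> Dom t ->
  fstar (step n v) t = step n v t.
Proof.
move=> v0 vn Dt; have ms := Mplus_step v0.
apply/eqP; rewrite eq_le; apply/andP; split.
  by apply: fstar_le_nonincr => // s u; exact: step_nonincr.
have [ct tN] := Dom_cell n Dt; set i := Num.truncn _ in ct tN.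
apply: le_ereal_real => [|l l0 lv]; first exact: fstar_ge0.
rewrite lt_fstar//; apply: (@lt_le_trans _ _ (dy n i.+1)%:E).
  by case: ct => _ /=; rewrite in_itv/= lte_fin => /andP[].
rewrite -(mu_head (dy_ge0 n i.+1)); apply: le_measure; rewrite ?inE.
- exact: measurable_itv.
- exact: measurable_superlevel.
move=> x /= xi; have Dx := head_subDom (dy_le1 tN) xi; split => //=.
apply: lt_le_trans lv _; have [cx xN] := Dom_cell n Dx.
rewrite (step_cell _ ct) (step_cell _ cx) lee_fin; apply: vn; rewrite tN andbT.
move: xi; rewrite /= in_itv/= => /andP[_ xi].
case: cx => _ /=; rewrite in_itv/= => /andP[h _].
by have := le_lt_trans h xi; rewrite dy_lt ltnS.
Qed.

Lemma fstar_le_integral f t : Mplus f -> (0 < t <= 1)%R ->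
  t%:E * fstar f t <= \int[mu]_(x in Dom) f x.
Proof.
move=> mf /andP[t0 t1]; rewrite -(integral_fstar mf).
have [m p] := Mplus_head (Mplus_fstar f) t1.
apply: (@le_trans _ _ (headint (fstar f) t)); last first.
  apply: ge0_subset_integral => //; [exact: measurable_Dom|exact: (Mplus_fstar f).1| |exact: head_subDom].
  by move=> x _; exact: fstar_ge0.
rewrite muleC -(integral_cst_head _ (ltW t0)); apply: ge0_le_integral => //.
- by move=> x _; exact: fstar_ge0.
by move=> x /=; rewrite in_itv/= => /andP[_ /ltW]; exact: fstar_nonincr.
Qed.

Lemma exists_sorting_perm (N : nat) (w : 'I_N -> R) :
  exists p : {perm 'I_N}, forall i j : 'I_N, (i <= j)%N -> (w (p j) <= w (p i))%R.
Proof.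
pose r : rel 'I_N := fun a b => (w b <= w a)%R.
pose s := sort r (enum 'I_N).
have rt : total r by move=> a b; exact: le_total.
have rtr : transitive r by move=> a b c ab bc; exact: le_trans bc ab.
have rr : reflexive r by move=> a; rewrite /r.
have ss : sorted r s by exact: sort_sorted.
have sz : size s = N by rewrite size_sort size_enum_ord.
have us : uniq s by rewrite sort_uniq enum_uniq.
pose q (i : 'I_N) := nth i s i.
have qI : injective q.
  move=> i j; rewrite /q (set_nth_default i) ?sz// => /eqP; rewrite nth_uniq ?sz//.
  by move/eqP/val_inj.
exists (perm qI) => i j ij; rewrite !permE /q (set_nth_default i) ?sz//.
by apply: (sorted_leq_nth rtr rr i ss) => //; rewrite inE sz.
Qed.

End upper_preliminaries.

Section weight.
Context {R : realType} (I : R -> R) (hI : quasiconcave I).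
Local Notation mu := (@lebesgue_measure R).
Local Notation Dom := (@Dom R).
Implicit Types (f g h : R -> \bar R) (s t : R) (i j : nat) (v : nat -> R).

Variables (n : nat) (n0 : (0 < n)%N) (k : nat -> R).
Hypothesis k0 : forall i, (i < 2 ^ n)%N -> (0 <= k i)%R.
Hypothesis kn : forall i j, (i <= j < 2 ^ n)%N -> (k j <= k i)%R.

(** The value K(j/2^n), when K has density [k i * 2^n] on cell i. *)
Definition prim (j : nat) : R := \sum_(i < j) k i.

Lemma prim_mono i j : (i <= j <= 2 ^ n)%N -> (prim i <= prim j)%R.
Proof.
move=> /andP[]; elim: j => [|j IH]; first by rewrite leqn0 => /eqP ->.
rewrite leq_eqVlt => /predU1P[->//|]; rewrite ltnS => ij jN.
apply: le_trans (IH ij (ltnW jN)) _.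
by rewrite /prim big_ord_recr/= lerDl k0.
Qed.

Lemma prim_ge0 i : (i <= 2 ^ n)%N -> (0 <= prim i)%R.
Proof. by move=> iN; have := @prim_mono 0%N i iN; rewrite /prim big_ord0. Qed.

Lemma dy_Dom i : (0 < i < 2 ^ n)%N -> Dom (dy n i).
Proof.
by move=> /andP[i0 iN]; apply/DomP; rewrite -(dy0 n) -(dy1 n) !dy_lt i0.
Qed.

(* The quotient K / I at the nodes, with the value 0 at the node 0, where I is not
   controlled. *)
Definition weight i : R := if i is 0%N then 0%R else (prim i / I (dy n i))%R.

Lemma weight_ge0 i : (i < 2 ^ n)%N -> (0 <= weight i)%R.
Proof.
case: i => //= i iN; rewrite divr_ge0 ?prim_ge0 1?ltnW//.
by apply/ltW/(I_gt0 hI)/dy_Dom.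
Qed.

(** The least nonincreasing majorant of [weight]; the default 0 is harmless for nonnegative
    weights. *)
Definition maxweight i : R := \big[Num.max/0%R]_(j < 2 ^ n | (i <= j)%N) weight j.

Lemma maxweight_ge0 i : (0 <= maxweight i)%R.
Proof. exact: bigmax_ge_id. Qed.

Lemma maxweight_ub i j : (i <= j < 2 ^ n)%N -> (weight j <= maxweight i)%R.
Proof.
move=> /andP[ij jN].
exact: (@le_bigmax_cond _ R _ 0%R (Ordinal jN) (fun o : 'I_(2 ^ n) => (i <= o)%N) (fun o => weight o) ij).
Qed.

Lemma maxweight_lub i y : (0 <= y)%R -> (forall j, (i <= j < 2 ^ n)%N -> (weight j <= y)%R) ->
  (maxweight i <= y)%R.
Proof. by move=> y0 h; apply: bigmax_le => // j ij; apply: h; rewrite ij/=. Qed.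

Lemma maxweight_nonincr i j : (i <= j)%N -> (maxweight j <= maxweight i)%R.
Proof.
move=> ij; apply: maxweight_lub; first exact: maxweight_ge0.
by move=> m /andP[jm mN]; apply: maxweight_ub; rewrite mN (leq_trans ij).
Qed.

Lemma I_dyS i : (0 < i)%N -> (i.+1 < 2 ^ n)%N -> (I (dy n i.+1) <= 2 * I (dy n i))%R.
Proof.
move=> i0 iN; apply: I_double => //; try by apply: dy_Dom; rewrite ?i0 ?(ltnW iN).
by case: i i0 iN => // i _ _; exact: dy_le_double.
Qed.

Lemma prim_le_maxweight i t : (0 < i < 2 ^ n)%N -> Dom t -> (dy n i <= t)%R ->
  (prim i <= I t * maxweight i)%R.
Proof.
move=> iN Dt it; have Di := dy_Dom iN; have Ii := I_gt0 hI Di.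
have -> : prim i = (I (dy n i) * weight i)%R.
  by case: i iN Di Ii {it} => // i iN Di Ii /=; rewrite mulrC divfK// gt_eqF.
apply: ler_pM; [exact: ltW|by apply: weight_ge0; case/andP: iN| |].
- exact: I_mono.
- by apply: maxweight_ub; rewrite leqnn; case/andP: iN.
Qed.

(** The inequality behind S_I g <= 2 g. A node j >= i' is already counted in [maxweight i']. For i
    <= j < i' with j > 0, I(s) is at most 2 I(j/2^n), so the denominator of [weight j] cancels and
    leaves 2 [prim j] <= 2 [prim i']. *)
Lemma I_maxweight_le s t i i' : Dom s -> Dom t -> (s <= t)%R -> cell n i s -> cell n i' t ->
  (i' < 2 ^ n)%N -> (I s * maxweight i <= 2 * I t * maxweight i')%R.
Proof.
move=> Ds Dt st cs ct i'N; have It := I_gt0 hI Dt; have Is := I_gt0 hI Ds.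
have M0 := maxweight_ge0 i'.
rewrite mulrC -ler_pdivlMr//; apply: maxweight_lub => [|j /andP[ij jN]].
  by rewrite divr_ge0 ?mulr_ge0// ltW.
rewrite ler_pdivlMr//; have [i'j|ji'] := leqP i' j.
  have := @maxweight_ub i' j; rewrite i'j jN => /(_ isT) h.
  rewrite mulrC; apply: (@le_trans _ _ (I t * maxweight i')%R); last first.
    by rewrite ler_wpM2r// mulr_natl mulr2n lerDl ltW.
  by apply: ler_pM => //; [exact: ltW|exact: weight_ge0|exact: I_mono].
case: j ij jN ji' => [|j] ij jN ji'.
  by rewrite /= mul0r !mulr_ge0// ltW.
have j'N : (j.+2 < 2 ^ n)%N by exact: leq_ltn_trans ji' i'N.
have Dj : Dom (dy n j.+1) by apply: dy_Dom; rewrite jN.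
have Dj' : Dom (dy n j.+2) by apply: dy_Dom; rewrite j'N.
have Ij := I_gt0 hI Dj.
have sj : (I s <= 2 * I (dy n j.+1))%R.
  apply: le_trans (I_dyS _ j'N) => //; apply: I_mono => //.
  case: cs => _ /=; rewrite in_itv/= => /andP[_ /ltW h]; apply: le_trans h _.
  by rewrite dy_le.
have i'0 : (0 < i' < 2 ^ n)%N by rewrite i'N andbT (leq_trans _ ji').
have tc : (dy n i' <= t)%R by case: ct => _ /=; rewrite in_itv/= => /andP[].
have h1 := prim_le_maxweight i'0 Dt tc.
have h2 : (prim j.+1 <= prim i')%R by apply: prim_mono; rewrite (ltnW ji') ltnW.
apply: (@le_trans _ _ (weight j.+1 * (2 * I (dy n j.+1)))%R).
  by apply: ler_wpM2l => //; exact: weight_ge0.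
rewrite /= mulrCA divfK ?gt_eqF//; lra.
Qed.

Let c := I 2^-1.

(** Nodes in the right half, from which one cannot double inside (0,1); there I is at least I(1/2)/2
    and [weight] is bounded by the total mass. *)
Lemma weight_tail j : (0 < j < 2 ^ n)%N -> (2 ^ n <= j.*2)%N ->
  (weight j <= 2 / c * prim (2 ^ n))%R.
Proof.
move=> /andP[]; case: j => // j _ jN jN2.
have c0 : (0 < c)%R by apply: I_gt0 => //; exact: half_Dom.
have Dj : Dom (dy n j.+1) by apply: dy_Dom; rewrite jN.
have Ij := I_gt0 hI Dj.
rewrite /= ler_pdivrMr//.
have p1 : (prim j.+1 <= prim (2 ^ n))%R by apply: prim_mono; rewrite leqnn (ltnW jN).
have hj : (1 <= 2 * (dy n j.+1 : R))%R.
  by rewrite /dy mulrA ler_pdivlMr ?exp2_gt0// mul1r -natrM ler_nat mul2n.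
have Ic := I_ge_linear hI Dj; rewrite -/c in Ic.
apply: le_trans p1 _; have P0 : (0 <= prim (2 ^ n))%R by exact: prim_ge0.
rewrite mulrAC -[leLHS]mul1r; apply: ler_wpM2r => //.
rewrite mulrAC ler_pdivlMr// mul1r; nra.
Qed.

(** Between j and 2j the primitive does not decrease and I at most doubles. *)
Lemma weight_half j m : (0 < j)%N -> (j <= m <= j.*2)%N -> (m < 2 ^ n)%N ->
  (weight j / 2 <= weight m)%R.
Proof.
move=> j0 /andP[jm m2] mN; have jN : (j < 2 ^ n)%N by exact: leq_ltn_trans mN.
have m0 : (0 < m)%N by exact: leq_trans jm.
have Dj : Dom (dy n j) by apply: dy_Dom; rewrite j0.
have Dm : Dom (dy n m) by apply: dy_Dom; rewrite m0.
have Ij := I_gt0 hI Dj; have Im := I_gt0 hI Dm.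
have pj : (prim j <= prim m)%R by apply: prim_mono; rewrite jm ltnW.
have I2 : (I (dy n m) <= 2 * I (dy n j))%R.
  apply: I_double => //; rewrite /dy mulrA ler_pM2r ?invr_gt0 ?exp2_gt0//.
  by rewrite -natrM ler_nat mul2n.
have -> : weight j = (prim j / I (dy n j))%R by case: j j0 {jm m2 jN Dj Ij pj I2}.
have -> : weight m = (prim m / I (dy n m))%R by case: m m0 {jm m2 mN Dm Im pj I2}.
rewrite ler_pdivrMr// ler_pdivrMr//; apply: le_trans pj _; rewrite -!mulrA -[leLHS]mulr1.
by apply: ler_wpM2l; [rewrite prim_ge0// ltnW|rewrite ler_pdivlMl// mulr1].
Qed.

End weight.

(** * The target norm is bounded by the Stieltjes functional *)

Section upper_embedding.
Context {R : realType} (I : R -> R) (hI : quasiconcave I).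
Variables (rhoX rhoY : (R -> \bar R) -> \bar R) (hX : ri_norm rhoX) (hY : ri_norm rhoY).
Local Notation mu := (@lebesgue_measure R).
Local Notation Dom := (@Dom R).
Implicit Types (f g h : R -> \bar R) (s t : R) (i j : nat) (v : nat -> R).

Variables (CH : R) (CH0 : (0 < CH)%R).
Hypothesis hH : forall f, Mplus f -> rhoY (H_op I f) <= CH%:E * rhoX f.
Variables (CX : R) (CX0 : (0 < CX)%R).
Hypothesis hCX : forall f, Mplus f -> \int[mu]_(x in Dom) f x <= CX%:E * rhoX f.
Variables (MY : R) (hMY : rhoY (cst 1) = MY%:E).
Variables (n : nat) (n0 : (0 < n)%N) (k : nat -> R).
Hypothesis k0 : forall i, (i < 2 ^ n)%N -> (0 <= k i)%R.
Hypothesis kn : forall i j, (i <= j < 2 ^ n)%N -> (k j <= k i)%R.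
Hypothesis kv : forall v, (forall i, (i < 2 ^ n)%N -> (0 <= v i)%R) ->
  (\sum_(i < 2 ^ n) k i * v i)%R%:E <= rhoY (step n v).

Let N : R := (2 ^ n)%:R.
Let N0 : (0 < N)%R. Proof. exact: exp2_gt0. Qed.
Let c := I 2^-1.
Let c0 : (0 < c)%R. Proof. by apply: I_gt0 => //; exact: half_Dom. Qed.
Let K i := (k i * N)%R.

Let K0 i : (i < 2 ^ n)%N -> (0 <= K i)%R.
Proof. by move=> iN; rewrite mulr_ge0 ?k0// ltW. Qed.

Lemma prim_total_le : (prim k (2 ^ n) <= MY)%R.
Proof.
have h := @kv (fun=> 1%R) (fun _ _ => ler01).
rewrite -lee_fin -hMY; apply: le_trans h.
by rewrite lee_fin /prim; apply: ler_sum => i _; rewrite mulr1.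
Qed.

Let MY0 : (0 <= MY)%R.
Proof. by apply: le_trans prim_total_le; exact: (prim_ge0 k0 (leqnn _)). Qed.

Lemma headint_step_prim i : (i <= 2 ^ n)%N -> headint (step n K) (dy n i) = (prim k i)%:E.
Proof.
move=> iN; rewrite headint_sum//; last exact: Mplus_step.
rewrite -sumEFin; apply: eq_bigr => j _.
by rewrite integral_cell_step ?(leq_trans (ltn_ord j))// /K mulfK// gt_eqF.
Qed.

(** By duality for H, the functional [k] on H v is v tested against K/I. On each cell but the first,
    K/I is at least half of [weight], since I at most doubles across it; on the first cell [weight]
    is 0. *)
Lemma weight_test v : (forall i, (i < 2 ^ n)%N -> (0 <= v i)%R) ->
  (\sum_(i < 2 ^ n) weight I n k i * v i / N)%R%:E <= (2 * CH)%:E * rhoX (step n v).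
Proof.
move=> v0; have mv := Mplus_step v0; have mK := Mplus_step K0.
pose q t := Iinv I t * headint (step n K) t.
have mq : Mplus q by apply: MplusM; [exact: Mplus_Iinv|exact: Mplus_headint].
have w0 i : (i < 2 ^ n)%N -> (0 <= weight I n k i)%R by exact: weight_ge0.
apply: (@le_trans _ _ (2%:E * \int[mu]_(x in Dom) (q x * step n v x))).
  rewrite integral_step// ge0_sume_distrr; last first.
    by move=> i _; rewrite mule_ge0 ?lee_fin ?v0//; exact: integral_cell_ge0.
  rewrite -sumEFin; apply: lee_sum => i _.
  have cell_bound : (weight I n k i / 2 / N)%:E <= \int[mu]_(x in cell n i) q x.
    have [m p] := Mplus_restr (measurable_cell n i) (@cell_Dom R n i) mq.
    rewrite EFinM -(integral_cst_cell _ (ltn_ord i)).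
    apply: ge0_le_integral => //; first exact: measurable_cell.
      by move=> x _; rewrite lee_fin divr_ge0 ?w0.
    move=> x cx; have Dx := cell_Dom cx.
    case: i {m p} cx => -[|i] iN cx /=; first by rewrite mul0r; exact: mq.2.
    have Di : Dom (dy n i.+1) by apply: dy_Dom; rewrite iN.
    have Ii := I_gt0 hI Di; have Ix := I_gt0 hI Dx.
    move: cx => [_ /=]; rewrite in_itv/= => /andP[ix xi].
    have I2 : (I x <= 2 * I (dy n i.+1))%R.
      by apply: I_double => //; apply: le_trans (ltW xi) _; exact: dy_le_double.
    apply: (@le_trans _ _ ((I x)^-1 * prim k i.+1)%:E).
      rewrite lee_fin [leRHS]mulrC -mulrA; apply: ler_wpM2l.
        exact: (prim_ge0 k0 (ltnW iN)).
      by rewrite -invfM lef_pV2 ?posrE ?mulr_gt0// mulrC.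
    rewrite EFinM; apply: lee_wpmul2l; first by rewrite lee_fin invr_ge0 ltW.
    rewrite -headint_step_prim ?(ltnW iN)//.
    have /DomP/andP[x0 /ltW x1] := Dx; have [m p] := Mplus_head mK x1.
    apply: ge0_subset_integral => //; try exact: measurable_itv.
    by move=> y /=; rewrite !in_itv/= => /andP[-> yi]; rewrite (lt_le_trans yi).
  have -> : (weight I n k i * v i / N)%:E = 2%:E * ((v i)%:E * (weight I n k i / 2 / N)%:E).
    by rewrite -!EFinM; congr EFin; field; rewrite gt_eqF.
  by apply: lee_wpmul2l => //; apply: lee_wpmul2l => //; rewrite lee_fin v0.
rewrite EFinM -muleA; apply: lee_wpmul2l => //.
apply: le_trans (hH mv); rewrite -[leRHS]mul1e.
(* H v is not a step function, so the bound [kv] has to be extended to it. *)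
apply: le_trans (step_dual_le hY ltr01 k0 kn _ (Mplus_H hI mv)); last first.
  by move=> u u0; rewrite mul1e; exact: kv.
rewrite H_dual// le_eqVlt; apply/orP; left; apply/eqP; apply: eq_integral => x _.
by rewrite /q muleC muleA.
Qed.

(** The term 4 CH is the factor 2 of [maxweight_le_sorted] times the constant of [weight_test]; the
    rest is the additive constant of [maxweight_le_sorted] integrated through the embedding of X
    into L^1. *)
Let CB : R := (4 * CH + 2 / c * MY * CX)%R.
Let CB0 : (0 < CB)%R.
Proof.
have h1 : (0 < 4 * CH)%R by rewrite mulr_gt0.
have h2 : (0 <= 2 / c * MY * CX)%R by rewrite !mulr_ge0 ?invr_ge0// ltW.
by rewrite /CB; lra.
Qed.

(* After sorting, the doubling of [weight] makes it comparable with its least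
   nonincreasing majorant, up to a constant coming from the last cells. *)
Lemma maxweight_le_sorted (p : {perm 'I_(2 ^ n)}) :
  (forall i j : 'I_(2 ^ n), (i <= j)%N -> (weight I n k (p j) <= weight I n k (p i))%R) ->
  forall i : 'I_(2 ^ n), (maxweight I n k i <= 2 * weight I n k (p i) + 2 / c * MY)%R.
Proof.
move=> hp i; have w0 j : (j < 2 ^ n)%N -> (0 <= weight I n k j)%R by exact: weight_ge0.
have cM : (0 <= 2 / c * MY)%R by rewrite mulr_ge0// divr_ge0// ltW.
apply: maxweight_lub => [|j /andP[ij jN]]; first by rewrite addr_ge0// mulr_ge0// w0.
have [j0|j0] := posnP j; first by rewrite j0 /= addr_ge0// mulr_ge0// w0.
have [jN2|jN2] := leqP (2 ^ n) j.*2.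
  have jj : (0 < j < 2 ^ n)%N by rewrite j0.
  apply: le_trans (weight_tail hI k0 jj jN2) _.
  rewrite -[leLHS]add0r; apply: lerD; first by rewrite mulr_ge0// w0.
  by apply: ler_wpM2l prim_total_le; rewrite divr_ge0// ltW.
rewrite -[leLHS]addr0; apply: lerD => //.
(* Pigeonhole: otherwise each of the i + 1 nodes j, ..., j + i, all at most 2j, has weight at least
   half of [weight j], hence above the entry at sorted position i, and would occupy one of the i
   positions before it. *)
rewrite mulrC -ler_pdivrMr// leNgt; apply/negP => lt_w.
have hm (m : 'I_i.+1) : (j + m < 2 ^ n)%N.
  apply: leq_ltn_trans jN2; rewrite -addnn leq_add2l.
  by apply: leq_trans ij; rewrite -ltnS.
pose q (m : 'I_i.+1) := (p^-1)%g (Ordinal (hm m)).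
have qi m : (q m < i)%N.
  rewrite ltnNge; apply/negP => iq; have := hp _ _ iq; rewrite /q permKV leNgt => /negP; apply.
  apply: lt_le_trans lt_w _; apply: weight_half => //=.
  rewrite leq_addr/= -addnn leq_add2l; apply: leq_trans ij; by rewrite -ltnS.
pose r m := Ordinal (qi m).
have rI : injective r.
  move=> m1 m2 /(congr1 val)/= /val_inj /perm_inj /(congr1 val)/= /addnI; exact: val_inj.
by have := leq_card r rI; rewrite !card_ord ltnn.
Qed.

(** The sorted comparison is transferred by permuting v with the inverse of the sorting permutation,
    which does not change its norm in X. *)
Lemma maxweight_test v : (forall i, (i < 2 ^ n)%N -> (0 <= v i)%R) ->
  (\sum_(i < 2 ^ n) maxweight I n k i / N * v i)%R%:E <= CB%:E * rhoX (step n v).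
Proof.
move=> v0; have mv := Mplus_step v0.
have [p hp] := exists_sorting_perm (fun i : 'I_(2 ^ n) => weight I n k i).
have hmax := maxweight_le_sorted hp.
pose v' j := natf (\row_i v ((p^-1)%g i) : 'rV[R]_(2 ^ n)) j.
have v'E (i : 'I_(2 ^ n)) : v' i = v ((p^-1)%g i) by rewrite /v' natfE mxE.
have v'0 i : (i < 2 ^ n)%N -> (0 <= v' i)%R.
  by move=> iN; rewrite -[i]/(nat_of_ord (Ordinal iN)) v'E v0.
have rv' : rhoX (step n v') = rhoX (step n v).
  apply: ri_eq_fstar => //; first exact: Mplus_step.
  exact: (@fstar_step_perm _ _ _ _ (p^-1)%g).
have h1 := weight_test v'0; rewrite rv' in h1.
have h2 : (\sum_(i < 2 ^ n) v i / N)%:E <= CX%:E * rhoX (step n v).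
  apply: le_trans (hCX mv); rewrite (integral_Dom_sum n)// -sumEFin; apply: lee_sum => i _.
  by rewrite integral_cell_step.
have E : (\sum_(i < 2 ^ n) weight I n k i * v' i / N =
          \sum_(i < 2 ^ n) weight I n k (p i) * v i / N)%R.
  rewrite (reindex_inj (@perm_inj _ p))/=; apply: eq_bigr => i _.
  by rewrite v'E permK.
rewrite E in h1.
apply: (@le_trans _ _ (2%:E * (\sum_(i < 2 ^ n) weight I n k (p i) * v i / N)%:E +
    (2 / c * MY)%:E * (\sum_(i < 2 ^ n) v i / N)%:E)).
  rewrite -!EFinM -EFinD lee_fin !mulr_sumr -big_split/=; apply: ler_sum => i _.
  have := ler_wpM2r (_ : 0 <= v i / N)%R (hmax i).
  rewrite divr_ge0 ?v0// ?(ltW N0)// => /(_ isT) h.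
  have -> : (maxweight I n k i / N * v i = maxweight I n k i * (v i / N))%R by rewrite mulrA mulrAC.
  by apply: le_trans h _; rewrite mulrDl !mulrA.
have c1 : (0 <= 4 * CH)%R by rewrite mulr_ge0// ltW.
have c2 : (0 <= 2 / c * MY * CX)%R by rewrite !mulr_ge0 ?invr_ge0// ltW.
rewrite (_ : CB%:E = (4 * CH)%:E + (2 / c * MY * CX)%:E)// ge0_muleDl ?lee_fin//.
apply: leeD.
  rewrite (_ : 4 * CH = 2 * (2 * CH))%R; last by ring.
  by rewrite EFinM -muleA; apply: lee_wpmul2l.
rewrite [(_ * CX)%R%:E]EFinM -muleA; apply: lee_wpmul2l => //.
by rewrite lee_fin mulr_ge0// divr_ge0// ltW.
Qed.

(** The factor 2 pays for S_I g <= 2 g, and CB for [maxweight_test]; so normalised, g becomes an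
    admissible competitor. *)
Let gam : R := (2 * CB)^-1%R.
Let gam0 : (0 < gam)%R. Proof. by rewrite invr_gt0 mulr_gt0. Qed.

Let gv i := (gam * maxweight I n k i)%R.
Let g := step n gv.

Let gv0 i : (0 <= gv i)%R.
Proof. by rewrite mulr_ge0 ?maxweight_ge0// ltW. Qed.

Let mg : Mplus g. Proof. by apply: Mplus_step => i _; exact: gv0. Qed.

Let fg t : Dom t -> fstar g t = g t.
Proof.
move=> Dt; apply: fstar_step_nonincr => // i j /andP[ij _].
by rewrite ler_wpM2l ?maxweight_nonincr// ltW.
Qed.

Lemma S_op_maxweight_le t : Dom t -> S_op I g t <= 2%:E * g t.
Proof.
move=> Dt; have It := I_gt0 hI Dt.
rewrite /S_op lee_pdivrMl//; apply: (@phiE_lub _ I g t) => // s Ds st.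
have [cs sN] := Dom_cell n Ds; have [ct tN] := Dom_cell n Dt.
rewrite fg// /g (step_cell _ cs) (step_cell _ ct) -!EFinM lee_fin /gv.
have := I_maxweight_le hI k0 Ds Dt st cs ct tN.
move/(ler_wpM2l (ltW gam0)); lra.
Qed.

Lemma assoc_norm_maxweight : assoc_norm rhoX (S_op I g) <= 1.
Proof.
apply: ge_ereal_sup => _ [h [mh h1] <-].
have mS : Mplus (S_op I g) by exact: Mplus_S_op.
have m2 := MplusM mh mg.
apply: (@le_trans _ _ (2%:E * \int[mu]_(x in Dom) (h x * g x))).
  rewrite -ge0_integralZl//; [|exact: measurable_Dom|exact: m2.1|exact: m2.2].
  apply: le_integral_Dom; [exact: MplusM|by apply: MplusZ|].
  move=> x Dx; rewrite [leRHS]muleCA; apply: lee_wpmul2l; first exact: mh.2.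
  exact: S_op_maxweight_le.
have mw0 i : (i < 2 ^ n)%N -> (0 <= maxweight I n k i / N)%R.
  by move=> _; rewrite divr_ge0 ?maxweight_ge0// ltW.
have mwn i j : (i <= j < 2 ^ n)%N -> (maxweight I n k j / N <= maxweight I n k i / N)%R.
  by move=> /andP[ij _]; rewrite ler_wpM2r ?invr_ge0 ?(ltW N0)// maxweight_nonincr.
have := step_dual_le hX CB0 mw0 mwn maxweight_test mh.
set w := step _ _ => hw.
have gw x : g x = gam%:E * w x.
  by rewrite /g /w /step -EFinM divfK// gt_eqF.
have mw : Mplus w.
  by apply: Mplus_step => i iN; rewrite mulr_ge0 ?mw0// ltW.
have mhw := MplusM mh mw.
under eq_integral => x _ do rewrite gw muleCA.
rewrite ge0_integralZl//; [|exact: measurable_Dom|exact: mhw.1|exact: mhw.2|by rewrite lee_fin ltW].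
rewrite muleA -EFinM; apply: le_trans (lee_wpmul2l _ hw) _; first by rewrite lee_fin mulr_ge0// ltW.
rewrite muleA -EFinM.
have -> : (2 * gam * CB = 1)%R by rewrite /gam; field; rewrite gt_eqF.
by rewrite mul1e.
Qed.

Definition stieltjes_sup f : \bar R :=
  ereal_sup [set stieltjes_neg (fstar f) (fun t => (I t)%:E * fstar g t) |
    g in [set g | Mplus g /\ assoc_norm rhoX (S_op I g) <= 1]].

Lemma sum_prim_le f : Mplus f -> \int[mu]_(x in Dom) f x < +oo ->
  (\sum_(i < (2 ^ n).-1) prim k i * (fstarr f (dy n i) - fstarr f (dy n i.+1)))%R%:E
    <= (2 * CB)%:E * stieltjes_sup f.
Proof.
move=> mf ff.
have [G GE] := exists_cumulative mf ff (@dy_gt0 R n 0).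
have GE' : cumul_of f G (dy n 1) by move=> t at' _; exact: GE.
have d1 : (@dy R n 1 < 1)%R.
  by rewrite -(dy1 n) dy_lt -[1%N](expn0 2) ltn_exp2l.
have mI : Mplus (fun t => (I t)%:E).
  split; last by move=> x Dx; rewrite lee_fin ltW// I_gt0.
  apply: nondecr_emeasurable; first exact: Dom_interval.
  by move=> s t Ds Dt st; rewrite lee_fin I_mono.
have mu' : Mplus (fun t => (I t)%:E * fstar g t) by apply: MplusM => //; exact: Mplus_fstar.
(* Cut to 0 past 2^n, where the sign of [k] is unknown while [stieltjes_ge_sum] asks for
   nonnegativity at every index. *)
pose D i := (if (i <= 2 ^ n)%N then gam * prim k i else 0)%R.
have D0 i : (0 <= D i)%R.
  rewrite /D; case: ifP => // iN; rewrite mulr_ge0 ?(ltW gam0)//.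
  exact: (prim_ge0 k0 iN).
have := @stieltjes_ge_sum _ f G n D _ mf ff GE' mu' _ D0.
have -> : D 0%N = 0%R by rewrite /D /= /prim big_ord0 mulr0.
move=> /(_ erefl) h.
have {}h : (\sum_(i < (2 ^ n).-1) D i * (fstarr f (dy n i) - fstarr f (dy n i.+1)))%R%:E <=
    \int[lebesgue_stieltjes_measure G]_(x in `]dy n 1, 1%R[) ((I x)%:E * fstar g x).
  apply: h => i t i0 iN Dt; rewrite /cell_oc /= in_itv/= => /andP[it ti].
  (* The right-open cell of t has index i' equal to i, or to i + 1 when t is a node; i <= i' is all
     that matters. *)
  have [ct tN] := Dom_cell n Dt; set i' := Num.truncn _ in ct tN.
  have /= := ct.2; rewrite in_itv/= => /andP[i't ti'].
  have ii' : (i <= i')%N by have := lt_trans it ti'; rewrite dy_lt ltnS.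
  rewrite /D (ltnW (ltnW iN)) fg// /g (step_cell _ ct) -EFinM lee_fin /gv.
  have i'N : (0 < i' < 2 ^ n)%N by rewrite tN andbT (leq_trans i0).
  have h1 := prim_le_maxweight hI k0 i'N Dt i't.
  have h2 : (prim k i <= prim k i')%R by apply: (prim_mono k0); rewrite ii' ltnW.
  have := ler_wpM2l (ltW gam0) (le_trans h2 h1); lra.
have hT : \int[lebesgue_stieltjes_measure G]_(x in `]dy n 1, 1%R[) ((I x)%:E * fstar g x)
    <= stieltjes_sup f.
  apply: (@le_trans _ _ (stieltjes_neg (fstar f) (fun t => (I t)%:E * fstar g t))).
    rewrite /stieltjes_neg le_max; apply/orP; right; apply: ereal_sup_ubound.
    by exists (dy n 1), G; split => //; rewrite dy_gt0.
  by apply: ereal_sup_ubound; exists g => //; split; [exact: mg|exact: assoc_norm_maxweight].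
rewrite -lee_pdivrMl ?mulr_gt0//; apply: le_trans (le_trans h hT).
rewrite -EFinM lee_fin mulr_sumr; apply: ler_sum => i _.
by rewrite /D mulrA (leq_trans (ltnW (ltn_ord i)) (leq_pred _)).
Qed.

Lemma norming_sum_le f : Mplus f -> \int[mu]_(x in Dom) f x < +oo ->
  (\sum_(i < 2 ^ n) k i * smp n f i)%R%:E <=
    (2 * CB)%:E * stieltjes_sup f + (2 * MY)%:E * \int[mu]_(x in Dom) f x.
Proof.
move=> mf ff.
have := abel_sum (2 ^ n) k (fun i => fstarr f (dy n i)).
rewrite dy1 fstarr1// mulr0 subr0 => <-.
have split_last (M : nat) (F : nat -> R) : (0 < M)%N ->
    (\sum_(i < M) F i = \sum_(i < M.-1) F i + F M.-1)%R.
  by case: M => // M _; rewrite big_ord_recr.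
have N1 : (2 ^ n = (2 ^ n).-1.+1)%N by rewrite prednK// expn_gt0.
rewrite (split_last _ (fun i => prim k i * (fstarr f (dy n i) - fstarr f (dy n i.+1)))%R) ?expn_gt0//.
rewrite -N1 dy1 fstarr1// subr0 EFinD.
apply: leeD; first exact: sum_prim_le.
(* The last cell, which the Stieltjes integral misses: its left node is at least 1/2 because n > 0,
   so f^* there is at most 2 ||f||_1. *)
set m := (2 ^ n).-1.
have mN : (m < 2 ^ n)%N by rewrite N1.
have mh : (2^-1 <= @dy R n m)%R.
  rewrite /dy ler_pdivlMr ?exp2_gt0// ler_pdivrMl ?ltr0n// -natrM ler_nat /m.
  have : (2 <= 2 ^ n)%N by rewrite -{1}(expn1 2) leq_exp2l.
  lia.
have E : (fstarr f (dy n m))%:E <= 2%:E * \int[mu]_(x in Dom) f x.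
  have m0 : (0 < @dy R n m)%R by apply: lt_le_trans mh; rewrite invr_gt0.
  rewrite fineK; last exact: fstar_fin_gt0.
  rewrite -lee_pdivrMl//; apply: le_trans (@fstar_le_integral _ _ (dy n m) mf _); last first.
    by rewrite m0 dy_le1// ltnW.
  by apply: lee_wpmul2r; [exact: fstar_ge0|rewrite lee_fin].
rewrite mulrC EFinM; apply: le_trans (lee_wpmul2r _ E) _.
  by rewrite lee_fin; exact: (prim_ge0 k0 (ltnW mN)).
rewrite muleAC -EFinM; apply: lee_wpmul2r; first by apply: integral_ge0; exact: mf.2.
rewrite lee_fin ler_wpM2l//; apply: le_trans prim_total_le.
by apply: (prim_mono k0); rewrite leqnn ltnW.
Qed.

End upper_embedding.

(** * The two inequalities between the target norm and the Stieltjes expression *)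

Section conclusion.
Context {R : realType} (I : R -> R) (hI : quasiconcave I).
Variables (rhoX rhoY : (R -> \bar R) -> \bar R) (hX : ri_norm rhoX) (hY : ri_norm rhoY).
Local Notation mu := (@lebesgue_measure R).
Local Notation Dom := (@Dom R).
Implicit Types (f : R -> \bar R).

Lemma stieltjes_sup_ge0 f : 0 <= stieltjes_sup I rhoX f.
Proof.
have m0 : Mplus (cst 0 : R -> \bar R) := Mplus_cst (lexx 0%R).
have S0 t : Dom t -> S_op I (cst 0) t = 0.
  move=> Dt; have {2}<- : (I t)^-1%:E * 0 = 0 by rewrite mule0.
  congr (_ * _); apply/eqP; rewrite eq_le (phiE_ge0 hI _ Dt) andbT.
  apply: phiE_lub => // s /DomP/andP[/ltW s0 _] _.
  by rewrite fstar_cst0 ?mule0.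
apply: le_trans (_ : stieltjes_neg (fstar f) (fun t => (I t)%:E * fstar (cst 0) t) <= _).
  by rewrite /stieltjes_neg le_max lexx.
apply: ereal_sup_ubound; exists (cst 0) => //; split => //.
apply: ge_ereal_sup => _ [h _ <-]; rewrite integral0_eq// => x Dx.
by rewrite S0// mule0.
Qed.

Lemma rhs_le_target (C : R) : (0 < C)%R ->
  (forall f, Mplus f -> rhoZ I rhoX f <= C%:E * rhoY f) ->
  forall f, Mplus f -> rhs_norm I rhoX f <= (9 * C)%:E * rhoY f.
Proof.
move=> C0 ZY f mf; have [M aM] := admissible_shifted hI hX.
have [fy|ff] := eqVneq (\int[mu]_(x in Dom) f x) +oo.
  by rewrite (ri_pinfty hY mf fy) gt0_muley ?leey// lte_fin mulr_gt0.
rewrite -ltey in ff.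
have Z0 : 0 <= rhoZ I rhoX f by exact: (sup_norm_ge0 aM mf).
rewrite EFinM -muleA; apply: le_trans (lee_wpmul2l _ (ZY f mf)) => //.
(* 8 for the Stieltjes term and 1 for ||f||_1, which lies below the norm of Z. *)
rewrite (_ : 9 = 8 + 1)%R; last by ring.
rewrite EFinD ge0_muleDl// mul1e; apply: leeD; last exact: (integral_le_sup_norm aM mf).
apply: ge_ereal_sup => _ [g [mg hg] <-]; exact: stieltjes_le_rhoZ.
Qed.

Variables (CH : R) (CH0 : (0 < CH)%R).
Hypothesis hH : forall f, Mplus f -> rhoY (H_op I f) <= CH%:E * rhoX f.
Variables (CX : R) (CX0 : (0 < CX)%R).
Hypothesis hCX : forall f, Mplus f -> \int[mu]_(x in Dom) f x <= CX%:E * rhoX f.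
Variables (MY : R) (hMY : rhoY (cst 1) = MY%:E).

Let CB : R := (4 * CH + 2 / I 2^-1 * MY * CX)%R.

Lemma smp_nonincr n f i j : Mplus f -> \int[mu]_(x in Dom) f x < +oo ->
  (i <= j < 2 ^ n)%N -> (smp n f j <= smp n f i)%R.
Proof.
move=> mf ff /andP[ij jN]; rewrite -lee_fin !smpE//; last exact: leq_ltn_trans jN.
by apply: fstar_nonincr; rewrite dy_le ltnS.
Qed.

(* A small linear perturbation makes the sampled values strictly decreasing. *)
Lemma target_smp_le n f : (0 < n)%N -> Mplus f -> \int[mu]_(x in Dom) f x < +oo ->
  rhoY (step n (smp n f)) <=
    (2 * CB)%:E * stieltjes_sup I rhoX f + (2 * MY)%:E * \int[mu]_(x in Dom) f x.
Proof.
move=> n0 mf ff; apply/lee_addgt0Pr => d d0.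
have MY0 : (0 <= MY)%R by rewrite -lee_fin -hMY; apply: (ri_ge0 hY); exact: (Mplus_cst ler01).
(* The perturbation costs at most [e] times the total mass of [k], hence at most [e * MY <= d]. *)
pose e := (d / (MY + 1))%R.
have e0 : (0 < e)%R by rewrite divr_gt0// ltr_wpDl.
pose b i := (smp n f i + e * (1 - dy n i))%R.
have dle i : (i < 2 ^ n)%N -> (0 <= 1 - @dy R n i)%R.
  by move=> iN; rewrite subr_ge0 dy_le1// ltnW.
have b0 i : (i < 2 ^ n)%N -> (0 <= b i)%R.
  by move=> iN; rewrite addr_ge0 ?smp_ge0// mulr_ge0 ?dle// ltW.
have bdec i j : (i < j < 2 ^ n)%N -> (b j < b i)%R.
  move=> /andP[ij jN]; apply: ler_ltD; first by apply: smp_nonincr; rewrite // (ltnW ij).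
  by rewrite ltr_pM2l// ltrD2l ltrN2 dy_lt.
have [k [k0 kn kv kb]] := step_norming hY b0 bdec.
have smp0 i : (i < 2 ^ n)%N -> (0 <= smp n f i)%R by move=> _; exact: smp_ge0.
have le_b : rhoY (step n (smp n f)) <= rhoY (step n b).
  apply: (ri_le hY); [exact: Mplus_step|exact: Mplus_step|].
  move=> x Dx; have [_ xN] := Dom_cell n Dx; rewrite lee_fin /b lerDl.
  by rewrite mulr_ge0 ?dle// ltW.
apply: le_trans le_b _; apply: le_trans kb _.
have -> : (\sum_(i < 2 ^ n) k i * b i =
    \sum_(i < 2 ^ n) k i * smp n f i + e * \sum_(i < 2 ^ n) k i * (1 - dy n i))%R.
  rewrite mulr_sumr -big_split/=; apply: eq_bigr => i _; rewrite /b; ring.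
rewrite EFinD; apply: leeD.
  exact: (norming_sum_le hI hX hY CH0 hH CX0 hCX hMY n0 k0 kn kv mf ff).
rewrite lee_fin; have h : (\sum_(i < 2 ^ n) k i * (1 - dy n i) <= MY)%R.
  apply: le_trans (prim_total_le hMY kv); apply: ler_sum => i _.
  by rewrite -[leRHS]mulr1; apply: ler_wpM2l; rewrite ?k0// gerBl dy_ge0.
apply: le_trans (ler_wpM2l (ltW e0) h) _.
by rewrite /e mulrAC ler_pdivrMr ?ltr_wpDl// ler_wpM2l ?(ltW d0)// lerDl.
Qed.

Lemma target_le_rhs : exists C : R, (0 < C)%R /\
  forall f, Mplus f -> rhoY f <= C%:E * rhs_norm I rhoX f.
Proof.
have MY0 : (0 <= MY)%R by rewrite -lee_fin -hMY; apply: (ri_ge0 hY); exact: (Mplus_cst ler01).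
have c0 := I_gt0 hI (@half_Dom R).
have CB0 : (0 < CB)%R.
  have h1 : (0 < 4 * CH)%R by rewrite mulr_gt0.
  have h2 : (0 <= 2 / I 2^-1 * MY * CX)%R by rewrite !mulr_ge0 ?invr_ge0// ltW.
  by rewrite /CB; lra.
exists (2 * CB + 2 * MY)%R; split; first by lra.
move=> f mf; have T0 := stieltjes_sup_ge0 f.
have C0 : (0 < 2 * CB + 2 * MY)%R by lra.
have f0 : 0 <= \int[mu]_(x in Dom) f x by apply: integral_ge0; exact: mf.2.
rewrite /rhs_norm -/(stieltjes_sup I rhoX f).
have [fy|ff] := eqVneq (\int[mu]_(x in Dom) f x) +oo.
  by rewrite fy addey ?gt0_muley ?leey// gt_eqF// (lt_le_trans _ T0).
rewrite -ltey in ff; have mfs := Mplus_fstar f.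
pose F n := step n (smp n f).
have mF n : Mplus (F n) by apply: Mplus_step => i _; exact: smp_ge0.
have [|nd cv] := ri_cvg hY mF mfs.
  by apply: aeW => x Dx; split; [exact: step_smp_nd|exact: step_smp_cvg].
rewrite (ri_fstar hY mf) (nondecreasing_cvg_ereal_sup nd cv).
(* One refinement more, so that the level is positive and there is a node inside (0,1). *)
apply: ge_ereal_sup => _ [n _ <-]; apply: le_trans (nd _ _ (leqnSn n)) _.
apply: le_trans (target_smp_le (ltn0Sn n) mf ff) _.
rewrite [leRHS](ge0_muleDr _ T0 f0); apply: leeD; apply: lee_wpmul2r => //; rewrite lee_fin; lra.
Qed.

End conclusion.

Theorem theorem1p1 (R : realType) (I : R -> R)
  (hI : quasiconcave I)
  (hint : exists C : R, (0 < C)%R /\ forall t : R, Dom t ->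
     \int[@lebesgue_measure R]_(s in `]0%R, t[) ((I s / s)%R)%:E <= (C * I t)%:E)
  (rhoX rhoY : (R -> \bar R) -> \bar R)
  (hX : ri_norm rhoX)
  (hY : optimal_target I rhoX rhoY) :
  exists C : R, (0 < C)%R /\ forall f : R -> \bar R, Mplus f ->
    rhoY f <= C%:E * rhs_norm I rhoX f /\ rhs_norm I rhoX f <= C%:E * rhoY f.
Proof.
have [hYn [CH [CH0 hH]] emb] := hY.
(* Optimality of Y enters here, tested on the space Z. *)
have [C1 [C10 hC1]] := emb _ (ri_norm_rhoZ hI hX) (H_bounded_rhoZ hI hX).
have [CX [CX0 hCX]] := ri_int hX.
have [MY hMY] := rhoX1_real hYn.
have [C2 [C20 hC2]] := target_le_rhs hI hX hYn CH0 hH CX0 hCX hMY.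
exists (C2 + 9 * C1)%R; split; first by rewrite addr_gt0// mulr_gt0.
have C90 : (0 <= 9 * C1)%R by rewrite mulr_ge0// ltW.
move=> f mf; split.
  apply: le_trans (hC2 f mf) _; apply: lee_wpmul2r; last by rewrite lee_fin lerDl.
  by apply: adde_ge0; [exact: (stieltjes_sup_ge0 hI)|apply: integral_ge0; exact: mf.2].
apply: le_trans (rhs_le_target hI hX hYn C10 hC1 mf) _.
by apply: lee_wpmul2r; [exact: (ri_ge0 hYn)|rewrite lee_fin lerDr ltW].
Qed.
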